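(* Let $d\ge1$ and let $\mu\in\mathcal{P}(\mathbb{R}^d)\cap L^\infty(\mathbb{R}^d)$ be compactly supported. Let $(\rho_{0,n})_{n\ge1}\subset\mathcal{P}(\mathbb{R}^d)\cap L^\infty(\mathbb{R}^d)$ be compactly supported probability densities with $$\sup_n\|\rho_{0,n}\|_{L^\infty}<\infty,\qquad\sup_n\operatorname{diam}(\operatorname{supp}\rho_{0,n})<\infty,\qquad D_n:=\operatorname{dist}(\operatorname{supp}\rho_{0,n},\operatorname{supp}\mu)\to\infty,$$ and let $\rho_{n,t}$ be the corresponding bounded solutions of $\partial_t\rho-\operatorname{div}(\rho\nabla g*(\rho-\mu))=0$. Let $c_0>0$ and $n_0$ be the persistence constants described in the context. Then there are times $t_n\in(0,c_0D_n)$, $n\ge n_0$, and a constant $C<\infty$, independent of $n$, such that $$\frac{\mathsf{D}(\rho_{n,t_n}\mid\mu)}{\mathrm{MMD}^2(\rho_{n,t_n},\mu)}\le\frac{C}{D_n}\longrightarrow0.$$ In particular, no positive constant depending only on $d$, $\mu$, and a common $L^\infty$ bound can yield a PL inequality on the class of compactly supported bounded probability densities: there is no function $c=c_{d,\mu}:(0,\infty)\to(0,\infty)$ such that $\mathsf{D}(\rho\mid\mu)\ge c(M)\,\mathrm{MMD}^2(\rho,\mu)$ for every $M>0$ and every compactly supported probability density $\rho$ on $\mathbb{R}^d$ with $\|\rho\|_{L^\infty}\le M$.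
   Context: $\mathcal{P}(\mathbb{R}^d)$ is the set of Borel probability measures, identified with densities when absolutely continuous. $g$ is the Coulomb kernel on $\mathbb{R}^d$: $g(x)=-\frac12|x|$ for $d=1$, $g(x)=-\frac1{2\pi}\log|x|$ for $d=2$, $g(x)=\frac1{(d-2)\sigma_d}|x|^{2-d}$ for $d\ge3$, $\sigma_d=|\mathbb{S}^{d-1}|$. $\mathrm{MMD}^2(\rho,\mu):=\frac12\int g*(\rho-\mu)\,d(\rho-\mu)$ and $\mathsf{D}(\rho\mid\mu):=\int|\nabla g*(\rho-\mu)|^2\,d\rho$. The bounded solution with initial datum $\rho_0\in\mathcal{P}\cap L^\infty$ is the unique global weak solution in $L^\infty_{\mathrm{loc}}([0,\infty);L^\infty(\mathbb{R}^d))$ (taken narrowly continuous in time), i.e. the unique curve $\rho:[0,\infty)\to\mathcal{P}(\mathbb{R}^d)$ in that class such that, with $v_t=-\nabla g*(\rho_t-\mu)$, for every $T>0$ and every $\varphi\in C_c^\infty([0,T)\times\mathbb{R}^d)$: $\int_0^T\int(\partial_t\varphi+v_t\cdot\nabla\varphi)\,d\rho_t\,dt+\int\varphi(0,x)\,d\rho_0(x)=0$. Persistence constants: let $\Phi_d(D)=D$ if $d=1$, $\log D$ if $d=2$, $1$ if $d\ge3$ (for $D\ge2$). The numbers $c_0,c_1,C_1>0$ and $n_0\in\mathbb{N}$ are constants, existing for every family as in the claim, such that for all $n\ge n_0$ and $0\le t\le c_0D_n$: $c_1\Phi_d(D_n)\le\mathrm{MMD}^2(\rho_{n,t},\mu)\le\mathrm{MMD}^2(\rho_{0,n},\mu)\le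 C_1\Phi_d(D_n)$. *)

(* Defs.v *)
From HB Require Import structures.
From mathcomp Require Import all_boot all_order all_algebra.
From mathcomp Require Import all_classical all_reals all_analysis.
From mathcomp Require Import measurable_realfun.
Import Order.TTheory GRing.Theory Num.Theory.
Import numFieldNormedType.Exports.

Set Implicit Arguments.
Unset Strict Implicit.
Unset Printing Implicit Defensive.

Local Open Scope classical_set_scope.
Local Open Scope ring_scope.

(* The Borel sigma-algebra on R^d = 'rV[R]_d.  The library norm on 'rV[R]_d is
   the sup norm; it induces the usual topology, but metric notions below use the
   Euclidean norm enorm. *)
Section borel.
Context (R : realType) (d : nat).

Let B0 : <<s (@open 'rV[R]_d) >> set0.
Proof. exact: sigma_algebra0. Qed.

Let BC A : <<s (@open 'rV[R]_d) >> A -> <<s (@open 'rV[R]_d) >> (~` A).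
Proof. exact: sigma_algebraC. Qed.

Let Bbigcup (F : (set 'rV[R]_d)^nat) :
  (forall i, <<s (@open 'rV[R]_d) >> (F i)) ->
  <<s (@open 'rV[R]_d) >> (\bigcup_i F i).
Proof. exact: sigma_algebra_bigcup. Qed.

HB.instance Definition _ :=
  @isMeasurable.Build default_measure_display 'rV[R]_d _ B0 BC Bbigcup.

Lemma rV_open_measurable (A : set 'rV[R]_d) : open A -> measurable A.
Proof. exact: sub_gen_smallest. Qed.

End borel.

Section rV_measurability.
Context (R : realType).

Lemma measurable_fun_rV_continuous (d d' : nat) (f : 'rV[R]_d -> 'rV[R]_d') :
  continuous f -> measurable_fun [set: 'rV[R]_d] f.
Proof.
move=> cf; apply: (@measurability _ _ _ _ _ _ (@open 'rV[R]_d')) => //.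
move=> _ [U oU <-].
by rewrite setTI; apply: rV_open_measurable; move/continuousP : cf; exact.
Qed.

Lemma measurable_fun_coord (d : nat) (i : 'I_d) :
  measurable_fun [set: 'rV[R]_d] (fun x : 'rV[R]_d => x 0 i).
Proof.
apply: (measurability _ (RGenOpens.measurableE R)) => _ [_ [a [b ->]] <-].
rewrite setTI; apply: rV_open_measurable.
apply: open_comp; last exact: interval_open.
by move=> x _; exact: coord_continuous.
Qed.

Lemma measurable_fun_rV (e : measure_display) (T : measurableType e) (d : nat)
    (f : T -> 'rV[R]_d) :
  (forall i, measurable_fun [set: T] (fun t => f t 0 i)) ->
  measurable_fun [set: T] f.
Proof.
move=> mf; apply: (@measurability _ _ _ _ _ _ (@open 'rV[R]_d)) => //.
move=> _ [U oU <-]; rewrite setTI.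
pose Q (p : 'rV[rat]_d * nat) : set 'rV[R]_d :=
  [set x | forall i, `|ratr (p.1 0 i) - x 0 i| < p.2.+1%:R^-1].
have -> : U = \bigcup_(p in [set p | Q p `<=` U]) Q p.
  apply/seteqP; split=> [x Ux|x [p /= pU Qx]]; last exact: pU.
  have : nbhs x U by exact: open_nbhs_nbhs.
  move=> /nbhs_ballP[r /= r0 rU].
  have [n nr] : exists n : nat, n.+1%:R^-1 < r / 2.
    have r20 : 0 < r / 2 by rewrite divr_gt0.
    by have /ltr_add_invr[k] := r20; rewrite add0r; exists k.
  have qx i : exists q : rat, `|ratr q - x 0 i| < n.+1%:R^-1 :> R.
    have n0 : (0 : R) < n.+1%:R^-1 by rewrite invr_gt0.
    have [q] := @rat_in_itvoo R (x 0 i - n.+1%:R^-1) (x 0 i + n.+1%:R^-1)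
      ltac:(by rewrite ltrBlDr -addrA ltrDl addr_gt0).
    rewrite in_itv/= => /andP[q1 q2]; exists q.
    by rewrite ltr_distl q1.
  exists (\row_i projT1 (cid (qx i)), n).
    move=> y /= Qy; apply: rU; split => // a i; rewrite (ord1 a) {a}.
    have := Qy i; rewrite mxE; case: cid => q /= qxi qyi.
    rewrite /ball/= (_ : x 0 i - y 0 i = (ratr q - y 0 i) - (ratr q - x 0 i)).
      apply: (le_lt_trans (ler_normB _ _)).
      by rewrite (splitr r) ltrD// (lt_trans _ nr).
    by rewrite opprB [RHS]addrC addrA subrK.
  by move=> i /=; rewrite mxE; case: cid.
rewrite preimage_bigcup bigcup_mkcond.
apply: countable_bigcupT_measurable => [|p]; first exact: countableP.
case: ifPn => // _.
rewrite [X in measurable X](_ : _ = \bigcap_(i in [set: 'I_d])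
    ((fun t => f t 0 i) @^-1` ball (ratr (p.1 0 i) : R) p.2.+1%:R^-1)).
  apply: fin_bigcap_measurable => [|i _]; first exact: finite_finset.
  rewrite -[X in measurable X]setTI; apply: mf => //.
  by apply: open_measurable; exact: ball_open.
by apply/seteqP; split=> t /= h i; [move=> _|]; exact: h.
Qed.

End rV_measurability.

Section lebesgue_rV.
Context (R : realType).

Definition rV_cons (d : nat) (p : measurableTypeR R * 'rV[R]_d) : 'rV[R]_d.+1 :=
  row_mx (p.1%:M : 'M[R]_1) p.2.

Definition rV_uncons (d : nat) (x : 'rV[R]_d.+1) : measurableTypeR R * 'rV[R]_d :=
  (x 0 0, \row_j x 0 (lift 0 j)).

Lemma rV_consE0 (d : nat) (p : measurableTypeR R * 'rV[R]_d) : rV_cons p 0 0 = p.1.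
Proof. by rewrite /rV_cons mxE; case: splitP => // j; rewrite (ord1 j) mxE. Qed.

Lemma rV_consEl (d : nat) (p : measurableTypeR R * 'rV[R]_d) (j : 'I_d) :
  rV_cons p 0 (lift 0 j) = p.2 0 j.
Proof.
rewrite /rV_cons mxE; case: splitP => [k|k /eqP]; first by rewrite (ord1 k).
by rewrite lift0 add1n eqSS => /eqP/val_inj <-.
Qed.

Lemma rV_consK (d : nat) : cancel (@rV_cons d) (@rV_uncons d).
Proof.
move=> p; rewrite /rV_uncons rV_consE0 [RHS]surjective_pairing; congr pair.
by apply/rowP => j; rewrite mxE rV_consEl.
Qed.

Lemma measurable_rV_cons (d : nat) :
  measurable_fun [set: measurableTypeR R * 'rV[R]_d] (@rV_cons d).
Proof.
apply: measurable_fun_rV => i; case: (unliftP 0 i) => [j ->|->].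
- under eq_fun do rewrite rV_consEl.
  apply: (measurableT_comp (measurable_fun_coord j)).
  exact: measurable_snd.
- by under eq_fun do rewrite rV_consE0; exact: measurable_fst.
Qed.

Lemma measurable_rV_uncons (d : nat) :
  measurable_fun [set: 'rV[R]_d.+1] (@rV_uncons d).
Proof.
apply: measurable_fun_pair; first exact: measurable_fun_coord.
apply: measurable_fun_rV => j; under eq_fun do rewrite mxE.
exact: measurable_fun_coord.
Qed.

HB.instance Definition _ (d : nat) :=
  isMeasurableFun.Build _ _ _ _ (@rV_cons d) (@measurable_rV_cons d).

Section cons_measure.
Context (d : nat) (m : {sigma_finite_measure set 'rV[R]_d -> \bar R}).

Definition cons_measure : set 'rV[R]_d.+1 -> \bar R :=
  pushforward ((@lebesgue_measure R) \x m)%E (@rV_cons d).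

Let cons_measure0 : cons_measure set0 = 0%E.
Proof. exact: measure0. Qed.

Let cons_measure_ge0 A : (0 <= cons_measure A)%E.
Proof. exact: measure_ge0. Qed.

Let cons_measure_sigma_additive : semi_sigma_additive cons_measure.
Proof. exact: measure_semi_sigma_additive. Qed.

HB.instance Definition _ := isMeasure.Build _ _ _ cons_measure
  cons_measure0 cons_measure_ge0 cons_measure_sigma_additive.

Let cons_measure_sigma_finite : sigma_finite setT cons_measure.
Proof.
have /sigma_finiteP[F [FT ndF Foo]] := sigma_finiteT (@lebesgue_measure R).
have /sigma_finiteP[G [GT ndG Goo]] := sigma_finiteT m.
exists (fun n => @rV_uncons d @^-1` (F n `*` G n)).
  rewrite -preimage_bigcup -[LHS](preimage_setT (@rV_uncons d)); congr preimage.
  apply/seteqP; split=> // -[x y] _.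
  have [/= n _ Fn] : (\bigcup_i F i) x by rewrite -FT.
  have [/= k _ Gk] : (\bigcup_i G i) y by rewrite -GT.
  exists (maxn n k) => //; split.
    by move: x Fn; exact/subsetPset/ndF/leq_maxl.
  by move: y Gk; exact/subsetPset/ndG/leq_maxr.
move=> n; have [mF Fn] := Foo n; have [mG Gn] := Goo n; split.
  rewrite -[X in measurable X]setTI; apply: measurable_rV_uncons => //.
  exact: measurableX.
rewrite /cons_measure /pushforward -comp_preimage.
rewrite (_ : _ @^-1` _ = F n `*` G n); last first.
  rewrite (_ : _ \o _ = id) ?preimage_id//.
  by apply/funext => p /=; exact: rV_consK.
by rewrite product_measure1E// lte_mul_pinfty// ge0_fin_numE.
Qed.

HB.instance Definition _ := Measure_isSigmaFinite.Build _ _ _ cons_measure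
  cons_measure_sigma_finite.

End cons_measure.

(* Lebesgue measure on R^d: the d-fold product of Lebesgue measure on R. *)
Fixpoint leb (d : nat) : {sigma_finite_measure set 'rV[R]_d -> \bar R} :=
  match d with
  | 0 => dirac (0 : 'rV[R]_0)
  | d'.+1 => cons_measure (leb d')
  end.

Lemma leb_box (d : nat) (A : 'I_d -> set (measurableTypeR R)) :
  (forall i, measurable (A i)) ->
  leb d [set x | forall i, A i (x 0 i)] =
  (\prod_(i < d) lebesgue_measure (A i))%E.
Proof.
elim: d A => [|d IH] A mA.
  by rewrite big_ord0 /= diracE mem_set// => -[].
rewrite big_ord_recl -(IH (fun i => A (lift ord0 i)))//= /cons_measure.
rewrite /pushforward.
have -> : @rV_cons d @^-1` [set x : 'rV[R]_d.+1 | forall i, A i (x 0 i)] =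
    A ord0 `*` [set x : 'rV[R]_d | forall i, A (lift ord0 i) (x 0 i)].
  apply/seteqP; split=> p /=.
  - move=> h; split; first by have := h ord0; rewrite rV_consE0.
    by move=> i; have := h (lift ord0 i); rewrite rV_consEl.
  - move=> [h0 h] i; case: (unliftP ord0 i) => [j ->|->].
      by rewrite rV_consEl.
    by rewrite rV_consE0.
apply: product_measure1E => //.
rewrite (_ : mkset _ = \bigcap_(i in [set: 'I_d])
    ((fun x : 'rV[R]_d => x 0 i) @^-1` A (lift ord0 i))).
  apply: fin_bigcap_measurable => [|i _]; first exact: finite_finset.
  rewrite -[X in measurable X]setTI.
  exact: (@measurable_fun_coord R d i measurableT _ (mA _)).
by apply/seteqP; split=> x /= h i; [move=> _|]; exact: h.
Qed.

End lebesgue_rV.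

Section euclidean.
Context (R : realType) (d : nat).

Definition enorm (x : 'rV[R]_d) : R := Num.sqrt (\sum_i x 0 i ^+ 2).

Definition set_diam (A : set 'rV[R]_d) : \bar R :=
  ereal_sup [set (enorm (x - y))%:E | x in A & y in A].

Definition set_dist (A B : set 'rV[R]_d) : R :=
  inf [set enorm (x - y) | x in A & y in B].

Definition unit_sphere : set 'rV[R]_d := [set x | enorm x = 1].

Definition cone (E : set 'rV[R]_d) : set 'rV[R]_d :=
  [set r *: x | r in `]0, 1]%classic & x in E].

(* Surface measure on the unit sphere, defined in polar coordinates. *)
Definition sphere_measure (E : set 'rV[R]_d) : \bar R :=
  (d%:R%:E * leb R d (cone E))%E.

(* sigma_d = |S^(d-1)| *)
Definition sphere_area : R := fine (sphere_measure unit_sphere).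

(* The value at the origin is irrelevant: it only enters integrals against
   product measures that do not charge the diagonal. *)
Definition coulomb (x : 'rV[R]_d) : R :=
  match d with
  | 1 => - (enorm x / 2)
  | 2 => - (ln (enorm x) / (2 * pi))
  | _ => ((d - 2)%N%:R * sphere_area)^-1 * enorm x ^- (d - 2)
  end.

Definition gradient (f : 'rV[R]_d -> R) (x : 'rV[R]_d) : 'rV[R]_d :=
  \row_i 'D_(delta_mx 0 i) f x.

End euclidean.

Section measures.
Context (R : realType) (d : nat).
Implicit Types rho mu : probability 'rV[R]_d R.

Definition has_density rho (f : 'rV[R]_d -> R) : Prop :=
  [/\ measurable_fun [set: 'rV[R]_d] f, forall x, 0 <= f x &
      forall A, measurable A -> rho A = (\int[leb R d]_(x in A) (f x)%:E)%E].

(* Densities are unique almost everywhere, so the infimum is over at most one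
   value; it is +oo when rho is not absolutely continuous. *)
Definition Linfty_norm rho : \bar R :=
  ereal_inf [set ('N[leb R d]_+oo [EFin \o f])%E | f in has_density rho].

Definition supp rho : set 'rV[R]_d :=
  [set x | forall U, open U -> U x -> (0 < rho U)%E].

(* g * (rho - mu) *)
Definition potential rho mu (x : 'rV[R]_d) : \bar R :=
  (\int[rho]_y (coulomb (x - y))%:E - \int[mu]_y (coulomb (x - y))%:E)%E.

(* (grad g) * (rho - mu) *)
Definition field rho mu (x : 'rV[R]_d) : 'rV[R]_d :=
  \row_i (\int[rho]_y (gradient (@coulomb R d) (x - y) 0 i)
          - \int[mu]_y (gradient (@coulomb R d) (x - y) 0 i)).

Definition MMD2 rho mu : \bar R :=
  (2^-1%:E * (\int[rho]_x potential rho mu x - \int[mu]_x potential rho mu x))%E.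

Definition dissipation rho mu : \bar R :=
  (\int[rho]_x (enorm (field rho mu x) ^+ 2)%:E)%E.

End measures.

Section smooth.
Context (R : realType) (V : normedModType R).

Fixpoint Ck (k : nat) (f : V -> R) : Prop :=
  match k with
  | 0 => continuous f
  | k'.+1 => (forall x, differentiable f x) /\
             (forall v, Ck k' (fun x => 'D_v f x))
  end.

Definition smooth (f : V -> R) : Prop := forall k, Ck k f.

End smooth.

Section evolution.
Context (R : realType) (d : nat).
Implicit Types (mu : probability 'rV[R]_d R) (rho : R -> probability 'rV[R]_d R).

(* C_c^oo([0, T) x R^d), as restrictions of functions in
   C_c^oo((-oo, T) x R^d). *)
Definition test_function (T : R) (phi : R * 'rV[R]_d -> R) : Prop :=
  [/\ smooth (phi : (R^o * 'rV[R]_d)%type -> R),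
      compact (closure [set p | phi p != 0]) &
      closure [set p | phi p != 0] `<=` [set p | p.1 < T]].

Definition dt (phi : R * 'rV[R]_d -> R) (p : R * 'rV[R]_d) : R :=
  'D_((1, 0) : (R^o * 'rV[R]_d)%type) (phi : (R^o * 'rV[R]_d)%type -> R) p.

Definition dotp (x y : 'rV[R]_d) : R := \sum_i x 0 i * y 0 i.

Definition velocity (rho mu : probability 'rV[R]_d R) (x : 'rV[R]_d) :
  'rV[R]_d := - field rho mu x.

Definition weak_solution mu (rho0 : probability 'rV[R]_d R) rho : Prop :=
  forall (T : R) (phi : R * 'rV[R]_d -> R), 0 < T -> test_function T phi ->
  \int[lebesgue_measure]_(t in `[0, T])
    (\int[rho t]_x (dt phi (t, x)
       + dotp (velocity (rho t) mu x) (gradient (fun y => phi (t, y)) x)))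
  + \int[rho0]_x phi (0, x) = 0.

Definition narrowly_continuous rho : Prop :=
  forall f : 'rV[R]_d -> R, continuous f ->
    (exists M : R, forall x, `|f x| <= M) ->
    {within `[0, +oo[%classic, continuous (fun t : R => \int[rho t]_x f x)}.

(* rho belongs to L^oo_loc([0, oo); L^oo(R^d)) *)
Definition locally_bounded rho : Prop :=
  forall T : R, 0 < T -> exists M : R,
    {ae @lebesgue_measure R, forall t : R,
      0 <= t <= T -> (Linfty_norm (rho t) <= M%:E)%E}.

Definition bounded_solution mu (rho0 : probability 'rV[R]_d R) rho : Prop :=
  [/\ locally_bounded rho, narrowly_continuous rho & weak_solution mu rho0 rho].

End evolution.

Section persistence.
Context (R : realType) (d : nat).

(* Phi_d(D), meaningful for 2 <= D only *)
Definition Phi (D : R) : R :=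
  match d with 1 => D | 2 => ln D | _ => 1 end.

(* Dn n = dist(supp rho_{0,n}, supp mu); the condition 2 <= Dn n is there for
   Phi (Dn n) to make sense. *)
Definition persistence (mu : probability 'rV[R]_d R)
    (rho0 : nat -> probability 'rV[R]_d R)
    (rho : nat -> R -> probability 'rV[R]_d R)
    (Dn : nat -> R) (c0 c1 C1 : R) (n0 : nat) : Prop :=
  [/\ 0 < c0, 0 < c1, 0 < C1 &
   forall n, (n0 <= n)%N -> 2 <= Dn n /\
     forall t : R, 0 <= t <= c0 * Dn n ->
     [/\ ((c1 * Phi (Dn n))%:E <= MMD2 (rho n t) mu)%E,
         (MMD2 (rho n t) mu <= MMD2 (rho0 n) mu)%E &
         (MMD2 (rho0 n) mu <= (C1 * Phi (Dn n))%:E)%E]].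

End persistence.

(* Main.v *)
Require Import Defs.
From HB Require Import structures.
From mathcomp Require Import all_boot all_order all_algebra.
From mathcomp Require Import all_classical all_reals all_analysis.
From mathcomp Require Import measurable_realfun ess_sup_inf ring lra.
Import Order.TTheory GRing.Theory Num.Theory.
Import numFieldNormedType.Exports.

Local Open Scope classical_set_scope.
Local Open Scope ring_scope.

Set Implicit Arguments.
Unset Strict Implicit.
Unset Printing Implicit Defensive.

(** * PART 1 *)

Section smooth_calculus.
Context (R : realType).
Implicit Types (V : normedModType R) (k : nat).

Lemma CkS V k (f : V -> R) : Ck k.+1 f -> Ck k f.
Proof.
elim: k f => [|k IH] f [df Df].
  by move=> x; exact: differentiable_continuous.
by split=> // v; exact/IH/Df.
Qed.

Lemma Ck_cst V k (c : R) : Ck k (fun _ : V => c).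
Proof.
elim: k c => [|k IH] c; first by move=> x; exact: cvg_cst.
split=> [x|v]; first exact: differentiable_cst.
under [X in Ck k X]eq_fun do rewrite (derive_cst c).
exact: IH.
Qed.

Lemma CkD V k (f g : V -> R) : Ck k f -> Ck k g -> Ck k (fun x => f x + g x).
Proof.
elim: k f g => [|k IH] f g.
  by move=> cf cg x; apply: continuousD; [exact: cf|exact: cg].
move=> [df Df] [dg Dg]; split=> [x|v]; first exact: differentiableD.
rewrite [X in Ck k X](_ : _ = fun x => 'D_v f x + 'D_v g x).
  by apply: IH; [exact: Df|exact: Dg].
by apply/funext => x; apply: deriveD; exact: diff_derivable.
Qed.

Lemma CkM V k (f g : V -> R) : Ck k f -> Ck k g -> Ck k (fun x => f x * g x).
Proof.
elim: k f g => [|k IH] f g.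
  by move=> cf cg x; apply: continuousM; [exact: cf|exact: cg].
move=> Cf Cg; have [df Df] := Cf; have [dg Dg] := Cg.
split=> [x|v]; first exact: differentiableM.
rewrite [X in Ck k X](_ : _ = fun x => f x * 'D_v g x + g x * 'D_v f x).
  apply: CkD; apply: IH; [exact: CkS|exact: Dg|exact: CkS|exact: Df].
by apply/funext => x; apply: deriveM; exact: diff_derivable.
Qed.

Lemma CkZ V k (c : R) (f : V -> R) : Ck k f -> Ck k (fun x => c * f x).
Proof. by move=> Cf; apply: CkM => //; exact: Ck_cst. Qed.

Lemma Ck_sum V k n (f : 'I_n -> V -> R) :
  (forall i, Ck k (f i)) -> Ck k (fun x => \sum_i f i x).
Proof.
elim: n f => [|n IH] f Cf.
  by under [X in Ck k X]eq_fun do rewrite big_ord0; exact: Ck_cst.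
under [X in Ck k X]eq_fun do rewrite big_ord_recl.
by apply: CkD => //; apply: IH => i; exact: Cf.
Qed.

Lemma Ck_lin V k (f : V -> R) (c : V -> R) :
  (forall x, differentiable f x) -> (forall v x, 'D_v f x = c v) -> Ck k f.
Proof.
case: k => [|k] df Df; first by move=> x; exact: differentiable_continuous.
split=> // v; under [X in Ck k X]eq_fun do rewrite Df.
exact: Ck_cst.
Qed.

Lemma derive_diff1 (u : R^o -> R) x v :
  differentiable u x -> 'D_v u x = v * 'D_1 u x.
Proof.
move=> du; rewrite !deriveE//.
have -> : v = v *: (1 : R^o) by rewrite /GRing.scale/= mulr1.
by rewrite linearZ /= /GRing.scale/= mulr1.
Qed.

Lemma Ck_comp V k (u : R^o -> R) (f : V -> R) :
  Ck k u -> Ck k f -> Ck k (fun x => u (f x)).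
Proof.
elim: k u f => [|k IH] u f.
  by move=> cu cf x; apply: continuous_comp; [exact: cf|exact: cu].
move=> Cu Cf; have [du Du] := Cu; have [df Df] := Cf.
split=> [x|v].
  by apply: differentiable_comp; [exact: df|exact: du].
rewrite [X in Ck k X](_ : _ = fun x => 'D_v f x * 'D_1 u (f x)); last first.
  apply/funext => x.
  rewrite (@deriveE _ _ _ (u \o f)); last exact: differentiable_comp.
  rewrite diff_comp; [|exact: df|exact: du].
  by rewrite /= -(deriveE _ (du (f x))) derive_diff1// -(deriveE _ (df x)).
apply: CkM; first exact: Df.
by apply: (IH (fun x => 'D_1 u x)); [exact: Du|exact: CkS].
Qed.

Lemma CkR k (u u' : R -> R) :
  (forall x : R, is_derive x (1 : R) u (u' x)) ->
  Ck k (u' : R^o -> R) -> Ck k.+1 (u : R^o -> R).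
Proof.
move=> du Cu'.
have diffu (x : R^o) : differentiable (u : R^o -> R) x.
  apply/derivable1_diffP.
  have [H _] := du x. exact: H.
split=> // v.
rewrite [X in Ck k X](_ : _ = fun x => v * u' x); first exact: CkZ.
by apply/funext => x; rewrite derive_diff1//; have [_ ->] := du x.
Qed.

End smooth_calculus.

(** * PART 2 *)

Section theta.
Context (R : realType).

Lemma is_derive_quadratic0 (f : R -> R) (x C : R) :
  (forall y, `|f y - f x| <= C * (y - x) ^+ 2) -> is_derive x (1 : R) f 0.
Proof.
move=> fC.
have C0 : 0 <= C by have := fC (x + 1); rewrite addrAC subrr add0r expr1n mulr1; exact: le_trans.
have cvg0 : (h^-1 *: (f (h *: (1 : R) + x) - f x)) @[h --> 0^'] --> (0 : R).
  apply/cvgrPdist_le => e e0; near=> h.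
  have h0 : h != 0 by near: h; exact: nbhs_dnbhs_neq.
  rewrite sub0r normrN /GRing.scale/= mulr1 normrM normfV ler_pdivrMl ?normr_gt0//.
  apply: (le_trans (fC _)); rewrite addrK.
  have -> : C * h ^+ 2 = `|h| * (C * `|h|).
    by rewrite -(ger0_norm (sqr_ge0 h)) normrX; ring.
  rewrite ler_wpM2l//.
  have : `|h| <= e / (C + 1).
    by near: h; apply: dnbhs0_le; rewrite divr_gt0// ltr_wpDl.
  rewrite ler_pdivlMr ?ltr_wpDl// => /(le_trans _); apply.
  by rewrite mulrC ler_wpM2l// lerDl.
split; last exact/cvg_lim.
by apply/cvg_ex; exists 0.
Unshelve. all: by end_near. Qed.

Definition theta (a s : R) : R := if 0 < s then expR (- (a * ln s) - s^-1) else 0.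

Lemma theta_ge0 a s : 0 <= theta a s.
Proof. by rewrite /theta; case: ifP => // _; exact: expR_ge0. Qed.

Lemma theta_le0 a s : s <= 0 -> theta a s = 0.
Proof. by rewrite /theta leNgt => /negbTE ->. Qed.

Lemma theta_quadratic a s : 0 <= a ->
  theta a s <= expR ((a + 2) * (ln (a + 2) - 1)) * s ^+ 2.
Proof.
move=> a0; rewrite /theta; case: ifPn => [s0|_]; last first.
  by rewrite mulr_ge0 ?expR_ge0 ?sqr_ge0.
set c := a + 2; have c0 : 0 < c by rewrite /c; lra.
have -> : s ^+ 2 = expR (2 * ln s) by rewrite expRM_natl lnK.
rewrite -expRD ler_expR.
have : ln (s^-1 / c) <= s^-1 / c - 1.
  have := @le_ln1Dx R (s^-1 / c - 1); rewrite subrKC; apply.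
  by rewrite ltrBrDr addNr divr_gt0// invr_gt0.
rewrite ln_div ?posrE ?invr_gt0// lnV ?posrE//.
rewrite -(ler_pM2l c0) => h.
have ca : c * (s^-1 / c) = s^-1 by rewrite mulrC divfK ?gt_eqF.
move: h; rewrite [X in _ <= X]mulrBr ca /c; lra.
Qed.

Lemma theta_deriv a s : 0 <= a ->
  is_derive s (1 : R) (theta a) (- a * theta (a + 1) s + theta (a + 2) s).
Proof.
move=> a0; have [s0|s0|->] := ltgtP s 0.
- rewrite !theta_le0 ?ltW// mulr0 addr0.
  apply: (@near_eq_is_derive _ _ _ (cst 0)) => //.
  near=> y; rewrite theta_le0// ltW//.
  by near: y; exact: lt_nbhsl.
- have -> : - a * theta (a + 1) s + theta (a + 2) s =
            (- (a * s^-1) + s ^- 2) * expR (- (a * ln s) - s^-1).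
    rewrite /theta s0.
    have e1 : expR (- ln s) = s^-1 by rewrite expRN lnK.
    rewrite (_ : - ((a + 1) * ln s) - s^-1 = - ln s + (- (a * ln s) - s^-1)); last by ring.
    rewrite (_ : - ((a + 2) * ln s) - s^-1 = - ln s + (- ln s + (- (a * ln s) - s^-1))); last by ring.
    by rewrite !expRD !e1 expr2 invfM; ring.
  apply: (@near_eq_is_derive _ _ _ (expR \o (fun s => - (a * ln s) - s^-1))) => //.
    near=> y; rewrite /theta /= ifT//.
    by near: y; exact: lt_nbhsr.
  apply: is_derive_eq.
    apply: is_derive1_comp.
    apply: is_deriveB.
      apply: is_deriveN; apply: is_deriveZ; exact: is_derive1_ln.
    by apply: is_deriveV; rewrite gt_eqF.
  by rewrite /= /GRing.scale/=; ring.
- rewrite !theta_le0// mulr0 addr0.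
  apply: (@is_derive_quadratic0 _ _ (expR ((a + 2) * (ln (a + 2) - 1)))) => y.
  rewrite (@theta_le0 _ 0)// !subr0 ger0_norm ?theta_ge0//.
  exact: theta_quadratic.
Unshelve. all: by end_near. Qed.

Lemma theta_Ck k a : 0 <= a -> Ck k (theta a : R^o -> R).
Proof.
elim: k a => [|k IH] a a0.
  move=> x; apply: differentiable_continuous; apply/derivable1_diffP.
  by have [] := theta_deriv x a0.
apply: (CkR (fun x => theta_deriv x a0)).
by apply: CkD; [apply: CkZ; apply: IH|apply: IH]; lra.
Qed.

End theta.

(** * PART 3 *)

Section antiderivative.
Context (R : realType).

Lemma continuous_integrable_itv (w : R -> R) (a b : R) : continuous w ->
  (@lebesgue_measure R).-integrable `[a, b] (EFin \o w).
Proof.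
move=> cw; apply: continuous_compact_integrable; first exact: segment_compact.
exact: continuous_subspaceT.
Qed.

Lemma antiderivative_gt (w : R -> R) (a x : R) : continuous w -> a < x ->
  is_derive x (1 : R) (fun y => \int[lebesgue_measure]_(t in `[a, y]) w t) (w x).
Proof.
move=> cw ax.
have [d1 d2] := @continuous_FTC1_closed R w a x (x + 1) ltac:(lra)
  (continuous_integrable_itv a (x + 1) cw) ax (cw x).
by split => //; rewrite -derive1E.
Qed.

Lemma antiderivative0 (w : R -> R) (a : R) : continuous w ->
  (forall x, x <= a -> w x = 0) ->
  exists W : R -> R, (forall x, is_derive x (1 : R) W (w x)) /\
    (forall x, x <= a -> W x = 0).
Proof.
move=> cw w0; exists (fun y => \int[lebesgue_measure]_(t in `[a - 1, y]) w t).
have W0 x : x <= a -> \int[lebesgue_measure]_(t in `[a - 1, x]) w t = 0.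
  move=> xa; rewrite (@eq_Rintegral _ _ _ _ _ (cst 0)).
    by rewrite Rintegral_cst//= mul0r.
  by move=> y; rewrite inE/= in_itv/= => /andP[_ yx]; rewrite w0// (le_trans yx).
split=> // x; have [xa|ax] := ltP x a; last by apply: antiderivative_gt => //; lra.
rewrite w0 ?ltW//; apply: (@near_eq_is_derive _ _ _ (cst 0)) => //.
near=> y; rewrite W0// ltW//.
by near: y; exact: lt_nbhsl.
Unshelve. all: by end_near. Qed.

Lemma derive0_ge_cst (W : R -> R) (a : R) :
  (forall x, a <= x -> is_derive x (1 : R) W 0) -> forall x, a <= x -> W x = W a.
Proof.
move=> dW x; rewrite le_eqVlt => /predU1P[->//|ax].
have [||c _ h] := @MVT R W (fun=> 0) a x ax.
- by move=> y; rewrite in_itv/= => /andP[ay _]; apply: dW; exact: ltW.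
- apply: derivable_within_continuous => y; rewrite in_itv/= => /andP[ay _].
  by have [] := dW _ ay.
by apply/eqP; rewrite -subr_eq0 h mul0r.
Qed.

Lemma Ck_continuousR (w : R -> R) : Ck 0 (w : R^o -> R) -> continuous w.
Proof. by []. Qed.

Lemma is_derive_Ck0 (W w : R -> R) :
  (forall x, is_derive x (1 : R) W (w x)) -> continuous W.
Proof.
move=> dW x; apply: differentiable_continuous; apply/derivable1_diffP.
by have [] := dW x.
Qed.

(* compactly supported on [0, N] smooth profile's tail primitive *)
Lemma compact_primitive (w : R -> R) (N : R) : (forall k, Ck k (w : R^o -> R)) ->
  (forall s, s <= 0 -> w s = 0) -> (forall s, N <= s -> w s = 0) ->
  exists G : R -> R, [/\ (forall s, is_derive s (1 : R) G (w s)),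
    (forall k, Ck k (G : R^o -> R)) & (forall s, N <= s -> G s = 0)].
Proof.
move=> Cw w0 wN; have [W [dW _]] := antiderivative0 (Cw 0%N) w0.
have dG s : is_derive s (1 : R) (fun s => W s - W N) (w s).
  rewrite -[w s]subr0; apply: is_deriveB.
exists (fun s => W s - W N); split => // [k|s Ns].
  by apply: CkS; apply: (CkR dG).
apply/eqP; rewrite subr_eq0; apply/eqP; apply: derive0_ge_cst => // x Nx.
by rewrite -(wN x Nx).
Qed.

End antiderivative.

Section test_functions.
Context (R : realType) (d : nat).

Definition nsq (x : 'rV[R]_d) : R := \sum_i x 0 i ^+ 2.

Lemma nsq_ge0 x : 0 <= nsq x.
Proof. by apply: sumr_ge0 => i _; exact: sqr_ge0. Qed.

Lemma coord_le_norm (x : 'rV[R]_d) i : `|x 0 i| <= `|x|.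
Proof.
rewrite [X in _ <= X]/Num.norm/= mx_normrE.
exact: (@le_bigmax _ _ _ 0 (fun i => `|x i.1 i.2|) (0, i)).
Qed.

Lemma norm_le_coord (x : 'rV[R]_d) c : 0 <= c -> (forall i, `|x 0 i| <= c) -> `|x| <= c.
Proof.
move=> c0 h; rewrite [X in X <= _]/Num.norm/= mx_normrE.
by apply/bigmax_leP; split=> //= -[a i] _; rewrite /= (ord1 a).
Qed.

Lemma norm2_le_nsq (x : 'rV[R]_d) : `|x| ^+ 2 <= nsq x.
Proof.
have : `|x| <= Num.sqrt (nsq x).
  apply: norm_le_coord; first exact: sqrtr_ge0.
  move=> i; rewrite -sqrtr_sqr ler_sqrt ?nsq_ge0// /nsq (bigD1 i)//= lerDl.
  by apply: sumr_ge0 => j _; exact: sqr_ge0.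
by rewrite -(@ler_pXn2r _ 2) ?nnegrE// ?sqrtr_ge0// sqr_sqrtr ?nsq_ge0.
Qed.

Lemma nsq_le_norm2 (x : 'rV[R]_d) : nsq x <= d%:R * `|x| ^+ 2.
Proof.
rewrite /nsq; apply: (@le_trans _ _ (\sum_(i < d) `|x| ^+ 2)).
  apply: ler_sum => i _; rewrite -real_normK ?num_real// ler_pXn2r ?nnegrE//.
  exact: coord_le_norm.
by rewrite sumr_const card_ord mulr_natl.
Qed.

Lemma nsqB x y : nsq (x - y) = nsq (y - x).
Proof.
rewrite /nsq; apply: eq_bigr => i _.
by rewrite !mxE -sqrrN opprB.
Qed.

Local Notation RV := (R^o * 'rV[R]_d)%type.

Lemma Ck_fst k : Ck k (fun p : RV => p.1 : R).
Proof.
have dif (p : RV) : differentiable (fst : RV -> R) p.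
  apply: linear_differentiable => q; exact: cvg_fst.
apply: (@Ck_lin R _ k _ fst) => // v p.
rewrite deriveE//.
by rewrite (diff_lin (f := (fst : {linear RV -> R^o})))// => q; exact: cvg_fst.
Qed.

Lemma Ck_coord k i : Ck k (fun p : RV => p.2 0 i : R).
Proof.
have dsnd (p : RV) : differentiable (snd : RV -> 'rV[R]_d) p.
  apply: linear_differentiable => q; exact: cvg_snd.
have dif (p : RV) : differentiable (fun p : RV => p.2 0 i : R) p.
  apply: (differentiable_comp (f := snd) (g := fun M : 'rV[R]_d => M 0 i : R)) => //.
  exact: differentiable_coord.
apply: (@Ck_lin R _ k _ (fun p : RV => p.2 0 i)) => // v p.
apply/cvg_lim => //; apply: cvg_near_cst; near=> h.
have h0 : h != 0 by near: h; exact: nbhs_dnbhs_neq.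
rewrite /= !mxE addrK /GRing.scale/=.
by rewrite mulrA mulVf// mul1r.
Unshelve. all: by end_near. Qed.

Definition tfun (eta G : R -> R) (y : 'rV[R]_d) (p : RV) : R :=
  eta p.1 * G (nsq (p.2 - y)).

Lemma tfun_smooth eta G y : (forall k, Ck k (eta : R^o -> R)) ->
  (forall k, Ck k (G : R^o -> R)) -> smooth (tfun eta G y).
Proof.
move=> Ceta CG k; apply: CkM.
  by apply: (Ck_comp (u := eta)) => //; exact: Ck_fst.
apply: (Ck_comp (u := G)) => //; apply: Ck_sum => i.
rewrite [X in Ck k X](_ : _ = fun p : RV => (p.2 0 i + - y 0 i) * (p.2 0 i + - y 0 i)).
  by apply: CkM; apply: CkD; [exact: Ck_coord|exact: Ck_cst|exact: Ck_coord|exact: Ck_cst].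
by apply/funext => p; rewrite !mxE expr2.
Qed.

End test_functions.

(** * PART 4 *)

Section directional.
Context (R : realType).

Lemma derive_along (V : normedModType R) (f : V -> R) (v x : V) (l : R) :
  is_derive (0 : R) (1 : R) (fun h : R => f (h *: v + x)) l -> is_derive x v f l.
Proof.
move=> [dF DF].
have E : (fun h : R => h^-1 *: (f (h *: v + x) - f x)) =
         (fun h : R => h^-1 *: ((fun h : R => f (h *: v + x)) (h *: (1 : R) + 0) -
            (fun h : R => f (h *: v + x)) 0)).
  apply/funext => h; have -> : h *: (1 : R) + 0 = h by rewrite addr0; exact: mulr1.
  by rewrite /= scale0r add0r.
by split; rewrite /derivable /derive E.
Qed.

Context (d : nat).

Lemma nsq_line (x : 'rV[R]_d) (h : R) i :
  nsq (h *: delta_mx 0 i + x) = nsq x + (2 * x 0 i * h + h ^+ 2).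
Proof.
rewrite /nsq (bigD1 i)//= [in RHS](bigD1 i)//= !mxE !eqxx/=.
rewrite (eq_bigr (fun j => x 0 j ^+ 2)); first by ring.
by move=> j ji; rewrite !mxE eqxx /= (negbTE ji) mulr0 add0r.
Qed.

Lemma radial_derive (G : R -> R) (g : R) (x y : 'rV[R]_d) i :
  is_derive (nsq (x - y)) (1 : R) G g ->
  is_derive x (delta_mx 0 i) (fun z => G (nsq (z - y))) (2 * (x - y) 0 i * g).
Proof.
move=> dG; apply: derive_along.
rewrite [X in is_derive _ _ X _](_ : _ =
   G \o (fun h => nsq (x - y) + (2 * (x - y) 0 i * h + h ^+ 2))); last first.
  by apply/funext => h /=; rewrite -addrA nsq_line.
have dq : is_derive (0 : R) (1 : R)
    (fun h => nsq (x - y) + (2 * (x - y) 0 i * h + h ^+ 2)) (2 * (x - y) 0 i).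
  apply: is_derive_eq; rewrite /GRing.scale/=; ring.
rewrite [X in is_derive _ _ _ X]mulrC; apply: is_derive1_comp.
by rewrite mulr0 expr0n/= !addr0.
Qed.

Lemma radial_gradient (G : R -> R) (g : R) (x y : 'rV[R]_d) :
  is_derive (nsq (x - y)) (1 : R) G g ->
  gradient (fun z => G (nsq (z - y))) x = \row_i (2 * (x - y) 0 i * g).
Proof.
by move=> dG; apply/rowP => i; rewrite [LHS]mxE [RHS]mxE; have [_ ->] := radial_derive i dG.
Qed.

Lemma tfun_dt (eta G : R -> R) (e t : R) (x y : 'rV[R]_d) :
  is_derive t (1 : R) eta e -> dt (tfun eta G y) (t, x) = e * G (nsq (x - y)).
Proof.
move=> de; rewrite /dt.
suff [_ ->] : is_derive ((t, x) : (R^o * 'rV[R]_d)%type) ((1, 0) : (R^o * 'rV[R]_d)%type)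
  (tfun eta G y : (R^o * 'rV[R]_d)%type -> R) (e * G (nsq (x - y))) by [].
apply: derive_along.
rewrite [X in is_derive _ _ X _](_ : _ = fun h : R => G (nsq (x - y)) * eta (h + t)); last first.
  by apply/funext => h; rewrite /tfun /= scaler0 add0r mulrC /GRing.scale/= mulr1.
rewrite [X in is_derive _ _ _ X]mulrC; apply: is_deriveZ.
rewrite -[e]mulr1; apply: (@is_derive1_comp _ eta (fun h => h + t)).
  by rewrite add0r.
by apply: is_derive_eq; rewrite addr0.
Qed.

Lemma tfun_gradient (eta G : R -> R) (g t : R) (x y : 'rV[R]_d) :
  is_derive (nsq (x - y)) (1 : R) G g ->
  gradient (fun z => tfun eta G y (t, z)) x = \row_i (eta t * (2 * (x - y) 0 i * g)).
Proof.
move=> dG; apply/rowP => i; rewrite [LHS]mxE [RHS]mxE.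
have d1 := radial_derive i dG.
by have [_ ->] : is_derive x (delta_mx 0 i) (fun z => tfun eta G y (t, z))
  (eta t * (2 * (x - y) 0 i * g)) by exact: (@is_deriveZ _ _ _ (fun z => G (nsq (z - y))) (eta t) _ _ _ d1).
Qed.

Lemma tfun_test (eta G : R -> R) (a b T N : R) (y : 'rV[R]_d) : b < T ->
  (forall k, Ck k (eta : R^o -> R)) -> (forall k, Ck k (G : R^o -> R)) ->
  (forall t, t < a -> eta t = 0) -> (forall t, b < t -> eta t = 0) ->
  (forall s, N <= s -> G s = 0) ->
  test_function T (tfun eta G y).
Proof.
move=> bT Ceta CG eta0 eta1 GN.
pose B : set (R * 'rV[R]_d) := `[a, b]%classic `*`
  [set x : 'rV[R]_d | forall i, `[y 0 i - Num.sqrt N, y 0 i + Num.sqrt N]%classic (x ord0 i)].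
have cB : compact B.
  apply: compact_setX; first exact: segment_compact.
  apply: (@rV_compact _ d (fun i => `[y 0 i - Num.sqrt N, y 0 i + Num.sqrt N]%classic)) => i.
  exact: segment_compact.
have clB : closed B by apply: compact_closed => //; exact: norm_hausdorff.
have sB : closure [set p | tfun eta G y p != 0] `<=` B.
  rewrite [X in _ `<=` X](iffLR (closure_id B))//; apply: closureS => -[t x] /=.
  rewrite /tfun /= mulf_eq0 negb_or => /andP[et Gx]; split => /=.
    rewrite in_itv/=; apply/andP; split; rewrite leNgt; apply: contra_neqN et.
      by move=> /eta0.
    by move=> /eta1.
  have xN : nsq (x - y) < N by rewrite ltNge; apply: contra_neqN Gx => /GN.
  move=> i /=; rewrite in_itv/= -ler_distl.
  have -> : x ord0 i - y 0 i = (x - y) 0 i by rewrite !mxE.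
  rewrite -sqrtr_sqr ler_sqrt; last by rewrite (le_trans _ (ltW xN))// nsq_ge0.
  apply: (le_trans _ (ltW xN)); rewrite /nsq (bigD1 i)//= lerDl.
  by apply: sumr_ge0 => j _; exact: sqr_ge0.
split; first exact: tfun_smooth.
  by apply: (subclosed_compact _ cB sB); exact: closed_closure.
apply: (subset_trans sB) => -[t x] [/=]; rewrite in_itv/= => /andP[_ tb] _.
exact: le_lt_trans tb bT.
Qed.

End directional.

(** * PART 5 *)

Lemma measurable_fun_EFin d (T : measurableType d) (R : realType) (D : set T)
  (g : T -> R) : measurable_fun D g -> measurable_fun D (fun x => (g x)%:E).
Proof. by move=> mg; apply/measurable_EFinP. Qed.

Lemma prob_integral_cst d (T : measurableType d) (R : realType)
  (P : probability T R) (b : R) : (\int[P]_y b%:E = b%:E)%E.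
Proof.
rewrite integral_cst// [X in (_ * X)%E](_ : _ = 1%E) ?mule1//.
exact: probability_setT.
Qed.

Section growth.
Context (R : realType) (d : nat).
Implicit Types rho : probability 'rV[R]_d R.

Definition growth (A : R) rho := forall (x : 'rV[R]_d) (r : R), 0 < r ->
  (rho (ball x r) <= (A * r ^+ d)%:E)%E.

Lemma rV_measurable_ball (x : 'rV[R]_d) r : measurable (ball x r).
Proof. by apply: rV_open_measurable; exact: ball_open. Qed.

Lemma rV_measurable_set1 (x : 'rV[R]_d) : measurable [set x].
Proof.
rewrite -(setCK [set x]); apply: measurableC; apply: rV_open_measurable.
rewrite openC; apply: accessible_closed_set1; apply: hausdorff_accessible.
exact: norm_hausdorff.
Qed.

Lemma rV_ballE (x y : 'rV[R]_d) r : ball x r y = (`|x - y| < r) :> Prop.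
Proof. by rewrite mx_norm_ball. Qed.

Lemma growth_ge0 A rho : growth A rho -> 0 <= A.
Proof.
move=> /(_ 0 1 ltr01); rewrite expr1n mulr1 => h.
by rewrite -lee_fin (le_trans _ h).
Qed.

Lemma growth_set1 A rho x : (0 < d)%N -> growth A rho -> rho [set x] = 0%E.
Proof.
move=> d0 gr; have A0 := growth_ge0 gr.
apply/eqP; rewrite eq_le measure_ge0 andbT; apply/lee_addgt0Pr => e e0.
rewrite add0e; pose r := Num.min 1 (e / (A + 1)).
have r0 : 0 < r by rewrite lt_min ltr01 divr_gt0// ltr_wpDl.
have r1 : r <= 1 by rewrite ge_min lexx.
apply: (@le_trans _ _ (rho (ball x r))).
  apply: le_measure; rewrite ?inE//; [exact: rV_measurable_set1|exact: rV_measurable_ball|].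
  by move=> _ ->; exact: ballxx.
apply: (le_trans (gr x r r0)); rewrite lee_fin.
apply: (@le_trans _ _ (A * r)).
  by rewrite ler_wpM2l// -[X in _ <= X]expr1 ler_wiXn2l// ltW.
have : r <= e / (A + 1) by rewrite /r ge_min lexx orbT.
rewrite ler_pdivlMr ?ltr_wpDl// => /(le_trans _); apply.
by rewrite mulrC ler_wpM2l ?lerDl// ltW.
Qed.

(* dyadic shells *)
Let shell (x : 'rV[R]_d) (r : R) (k : nat) (y : 'rV[R]_d) : \bar R :=
  (((r / 2 ^+ k.+1) ^- d.-1)%:E * (\1_(ball x (r / 2 ^+ k)) y)%:E)%E.

Let shell_ge0 (x : 'rV[R]_d) (r : R) k y : 0 < r -> (0 <= shell x r k y)%E.
Proof.
by move=> r0; rewrite /shell -EFinM lee_fin mulr_ge0// invr_ge0 exprn_ge0// divr_ge0// ltW.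
Qed.

Let shell_measurable (x : 'rV[R]_d) (r : R) k : measurable_fun setT (shell x r k).
Proof.
apply: measurable_funeM; apply: measurable_fun_EFin; apply: measurable_indic.
exact: rV_measurable_ball.
Qed.

Let shell_integral A rho (x : 'rV[R]_d) (r : R) k : (0 < d)%N -> growth A rho -> 0 < r ->
  (\int[rho]_y shell x r k y <= (A * 2 ^+ d * r / (2 ^ k.+1)%:R)%:E)%E.
Proof.
move=> d0 gr r0; rewrite /shell ge0_integralZl//; last first.
- by rewrite lee_fin invr_ge0 exprn_ge0// divr_ge0// ltW.
- by apply: measurable_fun_EFin; apply: measurable_indic; exact: rV_measurable_ball.
rewrite integral_indic//; last exact: rV_measurable_ball.
rewrite setIT; apply: (@le_trans _ _
    (((r / 2 ^+ k.+1) ^- d.-1)%:E * (A * (r / 2 ^+ k) ^+ d)%:E)%E).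
  apply: lee_wpmul2l; last by apply: gr; rewrite divr_gt0.
  by rewrite lee_fin invr_ge0 exprn_ge0// divr_ge0// ltW.
rewrite -EFinM lee_fin natrX le_eqVlt; apply/orP; left; apply/eqP.
have p0 : (2 : R) ^+ k != 0 by rewrite expf_neq0.
have -> : r / 2 ^+ k = (r / 2 ^+ k.+1) * 2 by rewrite exprSr; field.
rewrite -[RHS]mulrA; set q := r / 2 ^+ k.+1.
have q0 : q != 0 by rewrite gt_eqF// divr_gt0.
clearbody q; case: (d) d0 => // e _ /=; rewrite exprMn (exprS q).
have : q ^+ e != 0 by rewrite expf_neq0.
by move: (q ^+ e) (2 ^+ e.+1) => Q P Q0; field.
Qed.

Lemma dyadic_shell (r t : R) : 0 < t -> t < r ->
  exists k, r / 2 ^+ k.+1 <= t < r / 2 ^+ k.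
Proof.
move=> t0 tr; have r0 := lt_trans t0 tr.
have ex : exists k, r / 2 ^+ k.+1 <= t.
  have [n rn] : exists n : nat, r / t < n%:R.
    by exists (Num.bound (r / t)); apply: archi_boundP; rewrite divr_ge0// ltW.
  exists n; rewrite ler_pdivrMr ?exprn_gt0// mulrC -ler_pdivrMr//.
  rewrite (le_trans (ltW rn))// -natrX ler_nat.
  by rewrite (leq_trans (ltnW (ltn_expl n (ltnSn 1))))// leq_exp2l.
have [k kt mink] := ex_minnP ex.
exists k; rewrite kt/=; case: k mink {kt} => [|k] mink; first by rewrite expr0 divr1.
by rewrite ltNge; apply/negP => /mink; rewrite ltnn.
Qed.

Lemma singular_integral A rho (f : 'rV[R]_d -> R) (x : 'rV[R]_d) (r b : R) :
  (0 < d)%N -> growth A rho -> 0 < r -> 0 <= b ->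
  measurable_fun setT f -> (forall y, 0 <= f y) ->
  (forall y : 'rV[R]_d, y != x -> `|x - y| < r -> f y <= `|x - y| ^- d.-1 + b) ->
  (forall y : 'rV[R]_d, r <= `|x - y| -> f y <= b) ->
  (\int[rho]_y (f y)%:E <= (A * 2 ^+ d * r + b)%:E)%E.
Proof.
move=> d0 gr r0 b0 mf f0 fin fout; have A0 := growth_ge0 gr.
have mS : measurable_fun setT (fun y => \sum_(k <oo) shell x r k y)%E.
  by apply: ge0_emeasurable_sum => [k y _ _|k _]; [exact: shell_ge0|exact: shell_measurable].
have S0 y : (0 <= \sum_(k <oo) shell x r k y)%E.
  by apply: nneseries_ge0 => k _ _; exact: shell_ge0.
apply: (@le_trans _ _ (\int[rho]_y (\sum_(k <oo) shell x r k y + b%:E))%E).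
  apply: ae_ge0_le_integral => //.
  - by move=> y _; rewrite lee_fin.
  - exact: measurable_fun_EFin.
  - by move=> y _; rewrite adde_ge0// lee_fin.
  - by apply: emeasurable_funD => //; exact: measurable_cst.
  exists [set x]; split; [exact: rV_measurable_set1|exact: growth_set1 gr|].
  move=> y /= h; apply: contrapT => /eqP yx; apply: h => _.
  have [rxy|xyr] := leP r `|x - y|.
    by rewrite (@le_trans _ _ b%:E)// ?lee_fin ?fout// leeDr.
  apply: (@le_trans _ _ ((`|x - y| ^- d.-1)%:E + b%:E)%E); first by rewrite lee_fin fin.
  rewrite leeD2r//.
  have xy0 : 0 < `|x - y| by rewrite normr_gt0 subr_eq0 eq_sym.
  have [k /andP[k1 k2]] := dyadic_shell xy0 xyr.
  apply: (@le_trans _ _ (shell x r k y)).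
    rewrite /shell indicE mem_set ?mule1; last by rewrite rV_ballE.
    have rk : 0 < r / 2 ^+ k.+1 by rewrite divr_gt0.
    rewrite lee_fin lef_pV2 ?posrE ?exprn_gt0//.
    by rewrite lerXn2r ?nnegrE// ltW.
  rewrite (@nneseriesD1 _ _ k)//; last by move=> i _; exact: shell_ge0.
  by rewrite leeDl//; apply: nneseries_ge0 => i _ _; exact: shell_ge0.
rewrite ge0_integralD//.
have -> : (\int[rho]_y b%:E = b%:E)%E.
  exact: prob_integral_cst.
rewrite EFinD leeD2r//.
rewrite integral_nneseries//; last by move=> k y _; exact: shell_ge0.
apply: (@le_trans _ _ (\sum_(k <oo) (A * 2 ^+ d * r / (2 ^ k.+1)%:R)%:E)%E).
  apply: lee_nneseries => k _; first by move=> _; apply: integral_ge0 => y _; exact: shell_ge0.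
  exact: shell_integral.
by apply: (epsilon_trick0 xpredT); rewrite mulr_ge0 ?mulr_ge0// ltW.
Qed.

End growth.

(** * PART 6 *)

Section coulomb_kernel.
Context (R : realType) (d : nat).

Definition kappa : R :=
  match d with 1 => 2^-1 | 2 => (2 * pi)^-1 | _ => (sphere_area R d)^-1 end.

Lemma kappa_ge0 : 0 <= kappa.
Proof.
rewrite /kappa; case: d => [|[|[|n]]]; rewrite ?invr_ge0 ?mulr_ge0 ?pi_ge0//;
  by apply: fine_ge0; rewrite mule_ge0// lee_fin.
Qed.

(* coulomb x = gam |x|^2 *)
Definition gam (s : R) : R :=
  match d with
  | 1 => - (Num.sqrt s / 2)
  | 2 => - (ln (Num.sqrt s) / (2 * pi))
  | _ => ((d - 2)%N%:R * sphere_area R d)^-1 * Num.sqrt s ^- (d - 2)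
  end.

Lemma coulombE (x : 'rV[R]_d) : coulomb x = gam (nsq x).
Proof. by rewrite /coulomb /gam /enorm; move: x; case: d. Qed.

(* derivative of gam on s > 0 *)
Definition dgam (s : R) : R := - (kappa / 2) * expR (- (d%:R / 2 * ln s)).

Lemma expR_sqrt (s : R) : 0 < s -> expR (- (d%:R / 2 * ln s)) = Num.sqrt s ^- d.
Proof.
move=> s0; have -> : Num.sqrt s = expR (2^-1 * ln s).
  apply/eqP; rewrite -(@eqrXn2 _ 2) ?sqrtr_ge0 ?expR_ge0// sqr_sqrtr ?ltW//.
  by rewrite -expRM_natl mulrA mulfV ?mul1r ?lnK.
by rewrite -exprVn -expRN -expRM_natl; congr expR; ring.
Qed.

Lemma gam_derive (s : R) : (0 < d)%N -> 0 < s -> is_derive s (1 : R) gam (dgam s).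
Proof.
move=> d0 s0; rewrite /dgam expR_sqrt//.
have q0 : 0 < Num.sqrt s by rewrite sqrtr_gt0.
have dq := is_derive1_sqrt s0.
rewrite /gam /kappa; case: d d0 => [//|[|[|n]]] _.
- apply: is_derive_eq; rewrite /GRing.scale/= expr1; field.
  by rewrite gt_eqF.
- have dl : is_derive s (1 : R) (fun s => ln (Num.sqrt s)) ((Num.sqrt s)^-1 * (2 * Num.sqrt s)^-1).
    by apply: (@is_derive1_comp R (@ln R) Num.sqrt); exact: is_derive1_ln.
  have p0 : (pi : R) != 0 by rewrite gt_eqF// pi_gt0.
  have q1 := lt0r_neq0 q0.
  apply: is_derive_eq; rewrite /GRing.scale/= expr2.
  move: (pi : R) (Num.sqrt s) p0 q1 => p q p0 q1; field.
  by rewrite q1 p0.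
- rewrite (_ : (n.+3 - 2)%N = n.+1)//.
  have [->|sa] := eqVneq (sphere_area R n.+3) 0.
    rewrite mulr0 invr0 mul0r oppr0 !mul0r.
    rewrite [X in is_derive _ _ X _](_ : _ = cst 0); first exact: is_derive_cst.
    by apply/funext => y; rewrite mul0r.
  have dp : is_derive s (1 : R) (fun s => Num.sqrt s ^+ n.+1)
     (n.+1%:R * Num.sqrt s ^+ n * (2 * Num.sqrt s)^-1).
    have := @is_deriveX R _ Num.sqrt n.+1 s 1 _ dq.
    by rewrite (_ : Num.sqrt ^+ n.+1 = fun s => Num.sqrt s ^+ n.+1)//; apply/funext => y; rewrite exprfctE.
  have dv := @is_deriveV R (fun s => Num.sqrt s ^+ n.+1) s _ 1 (lt0r_neq0 (exprn_gt0 n.+1 q0)) dp.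
  apply: is_derive_eq; rewrite /GRing.scale/= !exprS.
  have := lt0r_neq0 (exprn_gt0 n q0); move: (Num.sqrt s ^+ n) => X X0.
  field; rewrite sa X0 gt_eqF//=.
Qed.

Lemma dgam_le0 s : dgam s <= 0.
Proof. by rewrite /dgam mulNr oppr_le0 mulr_ge0 ?expR_ge0// divr_ge0// kappa_ge0. Qed.

Definition gk (i : 'I_d) (z : 'rV[R]_d) : R := 2 * z 0 i * dgam (nsq z).

Lemma nsq_gt0 (z : 'rV[R]_d) : z != 0 -> 0 < nsq z.
Proof.
move=> z0; apply: lt_le_trans (norm2_le_nsq z).
by rewrite exprn_gt0// normr_gt0.
Qed.

Lemma gradient_coulomb (z : 'rV[R]_d) i : z != 0 ->
  gradient (@coulomb R d) z 0 i = gk i z.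
Proof.
move=> z0; have d0 : (0 < d)%N by case: d i {z z0} => // -[].
have -> : @coulomb R d = fun x => gam (nsq (x - 0)).
  by apply/funext => x; rewrite subr0 coulombE.
have dg : is_derive (nsq (z - 0)) (1 : R) gam (dgam (nsq (z - 0))).
  by apply: gam_derive => //; rewrite subr0 nsq_gt0.
by rewrite (radial_gradient dg) mxE subr0.
Qed.

Lemma dgam_bound (z : 'rV[R]_d) : z != 0 ->
  `|dgam (nsq z)| <= kappa / 2 * `|z| ^- d.
Proof.
move=> z0; have n0 := nsq_gt0 z0.
rewrite ler0_norm ?dgam_le0// /dgam mulNr opprK expR_sqrt// ler_wpM2l//.
  by rewrite divr_ge0// kappa_ge0.
rewrite lef_pV2 ?posrE ?exprn_gt0 ?sqrtr_gt0 ?normr_gt0//.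
rewrite lerXn2r ?nnegrE ?sqrtr_ge0//.
by rewrite -(@ler_pXn2r _ 2) ?nnegrE ?sqrtr_ge0// sqr_sqrtr ?norm2_le_nsq// ltW.
Qed.

Lemma gk0 i : gk i 0 = 0.
Proof. by rewrite /gk mxE mulr0 mul0r. Qed.

Lemma gk_bound i (z : 'rV[R]_d) : z != 0 -> `|gk i z| <= kappa * `|z| ^- d.-1.
Proof.
move=> z0; rewrite /gk normrM normrM (ger0_norm (ler0n R 2)).
have zn0 : 0 < `|z| by rewrite normr_gt0.
apply: (@le_trans _ _ (2 * `|z| * (kappa / 2 * `|z| ^- d))).
  apply: ler_pM; [by rewrite mulr_ge0|by []|by rewrite ler_wpM2l// coord_le_norm|exact: dgam_bound].
have d0 : (0 < d)%N by case: d i {z z0 zn0} => // -[].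
have -> : `|z| ^- d = (`|z| * `|z| ^+ d.-1)^-1 by rewrite -exprS prednK.
rewrite le_eqVlt; apply/orP; left; apply/eqP.
have : `|z| ^+ d.-1 != 0 by rewrite expf_neq0// gt_eqF.
by move: (`|z| ^+ d.-1) => X X0; field; rewrite X0 normr_eq0 z0.
Qed.

Lemma nsq_continuous : continuous (@nsq R d).
Proof.
apply: (@Ck_sum R _ 0 d (fun i (x : 'rV[R]_d) => x 0 i ^+ 2)) => i x.
by apply: (@continuousM R _ (fun x : 'rV[R]_d => x 0 i) (fun x => x 0 i)); exact: coord_continuous.
Qed.

Lemma measurable_nsq : measurable_fun setT (@nsq R d).
Proof.
apply: measurable_sum => i; apply: measurable_funX; exact: measurable_fun_coord.
Qed.

Lemma measurable_gk i : measurable_fun setT (gk i).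
Proof.
rewrite /gk /dgam.
apply: measurable_funM.
  by apply: measurable_funM => //; exact: measurable_fun_coord.
apply: measurable_funM => //; apply: measurableT_comp => //.
apply: measurableT_comp => //; apply: measurable_funM => //.
by apply: measurableT_comp; [exact: measurable_ln|exact: measurable_nsq].
Qed.

End coulomb_kernel.

(** * PART 7 *)

Section profile.
Context (R : realType).
Variables (w : R -> R) (N : R).
Hypothesis Cw : forall k, Ck k (w : R^o -> R).
Hypothesis w0 : forall s, s <= 0 -> w s = 0.
Hypothesis wN : forall s, N <= s -> w s = 0.

Lemma bounded_on_segment (f : R -> R) (a b : R) : continuous f ->
  exists2 M, 0 <= M & forall s, a <= s <= b -> `|f s| <= M.
Proof.
move=> cf; have [ab|ba] := leP a b; last first.
  by exists 0 => // s /andP[/le_trans h /h]; rewrite leNgt ba.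
have [c cab h] := @EVT_max R (fun s => `|f s|) a b ab
  ltac:(apply: continuous_subspaceT => x; apply: continuous_comp; [exact: cf|exact: norm_continuous]).
by exists `|f c| => // s sab; apply: h; rewrite in_itv.
Qed.

Lemma profile_bounded : exists2 M, 0 <= M & forall s, `|w s| <= M.
Proof.
have [M M0 h] := bounded_on_segment 0 N (Cw 0%N).
exists M => // s; have [s0|s0] := leP s 0; first by rewrite w0// normr0.
have [sN|sN] := leP N s; first by rewrite wN// normr0.
by apply: h; rewrite !ltW.
Qed.

Lemma profile_lipschitz : exists2 L, 0 <= L & forall s t, `|w s - w t| <= L * `|s - t|.
Proof.
have [dw Dw] := Cw 1%N.
have [L L0 hL] := bounded_on_segment 0 N (Dw 1).
have dw' (s : R) : is_derive s (1 : R) w ('D_1 w s).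
  by apply: derivableP; apply: diff_derivable; exact: dw.
have key s t : 0 <= s -> s <= t -> t <= N -> `|w s - w t| <= L * `|s - t|.
  move=> s0 st tN; rewrite distrC.
  have cw : {within `[s, t], continuous w} by apply: continuous_subspaceT; exact: (Cw 0%N).
  have [c ct ->] := @MVT_segment R w (fun x => 'D_1 w x) s t st (fun x _ => dw' x) cw.
  rewrite normrM distrC ler_wpM2r// hL//.
  by move: ct; rewrite in_itv/= => /andP[? ?]; rewrite (le_trans s0)//= (le_trans _ tN).
exists L => // s t.
have Nw : N < 0 -> w = cst 0.
  by move=> N0; apply/funext => u; have [/w0//|u0] := leP u 0; rewrite wN// ltW// (lt_trans N0).
have [N0|N0] := ltP N 0; first by rewrite Nw// subrr normr0 mulr_ge0.
pose c (u : R) := Num.min (Num.max u 0) N.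
have wc u : w u = w (c u).
  rewrite /c; have [u0|u0] := leP u 0; first by rewrite min_l// !w0.
  by have [uN|uN] := leP u N => //; rewrite !wN// ltW.
have c0 u : 0 <= c u by rewrite /c le_min N0 le_max lexx orbT.
have cN u : c u <= N by rewrite /c ge_min lexx orbT.
rewrite (wc s) (wc t).
wlog st : s t / s <= t.
  by move=> h; have [/h//|/ltW/h] := leP s t; rewrite distrC (distrC t s).
have cst : c s <= c t by rewrite /c; apply: le_min2 => //; exact: le_max2.
apply: (le_trans (key _ _ (c0 _) cst (cN _))); rewrite ler_wpM2l//.
rewrite distrC (distrC s) !ger0_norm ?subr_ge0//.
rewrite /c; case: (leP s 0) => ?; case: (leP t 0) => ?; case: (leP 0 N) => ?; case: (leP s N) => ?; case: (leP t N) => ?; lra.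
Qed.

Context (d : nat).

Definition ek (i : 'I_d) (z : 'rV[R]_d) : R := 2 * z 0 i * w (nsq z).

Lemma ek_bounded : exists2 M, 0 <= M & forall i z, `|ek i z| <= M.
Proof.
have [M M0 hM] := profile_bounded.
exists (2 * Num.sqrt N * M); first by rewrite !mulr_ge0 ?sqrtr_ge0.
move=> i z; rewrite /ek; have [zN|zN] := leP N (nsq z).
  by rewrite wN// mulr0 normr0 !mulr_ge0 ?sqrtr_ge0.
rewrite normrM normrM (ger0_norm (ler0n R 2)); apply: ler_pM => //.
rewrite ler_wpM2l// (le_trans (coord_le_norm _ _))//.
rewrite -(@ger0_norm _ `|z|)// -sqrtr_sqr ler_sqrt; last by rewrite (le_trans _ (ltW zN))// nsq_ge0.
by rewrite (le_trans (norm2_le_nsq z))// ltW.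
Qed.

Lemma ek_lipschitz : exists2 L, 0 <= L & forall i z z', `|ek i z - ek i z'| <= L * `|z - z'|.
Proof.
have [M M0 hM] := profile_bounded.
have [L L0 hL] := profile_lipschitz.
have [M' M'0 hM'] := ek_bounded.
pose q := Num.sqrt N; have q0 : 0 <= q by rewrite sqrtr_ge0.
pose C := 2 * M + 2 * q * (L * (d%:R * (2 * q + 1))).
have C0 : 0 <= C by rewrite addr_ge0// ?mulr_ge0// addr_ge0// mulr_ge0.
have key i z z' : nsq z < N -> `|z - z'| <= 1 -> `|ek i z - ek i z'| <= C * `|z - z'|.
  move=> zN z1.
  have zq : `|z| <= q.
    rewrite -(@ger0_norm _ `|z|)// -sqrtr_sqr ler_sqrt; last by rewrite (le_trans _ (ltW zN))// nsq_ge0.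
    by rewrite (le_trans (norm2_le_nsq z))// ltW.
  have sq : `|nsq z - nsq z'| <= d%:R * (2 * q + 1) * `|z - z'|.
    rewrite /nsq -sumrB; apply: (le_trans (ler_norm_sum _ _ _)).
    rewrite -mulrA mulr_natl -[X in _ <= _ *+ X]card_ord -sumr_const.
    apply: ler_sum => j _; rewrite subr_sqr normrM mulrC; apply: ler_pM => //.
      have -> : z 0 j + z' 0 j = 2 * z 0 j - (z - z') 0 j by rewrite !mxE; ring.
      apply: (le_trans (ler_normB _ _)); rewrite lerD//.
        by rewrite normrM (ger0_norm (ler0n R 2)) ler_wpM2l// (le_trans (coord_le_norm _ _)).
      exact: le_trans (coord_le_norm _ _) z1.
    by rewrite (le_trans _ (coord_le_norm (z - z') j))// !mxE.
  have -> : ek i z - ek i z' = 2 * (z - z') 0 i * w (nsq z') + 2 * z 0 i * (w (nsq z) - w (nsq z')).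
    by rewrite /ek !mxE; ring.
  apply: (le_trans (ler_normD _ _)); rewrite /C [leRHS]mulrDl; apply: lerD.
    rewrite normrM normrM (ger0_norm (ler0n R 2)) -!mulrA ler_wpM2l// mulrC ler_pM//.
    exact: coord_le_norm.
  rewrite normrM normrM (ger0_norm (ler0n R 2)) -!mulrA ler_wpM2l// ler_pM//.
    exact: le_trans (coord_le_norm _ _) zq.
  by apply: (le_trans (hL _ _)); rewrite ler_wpM2l// mulrA.
clearbody C; exists (C + 2 * M'); first by rewrite addr_ge0// mulr_ge0.
move=> i z z'; have [z1|z1] := leP `|z - z'| 1; last first.
  apply: (@le_trans _ _ (2 * M')).
    by apply: (le_trans (ler_normB _ _)); rewrite mulr_natl mulr2n lerD.
  by rewrite [leRHS]mulrDl ler_wpDl ?mulr_ge0// ler_peMr ?mulr_ge0// ltW.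
apply: (@le_trans _ _ (C * `|z - z'|)); last by rewrite ler_wpM2r// lerDl mulr_ge0.
have [zN|/key] := leP N (nsq z); last exact.
have [z'N|/key h] := leP N (nsq z').
  by rewrite /ek !wN// !mulr0 subrr normr0 mulr_ge0.
by rewrite distrC (distrC z) h// distrC.
Qed.

Lemma lipschitz_continuous (f : 'rV[R]_d -> R) L :
  (forall z z', `|f z - f z'| <= L * `|z - z'|) -> continuous f.
Proof.
move=> fL z; apply: (iffRL (@cvgrPdist_le _ R^o _ (nbhs z) _ f (f z))) => e e0.
have L1 : 0 < `|L| + 1 by rewrite ltr_wpDl.
have d0 : 0 < e / (`|L| + 1) by rewrite divr_gt0.
apply: filterS (nbhsx_ballx z _ d0) => z'; rewrite rV_ballE => zz'.
apply: (le_trans (fL _ _)).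
apply: (@le_trans _ _ ((`|L| + 1) * `|z - z'|)).
  by rewrite ler_wpM2r// (le_trans (ler_norm _))// lerDl.
by rewrite -ler_pdivlMl// mulrC ltW.
Qed.

End profile.

(** * PART 8 *)

Section cutoff.
Context (R : realType) (d : nat).

Definition chi (N s : R) : R := theta 0 (N * s) * theta 0 (N * (N - s)).

Definition wcut (N s : R) : R := dgam d s * chi N s.

Lemma theta0_le1 (s : R) : theta 0 s <= 1.
Proof.
rewrite /theta; case: ifPn => // s0.
by rewrite mul0r oppr0 sub0r expR_le1 oppr_le0 invr_ge0 ltW.
Qed.

Lemma theta0_ge (s : R) : 0 < s -> 1 - s^-1 <= theta 0 s.
Proof.
by move=> s0; rewrite /theta s0 mul0r oppr0 sub0r; exact: expR_ge1Dx.
Qed.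

Lemma chi_ge0 N s : 0 <= chi N s.
Proof. by rewrite mulr_ge0// theta_ge0. Qed.

Lemma chi_le1 N s : chi N s <= 1.
Proof. by rewrite -[1]mulr1 ler_pM ?theta_ge0 ?theta0_le1. Qed.

Lemma chi_le0 N s : 0 < N -> s <= 0 -> chi N s = 0.
Proof. by move=> N0 s0; rewrite /chi theta_le0 ?mul0r// mulr_ge0_le0// ltW. Qed.

Lemma chi_ge N s : 0 < N -> N <= s -> chi N s = 0.
Proof.
move=> N0 s0; rewrite /chi [X in _ * X]theta_le0 ?mulr0//.
by rewrite mulr_ge0_le0// ?subr_le0// ltW.
Qed.

Lemma chi_lower N s : 0 < N -> 0 < s -> s < N ->
  1 - chi N s <= (N * s)^-1 + (N * (N - s))^-1.
Proof.
move=> N0 s0 sN.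
have h1 : 1 - (N * s)^-1 <= theta 0 (N * s) by rewrite theta0_ge// mulr_gt0.
have h2 : 1 - (N * (N - s))^-1 <= theta 0 (N * (N - s)).
  by rewrite theta0_ge// mulr_gt0// subr_gt0.
have := theta0_le1 (N * s); have := theta0_le1 (N * (N - s)).
have := theta_ge0 0 (N * s); have := theta_ge0 0 (N * (N - s)).
move: h1 h2; rewrite /chi.
move: (theta _ _) (theta _ _) (_^-1) (_^-1) => a b p q h1 h2 a0 b0 a1 b1.
have : 0 <= (1 - a) * (1 - b) by rewrite mulr_ge0// subr_ge0.
rewrite mulrBl mulrBr mulrBr !mul1r mulr1; lra.
Qed.

Lemma wcut_le0 N s : 0 < N -> s <= 0 -> wcut N s = 0.
Proof. by move=> N0 s0; rewrite /wcut chi_le0// mulr0. Qed.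

Lemma wcut_ge N s : 0 < N -> N <= s -> wcut N s = 0.
Proof. by move=> N0 s0; rewrite /wcut chi_ge// mulr0. Qed.

Lemma Ck_affine k (a b : R) : Ck k ((fun s => a * s + b) : R^o -> R).
Proof.
apply: CkS; apply: (@CkR _ k (fun s => a * s + b) (fun=> a)); last exact: Ck_cst.
by move=> x; apply: is_derive_eq; rewrite /GRing.scale/= addr0 mulr1.
Qed.

Lemma wcut_smooth N k : 0 < N -> Ck k (wcut N : R^o -> R).
Proof.
move=> N0.
have -> : wcut N = fun s => - (kappa R d / 2) * expR (d%:R / 2 * ln N) *
   (theta (d%:R / 2) (N * s + 0) * theta 0 ((- N) * s + N * N)).
  apply/funext => s; rewrite /wcut.
  have [s0|s0] := leP s 0.
    rewrite chi_le0// mulr0 theta_le0 ?mul0r ?mulr0// addr0.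
    by rewrite mulr_ge0_le0// ltW.
  rewrite /chi mulrBr [X in _ = _ * (_ * theta _ X)]addrC mulNr addr0 /dgam.
  rewrite /theta mulr_gt0// mul0r oppr0 add0r lnM ?posrE//.
  rewrite (_ : - (d%:R / 2 * (ln N + ln s)) - (N * s)^-1 =
     - (d%:R / 2 * ln N) + (- (d%:R / 2 * ln s) - (N * s)^-1)); last by ring.
  rewrite [expR (- (_ * ln N) + _)]expRD expRN.
  rewrite [expR (- (_ * ln s) + _)]expRD.
  have := lt0r_neq0 (expR_gt0 (d%:R / 2 * ln N)).
  move: (expR (d%:R / 2 * ln N)) => X X0; rewrite !mulNr.
  by move: (expR _) (expR _) (if _ then _ else _) => E F Z; field.
apply: CkZ; apply: CkM.
  by apply: (Ck_comp (u := theta _)); [exact: theta_Ck|exact: Ck_affine].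
by apply: (Ck_comp (u := theta _)); [exact: theta_Ck|exact: Ck_affine].
Qed.

Lemma ek_wcut N (i : 'I_d) z : ek (wcut N) i z = chi N (nsq z) * gk i z.
Proof. by rewrite /ek /wcut /gk; ring. Qed.

(* away from 0, the cut-off kernels are uniformly close to the gradient *)
Lemma cutoff_uniform (r e : R) : (2 <= d)%N -> 0 < r -> 0 < e ->
  exists2 N0 : R, 0 < N0 & forall N, N0 <= N -> forall (i : 'I_d) z, r <= `|z| ->
   `|ek (wcut N) i z - gk i z| <= e.
Proof.
move=> d2 r0 e0; pose K := kappa R d + 1.
have K0 : 0 < K by rewrite ltr_wpDl// kappa_ge0.
pose a := K * r ^- d.-1.
have a0 : 0 < a by rewrite mulr_gt0// invr_gt0 exprn_gt0.
have rr0 : 0 < r ^+ 2 by rewrite exprn_gt0.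
have d0 : 0 < (d%:R : R) by rewrite ltr0n (leq_trans _ d2).
have Ke0 : 0 < 1 + (K / e) ^+ 2 by rewrite ltr_wpDr// exprn_ge0// divr_ge0// ltW.
pose P1 := 2 * d%:R * (1 + (K / e) ^+ 2).
pose P2 := a * ((r ^+ 2)^-1 + 2) / e.
have P10 : 0 < P1 by rewrite mulr_gt0// mulr_gt0.
have P20 : 0 < P2 by rewrite divr_gt0// mulr_gt0// addr_gt0// invr_gt0.
exists (1 + P1 + P2); first by lra.
move=> N N0N i z rz.
have N1 : 1 <= N by lra.
have N0 : 0 < N by lra.
have zn0 : 0 < `|z| by exact: lt_le_trans rz.
have z0 : z != 0 by rewrite -normr_gt0.
have sz := nsq_gt0 z0.
have c0 : 0 <= 1 - chi N (nsq z) by rewrite subr_ge0 chi_le1.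
rewrite ek_wcut -{2}[gk i z]mul1r -mulrBl normrM distrC (ger0_norm c0).
have gb : `|gk i z| <= K * `|z| ^- d.-1.
  by rewrite (le_trans (gk_bound i z0))// ler_wpM2r ?invr_ge0 ?exprn_ge0// lerDl.
have [sN|Ns] := ltP (nsq z) (N / 2).
  have ga : `|gk i z| <= a.
    rewrite (le_trans gb)// ler_wpM2l ?(ltW K0)// lef_pV2 ?posrE ?exprn_gt0//.
    by rewrite lerXn2r ?nnegrE// ltW.
  have c1 : 1 - chi N (nsq z) <= ((r ^+ 2)^-1 + 2) / N.
    have sN' : nsq z < N by lra.
    apply: (le_trans (chi_lower N0 sz sN')).
    rewrite mulrDl; apply: lerD.
      rewrite invfM mulrC ler_wpM2r ?invr_ge0 ?(ltW N0)// lef_pV2 ?posrE//.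
      by rewrite (le_trans _ (norm2_le_nsq z))// lerXn2r ?nnegrE// ltW.
    rewrite invfM mulrC ler_wpM2r ?invr_ge0 ?(ltW N0)//.
    rewrite -[X in _ <= X]invrK lef_pV2 ?posrE ?invr_gt0// ?subr_gt0//.
    lra.
  apply: (@le_trans _ _ (((r ^+ 2)^-1 + 2) / N * a)).
    by apply: ler_pM.
  rewrite mulrAC ler_pdivrMr// mulrC -ler_pdivrMl//.
  rewrite [X in X <= _](_ : _ = P2); last by rewrite /P2; ring.
  lra.
apply: (@le_trans _ _ (1 * `|gk i z|)).
  by rewrite ler_wpM2r// lerBlDr lerDl chi_ge0.
rewrite mul1r (le_trans gb)//.
have zz : 1 + (K / e) ^+ 2 <= `|z| ^+ 2.
  have : P1 / 2 <= d%:R * `|z| ^+ 2 by rewrite (le_trans _ (nsq_le_norm2 z))//; lra.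
  rewrite [X in X <= _](_ : _ = d%:R * (1 + (K / e) ^+ 2)) ?ler_pM2l//.
  by rewrite /P1; move: ((K / e) ^+ 2) => X; field.
have z1 : 1 <= `|z|.
  rewrite -(@ler_pXn2r _ 2) ?nnegrE// expr1n (le_trans _ zz)// lerDl.
  by rewrite exprn_ge0// divr_ge0// ltW.
have zK : K / e <= `|z|.
  have Ke : 0 <= K / e by rewrite divr_ge0// ltW.
  rewrite -(@ler_pXn2r _ 2) ?nnegrE// (le_trans _ zz)//.
  by rewrite lerDr.
rewrite ler_pdivrMr ?exprn_gt0//.
move: zK; rewrite ler_pdivrMr// => /le_trans; apply.
rewrite mulrC ler_wpM2l ?(ltW e0)//.
by rewrite -[X in X <= _]expr1 ler_weXn2l// -ltnS prednK// (leq_trans _ d2).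
Qed.

End cutoff.

(** * PART 9 *)

Section bounded_expectation.
Context (R : realType) dT (T : measurableType dT).
Implicit Types P : probability T R.

Lemma bounded_integrable P (f : T -> R) M : measurable_fun setT f ->
  (forall x, `|f x| <= M) -> P.-integrable setT (EFin \o f).
Proof.
move=> mf fM; apply: measurable_bounded_integrable => //.
  by rewrite (le_lt_trans (probability_le1 P measurableT))// ltry.
by exists M; split; [exact: num_real|move=> x Mx y _; apply: (le_trans (fM y)); exact: ltW].
Qed.

Lemma Rintegral_cst1 P (c : R) : \int[P]_x c = c.
Proof. by rewrite /Rintegral prob_integral_cst. Qed.

Lemma le_Rintegral_cst P (f : T -> R) M : P.-integrable setT (EFin \o f) ->
  (forall x, f x <= M) -> \int[P]_x f x <= M.
Proof.
move=> fi fM; rewrite -[leRHS](Rintegral_cst1 P); apply: le_Rintegral => //.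
by apply: (@bounded_integrable _ _ `|M|).
Qed.

Lemma norm_Rintegral_le P (f : T -> R) M : measurable_fun setT f ->
  (forall x, `|f x| <= M) -> `|\int[P]_x f x| <= M.
Proof.
move=> mf fM; apply: (le_trans (le_normr_Rintegral measurableT (bounded_integrable P mf fM))).
apply: le_Rintegral_cst => //.
apply: (@bounded_integrable _ _ M); first exact: measurableT_comp.
by move=> x; rewrite normr_id.
Qed.

Lemma norm_Rintegral_fine P (f : T -> R) M : measurable_fun setT f ->
  (\int[P]_x `|f x|%:E <= M%:E)%E ->
  P.-integrable setT (EFin \o f) /\ `|\int[P]_x f x| <= M.
Proof.
move=> mf fM.
have fi : P.-integrable setT (EFin \o f).
  apply/integrableP; split; first exact/measurable_EFinP.
  by apply: le_lt_trans fM _; exact: ltry.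
split => //; apply: (le_trans (le_normr_Rintegral measurableT fi)).
rewrite /Rintegral -lee_fin fineK//.
by apply: integrable_fin_num => //; exact: (integrable_norm fi).
Qed.

End bounded_expectation.

Section singular_fields.
Context (R : realType) (d : nat).
Hypothesis d0 : (0 < d)%N.
Implicit Types rho mu : probability 'rV[R]_d R.

Lemma measurable_subl (f : 'rV[R]_d -> R) (x : 'rV[R]_d) : measurable_fun setT f ->
  measurable_fun setT (fun y : 'rV[R]_d => f (x - y)).
Proof.
move=> mf; apply: (measurableT_comp mf (g := fun y : 'rV[R]_d => x - y)).
apply: measurable_fun_rV_continuous => y.
by apply: continuousB; [exact: cst_continuous|exact: cvg_id].
Qed.

Lemma measurable_subr (f : 'rV[R]_d -> R) (y : 'rV[R]_d) : measurable_fun setT f ->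
  measurable_fun setT (fun x : 'rV[R]_d => f (x - y)).
Proof.
move=> mf; apply: (measurableT_comp mf (g := fun x : 'rV[R]_d => x - y)).
apply: measurable_fun_rV_continuous => x.
by apply: continuousB; [exact: cvg_id|exact: cst_continuous].
Qed.

Lemma measurable_sub2 (f : 'rV[R]_d -> R) : measurable_fun setT f ->
  measurable_fun setT (fun p : 'rV[R]_d * 'rV[R]_d => f (p.1 - p.2)).
Proof.
move=> mf; apply: (measurableT_comp mf (g := fun p : 'rV[R]_d * 'rV[R]_d => p.1 - p.2)).
apply: measurable_fun_rV => i.
under eq_fun do rewrite !mxE.
apply: measurable_funB; apply: (measurableT_comp (measurable_fun_coord i)).
  exact: measurable_fst.
exact: measurable_snd.
Qed.

Lemma continuous_rV_measurable (f : 'rV[R]_d -> R) : continuous f ->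
  measurable_fun setT f.
Proof.
move=> cf; apply: (measurability _ (RGenOpens.measurableE R)) => _ [_ [a [b ->]] <-].
rewrite setTI; apply: rV_open_measurable.
by apply: open_comp => [x _|]; [exact: cf|exact: interval_open].
Qed.

(* kernels with the singularity of the field *)
Lemma singular_kernel_integral A rho (f : 'rV[R]_d -> R) (x : 'rV[R]_d) (c r b : R) :
  growth A rho -> 0 < c -> 0 < r -> 0 <= b -> measurable_fun setT f ->
  (forall z : 'rV[R]_d, z != 0 -> `|z| < r -> `|f z| <= c * `|z| ^- d.-1) ->
  (forall z : 'rV[R]_d, r <= `|z| -> `|f z| <= b) ->
  rho.-integrable setT (EFin \o (fun y : 'rV[R]_d => f (x - y))) /\
  `|\int[rho]_y f (x - y)| <= c * (A * 2 ^+ d * r) + b.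
Proof.
move=> gr c0 r0 b0 mf fin fout.
apply: norm_Rintegral_fine; first exact: measurable_subl.
have h := @singular_integral R d A rho (fun y => `|f (x - y)| / c) x r (b / c) d0 gr r0.
have mn : measurable_fun setT (fun y : 'rV[R]_d => `|f (x - y)|).
  by apply: measurableT_comp => //; exact: measurable_subl.
have {}h : (\int[rho]_y (`|f (x - y)| / c)%:E <= (A * 2 ^+ d * r + b / c)%:E)%E.
  apply: h.
  - by rewrite divr_ge0// ltW.
  - exact: measurable_funM.
  - by move=> y; rewrite divr_ge0// ltW.
  - move=> y yx xyr; rewrite ler_pdivrMr// mulrDl divfK ?gt_eqF//.
    rewrite (le_trans (fin _ _ xyr)) ?subr_eq0 1?eq_sym//.
    by rewrite mulrC lerDl.
  - by move=> y ry; rewrite ler_pM2r ?invr_gt0// fout.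
have -> : (\int[rho]_y `|f (x - y)|%:E = c%:E * \int[rho]_y (`|f (x - y)| / c)%:E)%E.
  rewrite -ge0_integralZl//; last 3 first.
  - by apply: measurable_fun_EFin; exact: measurable_funM.
  - by move=> y _; rewrite lee_fin divr_ge0// ltW.
  - by rewrite lee_fin ltW.
  apply: eq_integral => y _; rewrite -EFinM; congr EFin.
  by rewrite mulrC divfK ?gt_eqF.
apply: (@le_trans _ _ (c%:E * (A * 2 ^+ d * r + b / c)%:E)%E).
  by apply: lee_wpmul2l => //; rewrite lee_fin ltW.
by rewrite -EFinM lee_fin mulrDr [c * (b / c)]mulrC divfK ?gt_eqF.
Qed.

Definition kap1 : R := kappa R d + 1.

Lemma kap1_gt0 : 0 < kap1.
Proof. by rewrite ltr_wpDl// kappa_ge0. Qed.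

Definition cf (i : 'I_d) rho (x : 'rV[R]_d) : R := \int[rho]_y gk i (x - y).
Definition ce (w : R -> R) (i : 'I_d) rho (x : 'rV[R]_d) : R := \int[rho]_y ek w i (x - y).

Lemma gk_bound1 i (z : 'rV[R]_d) : z != 0 -> `|gk i z| <= kap1 * `|z| ^- d.-1.
Proof.
move=> z0; rewrite (le_trans (gk_bound i z0))// ler_wpM2r ?invr_ge0 ?exprn_ge0//.
by rewrite lerDl.
Qed.

Definition vmax (A : R) : R := kap1 * (A * 2 ^+ d * 1) + kap1.

Lemma cf_bound A rho i x : growth A rho ->
  rho.-integrable setT (EFin \o (fun y : 'rV[R]_d => gk i (x - y))) /\ `|cf i rho x| <= vmax A.
Proof.
move=> gr; apply: singular_kernel_integral => //.
- exact: kap1_gt0.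
- exact: ltW kap1_gt0.
- exact: measurable_gk.
- by move=> z z0 _; exact: gk_bound1.
- move=> z z1; have z0 : z != 0 by rewrite -normr_gt0 (lt_le_trans _ z1).
  rewrite (le_trans (gk_bound1 i z0))// ler_piMr ?(ltW kap1_gt0)//.
  by rewrite invf_le1 ?exprn_gt0 ?exprn_ege1// normr_gt0.
Qed.

Lemma vmax_ge0 A rho : growth A rho -> 0 <= vmax A.
Proof. by move=> gr; have [_] := cf_bound (Ordinal d0) 0 gr; exact: le_trans. Qed.

Lemma measurable_ek (w : R -> R) i : continuous w -> measurable_fun setT (@ek R w d i).
Proof.
move=> cw; apply: measurable_funM.
  by apply: measurable_funM => //; exact: measurable_fun_coord.
apply: measurableT_comp; first exact: continuous_measurable_fun.
exact: measurable_nsq.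
Qed.

Lemma ce_cf (A e : R) : (2 <= d)%N -> 0 <= A -> 0 < e ->
  exists2 N0, 0 < N0 & forall N, N0 <= N -> forall rho i x, growth A rho ->
  `|ce (wcut d N) i rho x - cf i rho x| <= e.
Proof.
move=> d2 A0 e0.
pose r := e / 2 / (kap1 * (A * 2 ^+ d) + 1).
have q0 : 0 < kap1 * (A * 2 ^+ d) + 1.
  by rewrite ltr_wpDl// mulr_ge0 ?(ltW kap1_gt0)// mulr_ge0.
have r0 : 0 < r by rewrite !divr_gt0.
have e20 : 0 < e / 2 by rewrite divr_gt0.
have [N0 N00 hN] := cutoff_uniform d2 r0 e20.
exists N0 => // N NN rho i x gr.
have N_gt0 : 0 < N by exact: lt_le_trans NN.
have cw : continuous (wcut d N) := @wcut_smooth R d N 0 N_gt0.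
have [] := @singular_kernel_integral A rho (fun z => ek (wcut d N) i z - gk i z) x kap1 r (e / 2)
  gr kap1_gt0 r0 (ltW e20).
- by apply: measurable_funB; [exact: measurable_ek|exact: measurable_gk].
- move=> z z0 _; rewrite ek_wcut -{2}[gk i z]mul1r -mulrBl normrM.
  rewrite (le_trans _ (gk_bound1 i z0))// ler_piMl// distrC ger0_norm.
    by rewrite lerBlDr lerDl chi_ge0.
  by rewrite subr_ge0 chi_le1.
- by move=> z rz; exact: hN.
move=> _; rewrite RintegralB//; last 2 first.
- have [M M0 hM] := ek_bounded (fun k => wcut_smooth d k N_gt0) (fun s => @wcut_le0 R d N s N_gt0)
     (fun s => @wcut_ge R d N s N_gt0) d.
  have mek : measurable_fun setT (@ek R (wcut d N) d i) by exact: measurable_ek.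
  exact: (@bounded_integrable _ _ _ rho _ M (measurable_subl x mek) (fun y => hM i (x - y))).
- by have [] := cf_bound i x gr.
move=> /le_trans; apply; rewrite [leRHS](splitr e) lerD2r.
rewrite mulrA -[leLHS]mulrC /r mulrAC ler_pdivrMr//.
by rewrite ler_wpM2l// ?(ltW e20)// lerDl.
Qed.

Lemma ce_lipschitz (w : R -> R) (N : R) : (forall k, Ck k (w : R^o -> R)) ->
  (forall s, s <= 0 -> w s = 0) -> (forall s, N <= s -> w s = 0) ->
  exists M L, [/\ 0 <= M, 0 <= L & forall i rho,
   [/\ forall x, rho.-integrable setT (EFin \o (fun y : 'rV[R]_d => ek w i (x - y))),
      forall x, `|ce w i rho x| <= M &
      forall x x', `|ce w i rho x - ce w i rho x'| <= L * `|x - x'|]].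
Proof.
move=> Cw w0 wN.
have [M M0 hM] := ek_bounded Cw w0 wN d.
have [L L0 hL] := ek_lipschitz Cw w0 wN d.
have me i : measurable_fun setT (@ek R w d i) by apply: measurable_ek; exact: (Cw 0%N).
exists M, L; split => // i rho.
have ie x : rho.-integrable setT (EFin \o (fun y : 'rV[R]_d => ek w i (x - y))).
  apply: (@bounded_integrable _ _ _ _ _ M) => // y.
  exact: measurable_subl.
split => // [x|x x'].
  by apply: norm_Rintegral_le => //; exact: measurable_subl.
rewrite /ce -RintegralB//; apply: norm_Rintegral_le.
  by apply: measurable_funB; exact: measurable_subl.
by move=> y; apply: (le_trans (hL _ _ _)); rewrite opprB addrA subrK.
Qed.

Lemma measurable_cf A rho i : (2 <= d)%N -> growth A rho ->
  measurable_fun setT (cf i rho).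
Proof.
move=> d2 gr; apply: (@measurable_fun_cvg _ _ _ setT (fun n => ce (wcut d n.+1%:R) i rho)) => //.
  move=> n; have n0 : (0 : R) < n.+1%:R by [].
  have [M [L [_ _ h]]] := ce_lipschitz (fun k => wcut_smooth d k n0) (fun s => @wcut_le0 R d _ s n0)
     (fun s => @wcut_ge R d _ s n0).
  have [_ _ hL] := h i rho.
  by apply: continuous_rV_measurable; exact: lipschitz_continuous hL.
move=> x _; apply/cvgrPdist_le => e e0.
have [N0 N00 hN] := ce_cf d2 (growth_ge0 gr) e0.
near=> n; rewrite distrC hN//.
apply: (@le_trans _ _ n%:R); last by rewrite ler_nat.
by near: n; exact: nbhs_infty_ger.
Unshelve. all: by end_near. Qed.

Lemma gradient_integral A rho i x : growth A rho ->
  \int[rho]_y (gradient (@coulomb R d) (x - y) 0 i) = cf i rho x.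
Proof.
move=> gr; rewrite /cf /Rintegral; congr fine.
set f := fun y : 'rV[R]_d => gradient (@coulomb R d) (x - y) 0 i.
have fE : f = fun y => gk i (x - y) + (f x) * \1_[set x] y.
  apply/funext => y; rewrite indicE; have [->|yx] := eqVneq y x.
    by rewrite mem_set// mulr1 subrr gk0 add0r.
  rewrite memNset ?mulr0 ?addr0; last by apply/eqP.
  by rewrite /f gradient_coulomb// subr_eq0 eq_sym.
apply: ae_eq_integral => //.
- rewrite (_ : (fun y => _) = EFin \o f)// fE; apply/measurable_EFinP.
  apply: measurable_funD; first by apply: measurable_subl; exact: measurable_gk.
  by apply: measurable_funM => //; apply: measurable_indic; exact: rV_measurable_set1.
- by apply/measurable_EFinP; apply: measurable_subl; exact: measurable_gk.
exists [set x]; split; [exact: rV_measurable_set1|exact: growth_set1 gr|].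
move=> y /= h; apply: contrapT => /eqP yx; apply: h => _.
by rewrite gradient_coulomb// subr_eq0 eq_sym.
Qed.

Lemma fieldE A rho mu x i : growth A rho -> growth A mu ->
  field rho mu x 0 i = cf i rho x - cf i mu x.
Proof. by move=> gr gm; rewrite mxE (gradient_integral _ _ gr) (gradient_integral _ _ gm). Qed.

End singular_fields.

(** * PART 10 *)

Lemma Rintegral_dominated dT (T : measurableType dT) (R : realType)
  (P : probability T R) (f_ : nat -> T -> R) (f g : T -> R) :
  (forall n, measurable_fun setT (f_ n)) -> measurable_fun setT f ->
  {ae P, forall x, f_ n x @[n --> \oo] --> f x} ->
  P.-integrable setT (EFin \o g) ->
  {ae P, forall x, forall n, `|f_ n x| <= g x} ->
  P.-integrable setT (EFin \o f) /\
  \int[P]_x f_ n x @[n --> \oo] --> \int[P]_x f x.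
Proof.
move=> mf_ mf f_f ig f_g.
have [|||||fi _ h] := @dominated_convergence _ _ R P setT measurableT
    (fun n => EFin \o f_ n) (EFin \o f) (EFin \o g).
- by move=> n; exact/measurable_EFinP.
- exact/measurable_EFinP.
- by apply: filterS f_f => x h _; apply: cvg_EFin; [exact: nearW|].
- exact: ig.
- by apply: filterS f_g => x h n _; rewrite /= lee_fin.
split=> //; apply: fine_cvg; rewrite /Rintegral fineK//.
exact: integrable_fin_num.
Qed.

Section narrow_curve.
Context (R : realType) (d : nat).
Variable r : R -> probability 'rV[R]_d R.
Hypothesis narrow : forall f : 'rV[R]_d -> R, continuous f ->
  (exists M : R, forall x, `|f x| <= M) ->
  continuous (fun t : R => \int[r t]_x f x).

Lemma narrow_diag (f : R -> 'rV[R]_d -> R) (s M L u : R) : 0 < u ->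
  (forall t x, `|t - s| < u -> `|f t x| <= M) ->
  (forall t x x', `|t - s| < u -> `|f t x - f t x'| <= L * `|x - x'|) ->
  (forall x, f t x @[t --> s] --> f s x) ->
  \int[r t]_x f t x @[t --> s] --> \int[r s]_x f s x.
Proof.
move=> u0 fM fL fs.
have ss : `|s - s| < u by rewrite subrr normr0.
have M0 : 0 <= M by apply: le_trans (fM s 0 ss).
have cf t : `|t - s| < u -> continuous (f t).
  by move=> ts; apply: (@lipschitz_continuous _ _ _ L) => z z'; exact: fL.
have mf t : `|t - s| < u -> measurable_fun setT (f t).
  by move=> /cf; exact: continuous_rV_measurable.
pose e t x := `|f t x - f s x|.
have e2M t x : `|t - s| < u -> e t x <= 2 * M.
  by move=> ts; rewrite (le_trans (ler_normB _ _))// mulr_natl mulr2n lerD// fM.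
pose un (n : nat) := Num.min u n.+1%:R^-1.
have un0 n : 0 < un n by rewrite lt_min u0/= invr_gt0.
have unu n t : `|t - s| < un n -> `|t - s| < u by move=> h; rewrite (lt_le_trans h)// ge_min lexx.
pose E n x := [set e t x | t in [set t | `|t - s| < un n]].
pose F n x := sup (E n x).
have E0 n x : E n x !=set0 by exists (e s x), s => //=; rewrite subrr normr0.
have EM n x : ubound (E n x) (2 * M) by move=> _ [t /= /unu ts <-]; exact: e2M.
have Es n x : has_sup (E n x) by split => //; exists (2 * M).
have eF n t x : `|t - s| < un n -> e t x <= F n x.
  by move=> ts; apply: ub_le_sup; [by exists (2 * M)|exists t].
have F0 n x : 0 <= F n x.
  by apply: (le_trans _ (eF n s x _)); rewrite ?subrr ?normr0// /e.
have FM n x : F n x <= 2 * M by apply: ge_sup.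
have FL n x x' : F n x <= F n x' + 2 * L * `|x - x'|.
  apply: ge_sup => // _ [t /= ts <-].
  apply: (@le_trans _ _ (e t x' + 2 * L * `|x - x'|)); last by rewrite lerD2r eF.
  rewrite /e.
  have -> : f t x - f s x = (f t x' - f s x') + ((f t x - f t x') - (f s x - f s x')) by ring.
  rewrite (le_trans (ler_normD _ _))// lerD2l (le_trans (ler_normB _ _))//.
  by rewrite -mulrA mulr_natl mulr2n lerD// fL// (unu n).
have cF n : continuous (F n).
  apply: (@lipschitz_continuous _ _ _ (2 * L)) => z z'.
  by rewrite ler_distl lerBlDr FL distrC FL.
have nF n x : `|F n x| <= 2 * M by rewrite ger0_norm.
have iF n t : (r t).-integrable setT (EFin \o F n).
  by apply: (@bounded_integrable _ _ _ _ _ (2 * M)) => //; exact: continuous_rV_measurable.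
have limF : (\int[r s]_x F n x) @[n --> \oo] --> (0 : R).
  rewrite -[X in _ --> X](Rintegral_cst1 (r s) 0).
  apply: (proj2 (@Rintegral_dominated _ _ _ (r s) F (cst 0) (cst (2 * M)) _ _ _ _ _)).
  - by move=> n; exact: continuous_rV_measurable.
  - exact: measurable_cst.
  - apply: aeW => x; apply/cvgrPdist_le => eps eps0.
    have [v /= v0 hv] := (nbhs_ballP _ _).1 (cvgr_dist_le _ _ (fs x) _ eps0).
    near=> n; rewrite sub0r normrN ger0_norm//; apply: ge_sup => // _ [t /= ts <-].
    rewrite /e distrC; apply: hv; rewrite /ball/= distrC (lt_le_trans ts)//.
    rewrite /un ge_min; apply/orP; right; near: n.
    by apply: filterS (near_infty_natSinv_lt (PosNum v0)) => n /ltW.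
  - by apply: (@bounded_integrable _ _ _ _ _ (2 * M)) => // x; rewrite ger0_norm ?mulr_ge0.
  - by apply: aeW => x n.
apply/cvgrPdist_le => eps eps0.
have e3 : 0 < eps / 3 by rewrite divr_gt0.
have [n hn] : exists n, \int[r s]_x F n x <= eps / 3.
  have [n _ /(_ n (leqnn n))] := cvgr_dist_le _ _ limF _ e3.
  by rewrite /= sub0r normrN => h; exists n; rewrite (le_trans (ler_norm _)).
have nearu : \forall t \near s, `|t - s| < un n.
  near=> t; rewrite distrC; near: t; exact: nbhsx_ballx.
have h1 : \forall t \near s, `|\int[r s]_x F n x - \int[r t]_x F n x| <= eps / 3.
  exact: (cvgr_dist_le _ _ (@narrow _ (cF n) (ex_intro _ _ (nF n)) s) _ e3).
have h2 : \forall t \near s, `|\int[r s]_x f s x - \int[r t]_x f s x| <= eps / 3.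
  exact: (cvgr_dist_le _ _ (@narrow _ (cf _ ss) (ex_intro _ M (fun x => fM s x ss)) s) _ e3).
near=> t.
have ts : `|t - s| < un n by near: t.
have tu := unu _ _ ts.
have a1 : `|\int[r s]_x F n x - \int[r t]_x F n x| <= eps / 3 by near: t.
have a2 : `|\int[r s]_x f s x - \int[r t]_x f s x| <= eps / 3 by near: t.
have fi v : `|v - s| < u -> (r t).-integrable setT (EFin \o f v).
  move=> vs; apply: (@bounded_integrable _ _ _ _ _ M); [exact: mf|by move=> x; exact: fM].
have a3 : `|\int[r t]_x f s x - \int[r t]_x f t x| <= \int[r t]_x F n x.
  rewrite -RintegralB//; [|exact: fi|exact: fi].
  have fii : (r t).-integrable setT (EFin \o (fun x => f s x - f t x)).
    by have := integrableB measurableT (fi s ss) (fi t tu).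
  apply: (le_trans (le_normr_Rintegral measurableT fii)).
  apply: le_Rintegral => //; [exact: (integrable_norm fii)|exact: iF|].
  by move=> x _; rewrite distrC; exact: eF.
have a4 : \int[r t]_x F n x <= eps / 3 + eps / 3.
  by move: a1; rewrite ler_distl => /andP[+ _]; lra.
have := ler_normD (\int[r s]_x f s x - \int[r t]_x f s x) (\int[r t]_x f s x - \int[r t]_x f t x).
rewrite addrA subrK => /le_trans; apply.
lra.
Unshelve. all: by end_near. Qed.

End narrow_curve.

(** * PART 11 *)

Lemma continuous_approx (R : realType) (f : R -> R) :
  (forall e, 0 < e -> exists g : R -> R, continuous g /\ forall t, `|f t - g t| <= e) ->
  continuous f.
Proof.
move=> h s; apply/cvgrPdist_le => e e0.
have e3 : 0 < e / 3 by rewrite divr_gt0.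
have [g [cg fg]] := h _ e3.
have near1 : \forall t \near s, `|g s - g t| <= e / 3.
  exact: (cvgr_dist_le _ _ (cg s) _ e3).
near=> t.
have a1 : `|g s - g t| <= e / 3 by near: t.
have -> : f s - f t = (f s - g s) + (g s - g t) - (f t - g t) by ring.
have := fg s; have := fg t.
have := ler_normD (f s - g s) (g s - g t).
have := ler_normB ((f s - g s) + (g s - g t)) (f t - g t).
by lra.
Unshelve. all: by end_near. Qed.

Lemma norm_sum_le (R : realType) n (f : 'I_n -> R) M :
  (forall i, `|f i| <= M) -> `|\sum_i f i| <= n%:R * M.
Proof.
move=> fM; apply: (le_trans (ler_norm_sum _ _ _)).
by rewrite mulr_natl -[X in _ <= _ *+ X]card_ord -sumr_const ler_sum.
Qed.

Lemma subrB4 (R : zmodType) (a b c e : R) : (a - b) - (c - e) = (a - c) - (b - e).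
Proof. by rewrite !opprB addrACA [RHS]addrACA [- b - c]addrC. Qed.

Lemma mulrBB (R : pzRingType) (a b c e : R) : a * b - c * e = (a - c) * b + c * (b - e).
Proof. by rewrite mulrBl mulrBr addrA subrK. Qed.

Section flux.
Context (R : realType) (d : nat).
Hypothesis d2 : (2 <= d)%N.
Variables (r : R -> probability 'rV[R]_d R) (mu : probability 'rV[R]_d R) (A : R).
Hypothesis narrow : forall f : 'rV[R]_d -> R, continuous f ->
  (exists M : R, forall x, `|f x| <= M) ->
  continuous (fun t : R => \int[r t]_x f x).
Hypothesis gr : forall t, growth A (r t).
Hypothesis gmu : growth A mu.

Let d0 : (0 < d)%N. Proof. exact: leq_trans d2. Qed.

Implicit Types (p q : 'I_d -> 'rV[R]_d -> R) (i : 'I_d) (t : R) (M L : R).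

Definition fluct i t (x : 'rV[R]_d) : R := cf i (r t) x - cf i mu x.

Definition flux (p : 'I_d -> 'rV[R]_d -> R) (t : R) : R :=
  - \int[r t]_x \sum_i fluct i t x * p i x.

Lemma fluct_bound i t x : `|fluct i t x| <= 2 * vmax d A.
Proof.
rewrite /fluct (le_trans (ler_normB _ _))// mulr_natl mulr2n lerD//.
  by have [] := cf_bound d0 i x (gr t).
by have [] := cf_bound d0 i x gmu.
Qed.

Lemma measurable_fluct i t : measurable_fun setT (fluct i t).
Proof.
apply: measurable_funB.
  exact: (measurable_cf d0 i d2 (gr t)).
exact: (measurable_cf d0 i d2 gmu).
Qed.

Let V : R := 2 * vmax d A.

Lemma vmax2_ge0 : 0 <= V.
Proof. by rewrite mulr_ge0//; exact: (vmax_ge0 d0 gmu). Qed.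

Lemma flux_integrable p t M : (forall i, measurable_fun setT (p i)) ->
  (forall i x, `|p i x| <= M) ->
  (r t).-integrable setT (EFin \o (fun x => \sum_i fluct i t x * p i x)).
Proof.
move=> mp pM; apply: (@bounded_integrable _ _ _ _ _ (d%:R * (V * M))).
  apply: measurable_sum => i; apply: measurable_funM => //; exact: measurable_fluct.
move=> x; apply: norm_sum_le => i; rewrite normrM ler_pM//.
exact: fluct_bound.
Qed.

Lemma flux_bound p t M : (forall i, measurable_fun setT (p i)) ->
  (forall i x, `|p i x| <= M) -> `|flux p t| <= d%:R * (V * M).
Proof.
move=> mp pM; rewrite /flux normrN; apply: norm_Rintegral_le.
  apply: measurable_sum => i; apply: measurable_funM => //; exact: measurable_fluct.
move=> x; apply: norm_sum_le => i; rewrite normrM ler_pM//.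
exact: fluct_bound.
Qed.

Lemma fluxB p q t M : (forall i, measurable_fun setT (p i)) ->
  (forall i, measurable_fun setT (q i)) ->
  (forall i x, `|p i x| <= M) -> (forall i x, `|q i x| <= M) ->
  flux p t - flux q t = flux (fun i x => p i x - q i x) t.
Proof.
move=> mp mq pM qM; rewrite /flux -opprD -RintegralB//; last 2 first.
- exact: (flux_integrable t mp pM).
- exact: (flux_integrable t mq qM).
congr (- _); apply: eq_Rintegral => x _.
by rewrite -sumrB; apply: eq_bigr => i _; rewrite mulrBr.
Qed.

Lemma flux_continuous p M L : 
  (forall i x, `|p i x| <= M) -> (forall i x x', `|p i x - p i x'| <= L * `|x - x'|) ->
  continuous (flux p).
Proof.
move=> pM pL; apply: continuous_approx => e e0.
have M0 : 0 <= M by apply: le_trans (pM (Ordinal d0) 0).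
have mp i : measurable_fun setT (p i).
  by apply: continuous_rV_measurable; exact: lipschitz_continuous (pL i).
pose e1 := e / (d%:R * (2 * M) + 1).
have q0 : 0 < d%:R * (2 * M) + 1 :> R by rewrite ltr_wpDl// mulr_ge0// mulr_ge0.
have e10 : 0 < e1 by rewrite divr_gt0.
have [N N0 hN] := ce_cf d0 d2 (growth_ge0 gmu) e10.
have {}hN := hN N (lexx N).
have [M' [L' [M'0 L'0 h]]] := ce_lipschitz d (fun k => wcut_smooth d k N0)
  (fun s => @wcut_le0 R d N s N0) (fun s => @wcut_ge R d N s N0).
pose Fn i t x := ce (wcut d N) i (r t) x - ce (wcut d N) i mu x.
have FnM i t x : `|Fn i t x| <= 2 * M'.
  rewrite /Fn (le_trans (ler_normB _ _))// mulr_natl mulr2n lerD//.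
    by have [_ ] := h i (r t).
  by have [_ ] := h i mu.
have FnL i t x x' : `|Fn i t x - Fn i t x'| <= 2 * L' * `|x - x'|.
  rewrite /Fn subrB4.
  rewrite (le_trans (ler_normB _ _))// -mulrA mulr_natl mulr2n lerD//.
    by have [_ _] := h i (r t).
  by have [_ _] := h i mu.
have FF i t x : `|fluct i t x - Fn i t x| <= 2 * e1.
  rewrite /fluct /Fn subrB4.
  have h1 := hN (r t) i x (gr t); have h2 := hN mu i x gmu.
  rewrite distrC in h1; rewrite distrC in h2.
  by rewrite (le_trans (ler_normB _ _))// mulr_natl mulr2n lerD.
have mFn i t : measurable_fun setT (Fn i t).
  by apply: continuous_rV_measurable; exact: lipschitz_continuous (FnL i t).
have bd t x : `|\sum_i Fn i t x * p i x| <= d%:R * (2 * M' * M).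
  by apply: norm_sum_le => i; rewrite normrM ler_pM.
have mS t : measurable_fun setT (fun x => \sum_i Fn i t x * p i x).
  by apply: measurable_sum => i; apply: measurable_funM.
exists (fun t => - \int[r t]_x \sum_i Fn i t x * p i x); split; last first.
  move=> t; rewrite /flux -opprD normrN -RintegralB//; last 2 first.
  - exact: (flux_integrable t mp pM).
  - exact: (@bounded_integrable _ _ _ _ _ (d%:R * (2 * M' * M))).
  apply: (@le_trans _ _ (d%:R * (2 * e1 * M))).
    apply: norm_Rintegral_le.
      apply: measurable_funB => //.
      by apply: measurable_sum => i; apply: measurable_funM => //; exact: measurable_fluct.
    move=> x; rewrite -sumrB; apply: norm_sum_le => i.
    by rewrite -mulrBl normrM ler_pM.
  rewrite [leLHS](_ : _ = (d%:R * (2 * M)) * e1); last by ring.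
  rewrite /e1 mulrCA ler_piMr ?(ltW e0)// ler_pdivrMr// mul1r lerDl//.
move=> s; apply: cvgN.
apply: (@narrow_diag R d r narrow (fun t x => \sum_i Fn i t x * p i x) s
  (d%:R * (2 * M' * M)) (d%:R * (2 * L' * M + 2 * M' * L)) 1) => //.
  move=> t x x' _; rewrite -sumrB -[leRHS]mulrA; apply: norm_sum_le => i.
  rewrite mulrBB.
  rewrite (le_trans (ler_normD _ _))// [leRHS]mulrDl lerD// normrM.
    by rewrite mulrAC ler_pM.
  by rewrite -[leRHS]mulrA ler_pM.
move=> x.
have [ML _ hek] := ek_bounded (fun k => wcut_smooth d k N0) (fun s => @wcut_le0 R d N s N0)
     (fun s => @wcut_ge R d N s N0) d.
have [Lk _ hLk] := ek_lipschitz (fun k => wcut_smooth d k N0) (fun s => @wcut_le0 R d N s N0)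
     (fun s => @wcut_ge R d N s N0) d.
have cn i :
    continuous (fun t : R => ce (wcut d N) i (r t) x).
  apply: (@narrow (fun y => ek (wcut d N) i (x - y))); last by exists ML => y.
  apply: (@lipschitz_continuous _ _ _ Lk) => z z'.
  rewrite (le_trans (hLk _ _ _))//.
  by rewrite opprB addrC subrKA distrC.
have cF i : continuous (fun t : R => Fn i t x * p i x).
  by move=> t; apply: cvgMl; apply: cvgB; [exact: cn|exact: cvg_cst].
exact: (@Ck_sum R R^o 0 d (fun i t => Fn i t x * p i x) cF).
Qed.

End flux.

(** * PART 12 *)

Section weak_derivative.
Context (R : realType).

Lemma FTC2_is_derive (F f : R -> R) (a b : R) : a < b -> continuous f ->
  (forall x, a <= x <= b -> is_derive x (1 : R) F (f x)) ->
  \int[lebesgue_measure]_(x in `[a, b]) f x = F b - F a.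
Proof.
move=> ab cf dF.
have cF x : a <= x <= b -> {for x, continuous F}.
  move=> xab; apply: differentiable_continuous; apply/derivable1_diffP.
  by have [] := dF x xab.
rewrite /Rintegral (@continuous_FTC2 _ f F a b ab)//.
- exact: continuous_subspaceT.
- split.
  + by move=> x; rewrite in_itv/= => /andP[ax xb]; have [] := dF x; rewrite ?ltW.
  + by apply: cvg_at_right_filter; apply: cF; rewrite lexx ltW.
  + by apply: cvg_at_left_filter; apply: cF; rewrite lexx ltW.
- move=> x; rewrite in_itv/= => /andP[ax xb].
  by have [_ <-] := dF x ltac:(by rewrite !ltW); rewrite derive1E.
Qed.

Definition bump (p e t : R) : R := theta 0 (t - (p - e)) * theta 0 (p + e - t).

Lemma bump_ge0 p e t : 0 <= bump p e t.
Proof. by rewrite mulr_ge0// theta_ge0. Qed.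

Lemma bump_left p e t : t <= p - e -> bump p e t = 0.
Proof. by move=> h; rewrite /bump theta_le0 ?mul0r// subr_le0. Qed.

Lemma bump_right p e t : p + e <= t -> bump p e t = 0.
Proof. by move=> h; rewrite /bump [X in _ * X]theta_le0 ?mulr0// subr_le0. Qed.

Lemma bump_gt0 p e t : p - e < t < p + e -> 0 < bump p e t.
Proof.
by move=> /andP[h1 h2]; rewrite /bump /theta !subr_gt0 h1 h2 mulr_gt0// expR_gt0.
Qed.

Lemma bump_smooth p e k : Ck k (bump p e : R^o -> R).
Proof.
apply: CkM.
  apply: (Ck_comp (u := theta 0)); first exact: theta_Ck.
  rewrite [X in Ck k X](_ : _ = fun t => 1 * t + - (p - e)); first exact: Ck_affine.
  by apply/funext => t; rewrite mul1r.
apply: (Ck_comp (u := theta 0)); first exact: theta_Ck.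
rewrite [X in Ck k X](_ : _ = fun t => (-1) * t + (p + e)); first exact: Ck_affine.
by apply/funext => t; rewrite mulN1r addrC.
Qed.

(* normalised smooth step *)
Lemma smooth_step p e : 0 < e -> exists (W : R -> R) (I : R),
  [/\ 0 < I, forall t, is_derive t (1 : R) W (bump p e t / I),
      forall k, Ck k (W : R^o -> R), forall t, t <= p - e -> W t = 0 &
      forall t, p + e <= t -> W t = 1].
Proof.
move=> e0; have cb : continuous (bump p e) := @bump_smooth p e 0%N.
have [W [dW W0]] := antiderivative0 cb (@bump_left p e).
pose I := W (p + e).
have WI t : p + e <= t -> W t = I.
  by apply: derive0_ge_cst => x px; rewrite -(bump_right px).
have I0 : 0 < I.
  have pe : p - e < p + e by lra.
  have [|c /[!in_itv]/= cpe h] := MVT pe (fun x _ => dW x).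
    by apply: continuous_subspaceT; exact: is_derive_Ck0 dW.
  have -> : I = bump p e c * (p + e - (p - e)) by rewrite -h (W0 (p - e))// subr0.
  by rewrite mulr_gt0 ?bump_gt0//; lra.
have dV (t : R) : is_derive t (1 : R) (fun t => I^-1 * W t) (bump p e t / I).
  by rewrite [bump p e t / I]mulrC; apply: is_deriveZ.
exists (fun t => I^-1 * W t), I; split => //.
- move=> k; apply: CkZ; apply: CkS; exact: (CkR dW (bump_smooth p e k)).
- by move=> t /W0 ->; rewrite mulr0.
- by move=> t /WI ->; rewrite mulVf ?gt_eqF.
Qed.

Lemma weak_derivative (m b : R -> R) (T : R) :
  continuous m -> continuous b ->
  (forall (eta eta' : R -> R) (u v : R),
    (forall t, is_derive t (1 : R) eta (eta' t)) ->
    (forall k, Ck k (eta : R^o -> R)) -> 0 < u -> v < T ->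
    (forall t, t < u -> eta t = 0) -> (forall t, v < t -> eta t = 0) ->
    \int[lebesgue_measure]_(t in `[0, T]) (eta' t * m t + eta t * b t) = 0) ->
  forall t, 0 < t < T -> is_derive t (1 : R) m (b t).
Proof.
move=> cm cb weak.
pose B (y : R) := \int[lebesgue_measure]_(t in `[-1, y]) b t.
have dB (x : R) : -1 < x -> is_derive x (1 : R) B (b x) by exact: antiderivative_gt.
pose q (t : R) := m t - B t.
have cB (x : R) : -1 < x -> {for x, continuous B}.
  by move=> x1; apply: differentiable_continuous; apply/derivable1_diffP; have [] := dB x x1.
have cq (x : R) : -1 < x -> {for x, continuous q}.
  by move=> x1; apply: continuousB; [exact: cm|exact: cB].
have le_q (p1 p2 : R) : 0 < p1 < T -> 0 < p2 < T -> q p2 <= q p1.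
  move=> /andP[p10 p1T] /andP[p20 p2T]; rewrite leNgt; apply/negP => qq.
  have T0 : 0 < T by lra.
  pose c1 := q p1 + (q p2 - q p1) / 3; pose c2 := q p2 - (q p2 - q p1) / 3.
  have c12 : c1 < c2 by rewrite /c1 /c2; lra.
  have [e1 /= e10 h1] : exists2 e, 0 < e & forall t, `|p1 - t| < e -> q t <= c1.
    have h : \forall t \near p1, q t <= c1.
      have := cq p1 ltac:(lra); move=> /cvgr_le; apply; rewrite /c1; lra.
    by have [e e0 he] := (nbhs_ballP _ _).1 h; exists e.
  have [e2 /= e20 h2] : exists2 e, 0 < e & forall t, `|p2 - t| < e -> c2 <= q t.
    have h : \forall t \near p2, c2 <= q t.
      have := cq p2 ltac:(lra); move=> /cvgr_ge; apply; rewrite /c2; lra.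
    by have [e e0 he] := (nbhs_ballP _ _).1 h; exists e.
  have [e [e0 [ee1 [ee2 [l1 [l2 [l3 l4]]]]]]] : exists e, 0 < e /\ e <= e1 /\ e <= e2 /\
      0 < p1 - e /\ 0 < p2 - e /\ p1 + e < T /\ p2 + e < T.
    pose M := Num.min (Num.min e1 e2) (Num.min (Num.min p1 p2) (Num.min (T - p1) (T - p2))).
    have M0 : 0 < M by rewrite !lt_min !subr_gt0 e10 e20 p10 p20 p1T p2T.
    have : M <= M by [].
    rewrite {2}/M !le_min => /andP[/andP[M1 M2] /andP[/andP[M3 M4] /andP[M5 M6]]].
    by exists (M / 2); repeat split; lra.
  have [W1 [I1 [I10 dW1 CW1 W10 W11]]] := smooth_step p1 e0.
  have [W2 [I2 [I20 dW2 CW2 W20 W21]]] := smooth_step p2 e0.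
  pose eta (t : R) := W1 t + (-1) * W2 t.
  pose eta' (t : R) := bump p1 e t / I1 - bump p2 e t / I2.
  have deta (t : R) : is_derive t (1 : R) eta (eta' t).
    by apply: is_derive_eq; rewrite /eta' /GRing.scale/= mulN1r.
  have Ceta k : Ck k (eta : R^o -> R) by apply: CkD => //; exact: CkZ.
  have ceta : continuous eta := Ceta 0%N.
  have ceta' : continuous eta'.
    move=> t; apply: cvgB; apply: cvgMl; exact: (@bump_smooth _ _ 0%N).
  have eta0 (t : R) : t <= Num.min (p1 - e) (p2 - e) -> eta t = 0.
    by rewrite le_min => /andP[h3 h4]; rewrite /eta W10// W20// mulr0 addr0.
  have eta1 (t : R) : Num.max (p1 + e) (p2 + e) <= t -> eta t = 0.
    by rewrite ge_max => /andP[h3 h4]; rewrite /eta W11// W21// mulr1 subrr.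
  have := weak eta eta' (Num.min (p1 - e) (p2 - e)) (Num.max (p1 + e) (p2 + e)) deta Ceta.
  rewrite lt_min l1 l2 gt_max l3 l4 => /(_ isT isT) w.
  have {}w : \int[lebesgue_measure]_(t in `[0, T]) (eta' t * m t + eta t * b t) = 0.
    by apply: w => t ht; [apply: eta0|apply: eta1]; exact: ltW.
  pose b0 (t : R) := B (Num.max t 0).
  have cb0 : continuous b0.
    move=> t; have cmax : {for t, continuous (fun t : R => Num.max t 0)}.
      by apply: continuous_max; [exact: cvg_id|exact: cst_continuous].
    have cBm : {for Num.max t 0, continuous B}.
      by apply: cB; rewrite lt_max; apply/orP; right; lra.
    exact: (continuous_comp cmax cBm).
  have b0E t : 0 <= t -> b0 t = B t by move=> t0; rewrite /b0 max_l.
  have w' : \int[lebesgue_measure]_(t in `[0, T]) (eta' t * b0 t + eta t * b t) = 0.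
    have cE : continuous (fun t => eta' t * b0 t + eta t * b t).
      move=> t; apply: cvgD; apply: cvgM; by [exact: ceta'|exact: cb0|exact: ceta|exact: cb].
    have dE x : 0 <= x <= T ->
        is_derive x (1 : R) (fun t => eta t * B t) (eta' x * b0 x + eta x * b x).
      move=> /andP[x0 xT].
      have dBx := dB x ltac:(lra); have dex := deta x.
      by apply: is_derive_eq; rewrite /GRing.scale/= b0E//; ring.
    rewrite (FTC2_is_derive T0 cE dE) (eta0 0) ?le_min ?(ltW l1) ?(ltW l2)//.
    by rewrite (eta1 T) ?ge_max ?(ltW l3) ?(ltW l4)// !mul0r subrr.
  have ci (f : R -> R) : continuous f -> (@lebesgue_measure R).-integrable `[0, T] (EFin \o f).
    exact: continuous_integrable_itv.
  have i1 : (@lebesgue_measure R).-integrable `[0, T] (EFin \o (fun t => eta' t * m t + eta t * b t)).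
    apply: ci => t; apply: cvgD; apply: cvgM; by [exact: ceta'|exact: cm|exact: ceta|exact: cb].
  have i2 : (@lebesgue_measure R).-integrable `[0, T] (EFin \o (fun t => eta' t * b0 t + eta t * b t)).
    apply: ci => t; apply: cvgD; apply: cvgM; by [exact: ceta'|exact: cb0|exact: ceta|exact: cb].
  pose g (t : R) := c1 * (bump p1 e t / I1) + (- c2) * (bump p2 e t / I2).
  have cg : continuous g.
    by move=> t; apply: cvgD; apply: cvgMr; apply: cvgMl; exact: (@bump_smooth _ _ 0%N).
  have ig : \int[lebesgue_measure]_(t in `[0, T]) g t = c1 - c2.
    have dg (x : R) : 0 <= x <= T ->
        is_derive x (1 : R) (fun t => c1 * W1 t + (- c2) * W2 t) (g x).
      by move=> _; have d1 := dW1 x; have d2 := dW2 x; apply: is_derive_eq.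
    rewrite (FTC2_is_derive T0 cg dg).
    rewrite (W10 0 (ltW l1)) (W20 0 (ltW l2)) (W11 T (ltW l3)) (W21 T (ltW l4)); ring.
  have : \int[lebesgue_measure]_(t in `[0, T])
     ((eta' t * m t + eta t * b t) - (eta' t * b0 t + eta t * b t)) <= c1 - c2.
    rewrite -ig; apply: le_Rintegral => //; [|exact: ci|].
      by have := integrableB _ i1 i2; apply.
    move=> t /= /[!in_itv]/= /andP[t0 tT].
    have -> : eta' t * m t + eta t * b t - (eta' t * b0 t + eta t * b t) =
      bump p1 e t / I1 * q t - bump p2 e t / I2 * q t.
      by rewrite b0E// /q /eta'; ring.
    rewrite /g mulNr [c1 * _]mulrC [c2 * _]mulrC lerB//.
      have [pt|pt] := ltP `|p1 - t| e.
        by rewrite ler_wpM2l ?divr_ge0 ?bump_ge0 ?(ltW I10)// h1// (lt_le_trans pt).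
      have [h|h] := lerP (p1 - t) 0.
        rewrite bump_right ?mul0r//; move: pt; rewrite ler0_norm//; lra.
      rewrite bump_left ?mul0r//; move: pt; rewrite gtr0_norm//; lra.
    have [pt|pt] := ltP `|p2 - t| e.
      by rewrite ler_wpM2l ?divr_ge0 ?bump_ge0 ?(ltW I20)// h2// (lt_le_trans pt).
    have [h|h] := lerP (p2 - t) 0.
      rewrite bump_right ?mul0r//; move: pt; rewrite ler0_norm//; lra.
    rewrite bump_left ?mul0r//; move: pt; rewrite gtr0_norm//; lra.
  rewrite RintegralB// w w' subrr; lra.
move=> t tT; have /andP[t0 tT'] := tT.
apply: (@near_eq_is_derive _ _ _ (fun s => B s + q t)) => //.
  near=> s.
  have sT : 0 < s < T.
    by apply/andP; split; near: s; [exact: lt_nbhsr|exact: lt_nbhsl].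
  have -> : q t = q s by apply/eqP; rewrite eq_le !le_q.
  by rewrite /q addrC subrK.
have := dB t ltac:(lra) => dBt.
by apply: is_derive_eq; rewrite addr0.
Unshelve. all: by end_near. Qed.

End weak_derivative.

(** * PART 13 *)

Section bounded_fubini.
Context (R : realType) d1 d2 (T1 : measurableType d1) (T2 : measurableType d2).
Variables (P : probability T1 R) (Q : probability T2 R).
Variables (f : T1 * T2 -> R) (M : R).
Hypothesis mf : measurable_fun setT f.
Hypothesis fM : forall z, `|f z| <= M.

Let fi : (P \x Q)%E.-integrable setT (EFin \o f).
Proof.
apply/integrableP; split; first exact/measurable_EFinP.
rewrite fubini_tonelli1//; last by apply: measurableT_comp => //; exact/measurable_EFinP.
apply: (@le_lt_trans _ _ (\int[P]_x M%:E)%E); last by rewrite prob_integral_cst ltry.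
apply: ge0_le_integral => //.
- by move=> x _; apply: integral_ge0.
- apply: measurable_fun_fubini_tonelli_F => //; apply: measurableT_comp => //; exact/measurable_EFinP.
- move=> x _; rewrite /fubini_F -(prob_integral_cst Q M); apply: ge0_le_integral => //.
    apply: measurableT_comp => //; apply/measurable_EFinP.
    exact: measurableT_comp.
  by move=> y _; rewrite lee_fin.
Qed.

Let EF x : ((\int[Q]_y f (x, y))%:E = \int[Q]_y (f (x, y))%:E)%E.
Proof.
rewrite /Rintegral fineK//; apply: integrable_fin_num => //.
by apply: (@bounded_integrable _ _ _ _ _ M) => //; exact: measurableT_comp.
Qed.

Let EG y : ((\int[P]_x f (x, y))%:E = \int[P]_x (f (x, y))%:E)%E.
Proof.
rewrite /Rintegral fineK//; apply: integrable_fin_num => //.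
by apply: (@bounded_integrable _ _ _ _ _ M) => //; exact: measurableT_comp.
Qed.

Lemma Rintegral_measurable1 : measurable_fun setT (fun x => \int[Q]_y f (x, y)).
Proof.
apply/measurable_EFinP; rewrite (_ : _ \o _ = fubini_F Q (EFin \o f)).
  exact: (measurable_fubini_F fi).
by apply/funext => x; rewrite /= EF.
Qed.

Lemma Rfubini : \int[P]_x \int[Q]_y f (x, y) = \int[Q]_y \int[P]_x f (x, y).
Proof.
rewrite /Rintegral; congr fine.
under eq_integral do rewrite EF.
under [in RHS]eq_integral do rewrite EG.
exact: (Fubini fi).
Qed.

End bounded_fubini.

Section energy.
Context (R : realType) (d : nat).
Hypothesis d2 : (2 <= d)%N.
Variables (r : R -> probability 'rV[R]_d R) (mu : probability 'rV[R]_d R) (A : R).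
Hypothesis narrow : forall f : 'rV[R]_d -> R, continuous f ->
  (exists M : R, forall x, `|f x| <= M) ->
  continuous (fun t : R => \int[r t]_x f x).
Hypothesis gr : forall t, growth A (r t).
Hypothesis gmu : growth A mu.
Variables (w G : R -> R) (N T : R).
Hypothesis Cw : forall k, Ck k (w : R^o -> R).
Hypothesis w0 : forall s, s <= 0 -> w s = 0.
Hypothesis wN : forall s, N <= s -> w s = 0.
Hypothesis dG : forall s, is_derive s (1 : R) G (w s).
Hypothesis GN : forall s, N <= s -> G s = 0.

Definition pot (rho : probability 'rV[R]_d R) (y : 'rV[R]_d) : R := \int[rho]_x G (nsq (x - y)).

Definition fl (y : 'rV[R]_d) : R -> R := flux r mu (fun i x => ek w i (x - y)).

Hypothesis T0 : 0 < T.
Hypothesis dpot : forall (y : 'rV[R]_d) t, 0 < t < T ->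
  is_derive t (1 : R) (fun t => pot (r t) y) (fl y t).

Definition energy (t : R) : R :=
  2^-1 * \int[r t]_y pot (r t) y - \int[mu]_y pot (r t) y.

Let cG : continuous G. Proof. exact: is_derive_Ck0 dG. Qed.
Let d0 : (0 < d)%N. Proof. exact: leq_trans d2. Qed.

Lemma nsq_line_gen (z v : 'rV[R]_d) h :
  nsq (z + h *: v) = nsq z + ((2 * \sum_i z 0 i * v 0 i) * h + nsq v * h ^+ 2).
Proof.
rewrite /nsq mulr_sumr !mulr_suml -!big_split/=; apply: eq_bigr => i _.
by rewrite !mxE; ring.
Qed.

Lemma G_lipschitz : exists2 L, 0 <= L & forall z z' : 'rV[R]_d,
  `|G (nsq z) - G (nsq z')| <= L * `|z - z'|.
Proof.
have [M M0 hM] := ek_bounded Cw w0 wN d.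
exists (d%:R * M); first by rewrite mulr_ge0.
move=> z z'; pose v := z - z'.
pose phi (h : R) := G (nsq (z' + h *: v)).
pose dphi (h : R) := \sum_i ek w i (z' + h *: v) * v 0 i.
have dp (h : R) : is_derive h (1 : R) phi (dphi h).
  have dq : is_derive h (1 : R)
     (fun h => nsq z' + ((2 * \sum_i z' 0 i * v 0 i) * h + nsq v * h ^+ 2))
     (2 * \sum_i (z' + h *: v) 0 i * v 0 i).
    have -> : \sum_i (z' + h *: v) 0 i * v 0 i = \sum_i z' 0 i * v 0 i + h * nsq v.
      rewrite /nsq mulr_sumr -big_split/=; apply: eq_bigr => i _; rewrite !mxE.
      by move: (z' 0 i) => a; ring.
    move: (nsq z') (\sum_i _) (nsq v) => a b c.
    by apply: is_derive_eq; rewrite /GRing.scale/=; ring.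
  have -> : dphi h = w (nsq (z' + h *: v)) * (2 * \sum_i (z' + h *: v) 0 i * v 0 i).
    rewrite /dphi !mulr_sumr; apply: eq_bigr => i _; rewrite /ek.
    by ring.
  have -> : phi = G \o (fun h => nsq z' + ((2 * \sum_i z' 0 i * v 0 i) * h + nsq v * h ^+ 2)).
    by apply/funext => u; rewrite /phi /= nsq_line_gen.
  apply: is_derive1_comp.
  by rewrite -nsq_line_gen; exact: dG.
have cphi : {within `[0, 1], continuous phi}.
  by apply: continuous_subspaceT; exact: is_derive_Ck0 dp.
have [c _] := @MVT_segment R phi dphi 0 1 ler01 (fun x _ => dp x) cphi.
rewrite /phi scale1r scale0r addr0 /v subrKC subr0 mulr1 => ->.
rewrite -mulrA; apply: norm_sum_le => i; rewrite normrM ler_pM//.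
exact: coord_le_norm.
Qed.

Lemma G_bounded : exists2 M, 0 <= M & forall z : 'rV[R]_d, `|G (nsq z)| <= M.
Proof.
have [M M0 hM] := bounded_on_segment 0 N cG; exists M => // z.
have [Nz|zN] := leP N (nsq z); first by rewrite GN// normr0.
by apply: hM; rewrite nsq_ge0 ltW.
Qed.

Lemma measurable_G : measurable_fun setT (fun z : 'rV[R]_d => G (nsq z)).
Proof.
apply: measurableT_comp; first exact: continuous_measurable_fun.
exact: measurable_nsq.
Qed.

Lemma potential_props : exists M L, [/\ 0 <= M, 0 <= L & forall rho,
   [/\ forall y, `|pot rho y| <= M, forall y y', `|pot rho y - pot rho y'| <= L * `|y - y'| &
     measurable_fun setT (pot rho)]].
Proof.
have [M M0 hM] := G_bounded; have [L L0 hL] := G_lipschitz.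
exists M, L; split => // rho.
have mG y : measurable_fun setT (fun x : 'rV[R]_d => G (nsq (x - y))).
  exact: (measurable_subr y measurable_G).
have lip y y' : `|pot rho y - pot rho y'| <= L * `|y - y'|.
  rewrite /pot -RintegralB//; last 2 first.
  - by apply: (@bounded_integrable _ _ _ _ _ M).
  - by apply: (@bounded_integrable _ _ _ _ _ M).
  apply: norm_Rintegral_le; first exact: measurable_funB.
  by move=> x; apply: (le_trans (hL _ _)); rewrite opprB addrC subrKA distrC.
split => // [y|]; first exact: norm_Rintegral_le.
by apply: continuous_rV_measurable; exact: lipschitz_continuous lip.
Qed.

Lemma pot_integrable (rho nu : probability 'rV[R]_d R) : rho.-integrable setT (EFin \o pot nu).
Proof.
have [M [L [M0 L0 h]]] := potential_props; have [hM hL mp] := h nu.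
exact: (@bounded_integrable _ _ _ rho (pot nu) M mp hM).
Qed.

Lemma pot_sym (rho nu : probability 'rV[R]_d R) :
  \int[rho]_y pot nu y = \int[nu]_y pot rho y.
Proof.
have [M M0 hM] := G_bounded.
have := @Rfubini R _ _ _ _ rho nu (fun z => G (nsq (z.1 - z.2))) M
  (measurable_sub2 measurable_G) (fun z => hM _).
rewrite /pot /= => <-.
by apply: eq_Rintegral => y _; apply: eq_Rintegral => x _; rewrite nsqB.
Qed.

Lemma pot_continuous_t y : continuous (fun t => pot (r t) y).
Proof.
have [M M0 hM] := G_bounded; have [L L0 hL] := G_lipschitz.
apply: (@narrow (fun x => G (nsq (x - y)))); last by exists M => x.
apply: (@lipschitz_continuous _ _ _ L) => z z'.
by apply: (le_trans (hL _ _)); rewrite opprB subrKA.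
Qed.

Lemma narrow_cst (nu : probability 'rV[R]_d R) : forall f : 'rV[R]_d -> R, continuous f ->
  (exists M : R, forall x, `|f x| <= M) ->
  continuous (fun t : R => \int[nu]_x f x).
Proof. by move=> f _ _; exact: cst_continuous. Qed.

Lemma energy_continuous : continuous energy.
Proof.
have [M [L [M0 L0 h]]] := potential_props.
move=> s; apply: cvgB.
  apply: cvgMr.
  apply: (@narrow_diag R d r narrow (fun t y => pot (r t) y) s M L 1) => //.
  - by move=> t x _; have [] := h (r t).
  - by move=> t x x' _; have [_ + _] := h (r t); exact.
  - by move=> x; exact: pot_continuous_t.
apply: (@narrow_diag R d (fun=> mu) (@narrow_cst mu) (fun t y => pot (r t) y) s M L 1) => //.
- by move=> t x _; have [] := h (r t).
- by move=> t x x' _; have [_ + _] := h (r t); exact.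
- by move=> x; exact: pot_continuous_t.
Qed.

Lemma derive_bound (f f' : R -> R) C : (forall t, 0 < t < T -> is_derive t (1 : R) f (f' t)) ->
  (forall t, `|f' t| <= C) -> forall s t, 0 < s < T -> 0 < t < T ->
  `|f t - f s| <= C * `|t - s|.
Proof.
move=> df fC s t sT tT.
wlog st : s t sT tT / s <= t.
  move=> h; have [/h|/ltW/h] := leP s t; first exact.
  by rewrite distrC [`|t - s|]distrC; exact.
have dst x : s <= x <= t -> is_derive x (1 : R) f (f' x).
  move=> /andP[sx xt]; apply: df; case/andP: sT => ? _; case/andP: tT => _ ?.
  by rewrite (lt_le_trans _ sx)//= (le_lt_trans xt).
have cf : {within `[s, t], continuous f}.
  apply: derivable_within_continuous => x; rewrite in_itv/= => xst.
  by have [] := dst x xst.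
have df' (x : R) : x \in `]s, t[ -> is_derive x (1 : R) f (f' x).
  by rewrite in_itv/= => /andP[/ltW sx /ltW xt]; apply: dst; rewrite sx.
have [c _ ->] := MVT_segment st df' cf.
by rewrite normrM ler_wpM2r.
Qed.

Lemma ek_subr_bounded : exists M L, [/\ 0 <= M, 0 <= L,
   forall y (i : 'I_d) x, `|ek w i (x - y)| <= M,
   forall y y' (i : 'I_d) x, `|ek w i (x - y) - ek w i (x - y')| <= L * `|y - y'| &
   forall y (i : 'I_d), measurable_fun setT (fun x : 'rV[R]_d => ek w i (x - y))].
Proof.
have [M M0 hM] := ek_bounded Cw w0 wN d.
have [L L0 hL] := ek_lipschitz Cw w0 wN d.
exists M, L; split => // [y y' i x|y i].
  by apply: (le_trans (hL _ _ _)); rewrite opprB addrC subrKA distrC.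
by apply: measurable_subr; apply: measurable_ek; exact: (Cw 0%N).
Qed.

Let V : R := 2 * vmax d A.

Lemma fl_bounds : exists B L, [/\ 0 <= B, 0 <= L, forall y t, `|fl y t| <= B &
  forall y y' t, `|fl y t - fl y' t| <= L * `|y - y'|].
Proof.
have V0 : 0 <= V by exact: (vmax2_ge0 d2 gmu).
have [M [L [M0 L0 hM hL mp]]] := ek_subr_bounded.
exists (d%:R * (V * M)), (d%:R * (V * L)); split.
- by apply: mulr_ge0 => //; apply: mulr_ge0.
- by apply: mulr_ge0 => //; apply: mulr_ge0.
- by move=> y t; apply: flux_bound => //; exact: hM.
move=> y y' t; rewrite /fl (@fluxB R d d2 r mu A gr gmu _ _ t M)//.
rewrite -[leRHS]mulrA -(mulrA V); apply: (flux_bound d2 gr gmu).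
  by move=> i; exact: measurable_funB.
by move=> i x; exact: hL.
Qed.

Definition dissip (t : R) : R :=
  \int[r t]_x \sum_i fluct r mu i t x * (ce w i (r t) x - ce w i mu x).

Lemma integral_flux (nu : probability 'rV[R]_d R) s : \int[nu]_y fl y s =
  - \int[r s]_x \sum_i fluct r mu i s x * ce w i nu x.
Proof.
have V0 : 0 <= V by exact: (vmax2_ge0 d2 gmu).
have [M M0 hM] := ek_bounded Cw w0 wN d.
have mek i : measurable_fun setT (@ek R w d i) by apply: measurable_ek; exact: (Cw 0%N).
have mf := measurable_fluct d2 gr gmu.
pose k (z : 'rV[R]_d * 'rV[R]_d) := \sum_i fluct r mu i s z.1 * ek w i (z.1 - z.2).
have mk : measurable_fun setT k.
  apply: measurable_sum => i; apply: measurable_funM; last exact: measurable_sub2.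
  exact: (measurableT_comp (mf i s) measurable_fst).
have bk z : `|k z| <= d%:R * (V * M).
  apply: norm_sum_le => i; rewrite normrM ler_pM//.
  exact: (fluct_bound d2 gr gmu).
have mk2 y : measurable_fun setT (fun x : 'rV[R]_d => k (x, y)) by exact: measurableT_comp.
have := @Rfubini R _ _ _ _ (r s) nu k _ mk bk.
have E1 x : \int[nu]_y k (x, y) = \sum_i fluct r mu i s x * ce w i nu x.
  have ii i : nu.-integrable setT (EFin \o (fun y : 'rV[R]_d => ek w i (x - y))).
    apply: (@bounded_integrable _ _ _ _ _ M) => [|y]; first exact: measurable_subl.
    exact: hM.
  rewrite /k /=.
  have Esum n (c : 'I_n -> R) (g : 'I_n -> 'rV[R]_d -> R) :
      (forall i, nu.-integrable setT (EFin \o g i)) ->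
      nu.-integrable setT (EFin \o (fun y => \sum_i c i * g i y)) /\
      \int[nu]_y (\sum_i c i * g i y) = \sum_i c i * \int[nu]_y g i y.
    elim: n c g => [|n IH] c g ig.
      have -> : (fun y => \sum_(i < 0) c i * g i y) = fun=> 0.
        by apply/funext => y; rewrite big_ord0.
      rewrite big_ord0 Rintegral_cst1; split => //.
      by apply: (@bounded_integrable _ _ _ _ _ 0) => // y; rewrite normr0.
    have [i1 i2] := IH (fun i => c (lift ord0 i)) (fun i => g (lift ord0 i)) (fun i => ig _).
    have i3 : nu.-integrable setT (EFin \o (fun y => c ord0 * g ord0 y)).
      by have := integrableZl measurableT (c ord0) (ig ord0).
    have -> : (fun y => \sum_(i < n.+1) c i * g i y) =
        fun y => c ord0 * g ord0 y + \sum_(i < n) c (lift ord0 i) * g (lift ord0 i) y.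
      by apply/funext => y; rewrite big_ord_recl.
    rewrite big_ord_recl RintegralD// RintegralZl// i2; split => //.
    by have := integrableD measurableT i3 i1.
  by have [_ ->] := Esum _ (fun i => fluct r mu i s x) _ ii.
under eq_Rintegral do rewrite E1.
move=> ->; rewrite /fl /flux -mulN1r -RintegralZl//.
  by apply: eq_Rintegral => y _; rewrite mulN1r.
apply: (@bounded_integrable _ _ _ _ _ (d%:R * (V * M))).
  have := @Rintegral_measurable1 R _ _ _ _ nu (r s) (fun z => k (z.2, z.1)) (d%:R * (V * M)).
  apply; last by move=> z; exact: bk.
  by apply: (measurableT_comp mk); apply: measurable_fun_pair; [exact: measurable_snd|exact: measurable_fst].
by move=> y; apply: norm_Rintegral_le.
Qed.

Lemma energy_derive s : 0 < s < T -> is_derive s (1 : R) energy (- dissip s).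
Proof.
move=> sT; have /andP[s0 sT'] := sT.
have [B [L [B0 L0 hB hL]]] := fl_bounds.
have [PM [PL [PM0 PL0 hP]]] := potential_props.
pose Q (t : R) (y : 'rV[R]_d) : R :=
  if t == s then fl y s else (pot (r t) y - pot (r s) y) / (t - s).
pose u := Num.min s (T - s).
have u0 : 0 < u by rewrite lt_min s0 subr_gt0.
have ut t : `|t - s| < u -> 0 < t < T.
  rewrite lt_min !ltr_norml => /andP[/andP[a1 a2] /andP[a3 a4]]; apply/andP; lra.
have QB t y : `|t - s| < u -> `|Q t y| <= B.
  move=> /ut tT; rewrite /Q; case: eqVneq => // ts.
  rewrite normrM normfV ler_pdivrMr ?normr_gt0 ?subr_eq0//.
  exact: (derive_bound (f := fun t => pot (r t) y) (dpot y)).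
have QL t y y' : `|t - s| < u -> `|Q t y - Q t y'| <= L * `|y - y'|.
  move=> /ut tT; rewrite /Q; case: eqVneq => // ts.
  rewrite -mulrBl subrB4 normrM normfV ler_pdivrMr ?normr_gt0 ?subr_eq0//.
  apply: (@derive_bound (fun t => pot (r t) y - pot (r t) y') (fun t => fl y t - fl y' t)) => //.
  by move=> v vT; apply: is_deriveB; exact: dpot.
have Qs y : Q t y @[t --> s] --> Q s y.
  have [h [hE ch hs]] := (is_derive1_caratheodory _ _ _).1 (dpot y sT).
  rewrite {2}/Q eqxx -hs; apply: cvg_trans ch; apply: near_eq_cvg.
  near=> t; rewrite /Q; case: eqVneq => [->//|ts].
  by rewrite hE mulfK// subr_eq0.
pose H (t : R) := 2^-1 * (\int[r t]_y Q t y + \int[r s]_y Q t y) - \int[mu]_y Q t y.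
have iP (rho nu : probability 'rV[R]_d R) : rho.-integrable setT (EFin \o pot nu) := pot_integrable rho nu.
have HE t : energy t - energy s = H t * (t - s).
  have [->|ts] := eqVneq t s; first by rewrite !subrr mulr0.
  have QE (rho : probability 'rV[R]_d R) : (\int[rho]_y Q t y) * (t - s) = \int[rho]_y pot (r t) y - \int[rho]_y pot (r s) y.
    rewrite -RintegralB; [|by []|exact: iP|exact: iP]. rewrite -(@RintegralZr _ _ _ rho setT (Q t) (t - s))//.
      by apply: eq_Rintegral => y _; rewrite /Q (negbTE ts) divfK// subr_eq0.
    have := integrableZl measurableT (t - s)^-1 (integrableB measurableT (iP rho (r t)) (iP rho (r s))).
    apply: eq_integrable => // y _.
    by rewrite /Q (negbTE ts) /= mulrC EFinM EFinB.
  rewrite /H mulrBl -mulrA [(_ + _) * (t - s)]mulrDl !QE /energy (pot_sym (r t) (r s)).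
  move: (\int[_]_y _) (\int[r s]_y pot (r t) y) (\int[r s]_y pot (r s) y)
    (\int[mu]_y pot (r t) y) (\int[mu]_y pot (r s) y) => a b c e f.
  by lra.
apply/is_derive1_caratheodory; exists H; split => //.
  apply: cvgB.
    apply: cvgMr; apply: cvgD.
      exact: (@narrow_diag R d r narrow Q s B L u).
    exact: (@narrow_diag R d (fun=> r s) (@narrow_cst (r s)) Q s B L u).
  exact: (@narrow_diag R d (fun=> mu) (@narrow_cst mu) Q s B L u).
have Qss : Q s = fun y => fl y s by apply/funext => y; rewrite /Q eqxx.
rewrite /H Qss !integral_flux.
have [M [L' [M0 L'0 hce]]] := ce_lipschitz d Cw w0 wN.
have V0 : 0 <= V by exact: (vmax2_ge0 d2 gmu).
have ifl (nu : probability 'rV[R]_d R) : (r s).-integrable setT (EFin \o (fun x => \sum_i fluct r mu i s x * ce w i nu x)).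
  apply: (@flux_integrable R d d2 r mu A gr gmu (fun i => ce w i nu) s M).
    move=> i; have [_ _ hl] := hce i nu.
    by apply: continuous_rV_measurable; exact: lipschitz_continuous hl.
  by move=> i; have [] := hce i nu.
have -> : dissip s = \int[r s]_x (\sum_i fluct r mu i s x * ce w i (r s) x) -
   \int[r s]_x (\sum_i fluct r mu i s x * ce w i mu x).
  rewrite -RintegralB//; apply: eq_Rintegral => x _.
  by rewrite -sumrB; apply: eq_bigr => i _; rewrite mulrBr.
move: (\int[_]_x _) (\int[_]_x _) => a b; lra.
Unshelve. all: by end_near. Qed.

Lemma energy_mvt : exists2 tau, 0 < tau < T & energy 0 - energy T = T * dissip tau.
Proof.
have [||c] := @MVT R energy (fun t => - dissip t) 0 T T0.
- by move=> x; rewrite in_itv/=; exact: energy_derive.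
- by apply: continuous_subspaceT; exact: energy_continuous.
rewrite in_itv/= => cT h; exists c => //.
by rewrite -opprB h subr0 mulNr opprK mulrC.
Qed.

End energy.

(** * PART 14 *)

Section log_part.
Context (R : realType) (d : nat).
Hypothesis d2 : (2 <= d)%N.

Let d0 : (0 < d)%N. Proof. exact: leq_trans d2. Qed.

Definition cq : R := if d == 2 then (2 * pi)^-1 else 0.

Definition qlog (z : 'rV[R]_d) : R := cq * ln (1 + `|z|).

Lemma cq_ge0 : 0 <= cq.
Proof. by rewrite /cq; case: ifP => // _; rewrite invr_ge0 mulr_ge0// pi_ge0. Qed.

Lemma qlog_ge0 z : 0 <= qlog z.
Proof. by rewrite mulr_ge0 ?cq_ge0// ln_ge0// lerDl. Qed.

Lemma qlog_sub x y : qlog (x + y) <= qlog x + qlog y.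
Proof.
rewrite /qlog -mulrDr ler_wpM2l ?cq_ge0//.
have px : 0 < 1 + `|x| by rewrite ltr_wpDr.
have py : 0 < 1 + `|y| by rewrite ltr_wpDr.
rewrite -lnM ?posrE// ler_ln ?posrE ?mulr_gt0 ?ltr_wpDr//.
have := ler_normD x y; have : 0 <= `|x| * `|y| by rewrite mulr_ge0.
have -> : (1 + `|x|) * (1 + `|y|) = 1 + `|x| + `|y| + `|x| * `|y| by ring.
lra.
Qed.

Lemma qlogN z : qlog (- z) = qlog z.
Proof. by rewrite /qlog normrN. Qed.

Lemma qlog_continuous : continuous qlog.
Proof.
move=> z.
have h1 : {for z, continuous (fun z : 'rV[R]_d => 1 + `|z|)}.
  by apply: continuousD; [exact: cst_continuous|exact: norm_continuous].
have h2 : {for 1 + `|z|, continuous (@ln R)} by apply: continuous_ln; rewrite ltr_wpDr.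
have hc : {for z, continuous (fun _ : 'rV[R]_d => cq)} by exact: cst_continuous.
exact: (continuousM hc (continuous_comp h1 h2)).
Qed.

Lemma enorm_ge (z : 'rV[R]_d) : `|z| <= Num.sqrt (nsq z).
Proof. by rewrite -(@ger0_norm _ `|z|)// -sqrtr_sqr ler_sqrt ?nsq_ge0// norm2_le_nsq. Qed.

Lemma ln_le_subr1 (x : R) : 0 < x -> ln x <= x - 1.
Proof. by move=> x0; have := @le_ln1Dx R (x - 1); rewrite subrKC; apply; lra. Qed.

Lemma coulomb_log_bound : exists2 C : R, 0 < C & forall z : 'rV[R]_d, z != 0 ->
  (`|z| < 1 -> `|coulomb z + qlog z| <= C * `|z| ^- d.-1) /\
  (1 <= `|z| -> `|coulomb z + qlog z| <= C).
Proof.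
have en := enorm_ge.
have en2 (z : 'rV[R]_d) : nsq z <= d%:R * `|z| ^+ 2 := nsq_le_norm2 z.
move: (@coulombE R d) en en2; rewrite /qlog /cq /gam; move: d2.
case: d => [//|[//|[|n]]] _ cE en en2.
- rewrite eqxx; set p := (2 * pi)^-1.
  have p0 : 0 < p by rewrite invr_gt0 mulr_gt0// pi_gt0.
  exists p => // z z0; rewrite cE expr1.
  have b0 : 0 < `|z| by rewrite normr_gt0.
  set a := Num.sqrt (nsq z); set b := `|z|.
  have ba : b <= a := en z.
  have a0 : 0 < a := lt_le_trans b0 ba.
  have ab : a <= 2 * b.
    rewrite -(@ler_pXn2r _ 2) ?nnegrE ?mulr_ge0 ?(ltW a0) ?(ltW b0)//.
    rewrite sqr_sqrtr ?nsq_ge0// (le_trans (en2 z))// -/b exprMn.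
    have : 0 <= b ^+ 2 by rewrite exprn_ge0// ltW.
    lra.
  have -> : - (ln a / (2 * pi)) + p * ln (1 + b) = p * (ln (1 + b) - ln a).
    by rewrite -/p mulrBr addrC [ln a * p]mulrC.
  have ln2 : ln (2 : R) <= 1 by apply: (le_trans (ln_le_subr1 _)) => //; lra.
  have lab : ln a <= ln 2 + ln b by rewrite -lnM ?posrE// ler_ln ?posrE// mulr_gt0.
  have lba : ln b <= ln a by rewrite ler_ln.
  have l1b : 0 <= ln (1 + b) by rewrite ln_ge0// lerDl ltW.
  rewrite normrM (gtr0_norm p0); split => [b1|b1].
    rewrite ler_pM2l//.
    have lb : - ln b <= b^-1 - 1 by rewrite -lnV ?posrE// ln_le_subr1// invr_gt0.
    have ib : 1 <= b^-1 by rewrite invf_ge1// ltW.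
    have l2 : ln (1 + b) <= ln 2 by rewrite ler_ln ?posrE ?ltr_wpDr ?(ltW b0)//; lra.
    have l3 : ln b <= 0 by rewrite ln_le0// ltW.
    by rewrite ler_norml; apply/andP; split; lra.
  rewrite -[leRHS]mulr1 ler_pM2l//.
  have l2 : ln (1 + b) <= ln 2 + ln b.
    by rewrite -lnM ?posrE// ler_ln ?posrE ?mulr_gt0 ?ltr_wpDr ?(ltW b0)//; lra.
  have l3 : ln b <= ln (1 + b) by rewrite ler_ln ?posrE ?ltr_wpDr ?(ltW b0)//; lra.
  by rewrite ler_norml; apply/andP; split; lra.
- have e3 : (n.+3 - 2)%N = n.+1 by [].
  rewrite {}e3 in cE; rewrite (_ : n.+3 == 2 = false)//.
  set c := (_ * sphere_area _ _)^-1 in cE.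
  have c0 : 0 <= c.
    by rewrite invr_ge0 mulr_ge0// fine_ge0// mule_ge0// lee_fin.
  clearbody c; exists (c + 1); first by rewrite ltr_wpDl.
  move=> z z0; rewrite cE mul0r addr0.
  have b0 : 0 < `|z| by rewrite normr_gt0.
  have h : `|c * Num.sqrt (nsq z) ^- n.+1| <= c * `|z| ^- n.+1.
    rewrite ger0_norm ?mulr_ge0 ?invr_ge0 ?exprn_ge0 ?sqrtr_ge0//.
    rewrite ler_wpM2l// lef_pV2 ?posrE ?exprn_gt0//; last exact: lt_le_trans (en z).
    by rewrite lerXn2r ?nnegrE ?sqrtr_ge0.
  split=> b1; apply: (le_trans h).
    apply: ler_pM; [by []|by rewrite invr_ge0 exprn_ge0|by rewrite lerDl|].
    rewrite lef_pV2 ?posrE ?exprn_gt0// /= exprS ler_piMl ?exprn_ge0//.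
    exact: ltW.
  rewrite (@le_trans _ _ c)// ?lerDl// ler_piMr//.
  by rewrite invf_le1 ?exprn_gt0// exprn_ege1.
Qed.

Lemma measurable_coulomb : measurable_fun setT (@coulomb R d).
Proof.
have mq : measurable_fun setT (fun z : 'rV[R]_d => Num.sqrt (nsq z)).
  apply: measurableT_comp; last exact: measurable_nsq.
  by apply: continuous_measurable_fun; exact: sqrt_continuous.
have -> : @coulomb R d = fun z => gam d (nsq z) by apply/funext => z; rewrite coulombE.
rewrite /gam; move: mq; case: d d2 => [//|[//|[|n]]] _ mq.
  apply: measurableT_comp => //; apply: measurable_funM => //.
  by apply: measurableT_comp => //; exact: measurable_ln.
apply: measurable_funM => //.
rewrite (_ : (n.+3 - 2)%N = n.+1)//.
under eq_fun => z do rewrite -powR_inv1 ?exprn_ge0 ?sqrtr_ge0//.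
by apply: (measurableT_comp (measurable_powR _)); exact: measurable_funX.
Qed.

End log_part.

Section radial_approx.
Context (R : realType) (d : nat).
Hypothesis d2 : (2 <= d)%N.
Let d0 : (0 < d)%N. Proof. exact: leq_trans d2. Qed.

Lemma nonincr_derive (f f' : R -> R) (a b : R) : a <= b ->
  (forall x : R, a <= x <= b -> is_derive x (1 : R) f (f' x)) ->
  exists2 c, a <= c <= b & f b - f a = f' c * (b - a).
Proof.
move=> ab df.
have cf : {within `[a, b], continuous f}.
  apply: derivable_within_continuous => x; rewrite in_itv/= => xab.
  by have [] := df x xab.
have df' (x : R) : x \in `]a, b[ -> is_derive x (1 : R) f (f' x).
  by rewrite in_itv/= => /andP[/ltW ax /ltW xb]; apply: df; rewrite ax.
by have [c cab ->] := MVT_segment ab df' cf; exists c.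
Qed.

Variables (N : R) (G : R -> R).
Hypothesis N0 : 0 < N.
Hypothesis dG : forall s, is_derive s (1 : R) G (wcut d N s).

Lemma radial_dominated (s : R) : 0 < s -> `|G s - G 1| <= `|gam d s - gam d 1|.
Proof.
move=> s0.
have key (a b : R) : 0 < a -> a <= b -> G b - G a <= 0 /\ gam d b - gam d a <= G b - G a.
  move=> a0 ab.
  have dg (x : R) : a <= x <= b -> is_derive x (1 : R) (gam d) (dgam d x).
    by move=> /andP[ax _]; apply: gam_derive => //; exact: lt_le_trans ax.
  split.
    have dG' (x : R) : a <= x <= b -> is_derive x (1 : R) G (wcut d N x) by move=> _; exact: dG.
    have [c _ ->] := nonincr_derive ab dG'.
    by rewrite mulr_le0_ge0 ?subr_ge0// /wcut mulr_le0_ge0 ?dgam_le0 ?chi_ge0.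
  rewrite -subr_le0 subrB4.
  have dh (x : R) : a <= x <= b -> is_derive x (1 : R) (fun x => gam d x - G x) (dgam d x - wcut d N x).
    by move=> xab; have dgx := dg x xab; apply: is_deriveB.
  have [c cab ->] := nonincr_derive ab dh.
  rewrite mulr_le0_ge0 ?subr_ge0// /wcut -{1}[dgam d c]mulr1 -mulrBr.
  by rewrite mulr_le0_ge0 ?dgam_le0// subr_ge0 chi_le1.
have [s1|s1] := leP s 1.
  have [h1 h2] := key s 1 s0 s1.
  by rewrite !ger0_norm; lra.
have [h1 h2] := key 1 s ltr01 (ltW s1).
by rewrite !ler0_norm; lra.
Qed.

Lemma radial_close (s : R) : 0 < s -> Num.max s 1 + 1 <= N ->
  `|(G s - G 1) - (gam d s - gam d 1)| <=
   kappa R d / 2 * expR (- (d%:R / 2 * ln (Num.min s 1))) * ((Num.min s 1)^-1 + 1) * `|s - 1| / N.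
Proof.
move=> s0 sN; set a := Num.min s 1; set b := Num.max s 1.
have a0 : 0 < a by rewrite lt_min s0/=.
have K0 := kappa_ge0 R d.
have key (u v : R) : a <= u -> u <= v -> v <= b ->
    `|(gam d v - gam d u) - (G v - G u)| <= kappa R d / 2 * expR (- (d%:R / 2 * ln a)) * (a^-1 + 1) / N * (v - u).
  move=> au uv vb; rewrite subrB4.
  have dh (x : R) : u <= x <= v -> is_derive x (1 : R) (fun x => gam d x - G x) (dgam d x - wcut d N x).
    move=> /andP[ux _]; have x0 : 0 < x by apply: lt_le_trans a0 _; exact: le_trans ux.
    by have dgx := gam_derive d0 x0; apply: is_deriveB.
  have [c /andP[uc cv] ->] := nonincr_derive uv dh.
  have ac : a <= c := le_trans au uc.
  have cb : c <= b := le_trans cv vb.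
  have c0 : 0 < c := lt_le_trans a0 ac.
  rewrite normrM (@ger0_norm _ (v - u)) ?subr_ge0// ler_wpM2r ?subr_ge0//.
  rewrite /wcut -{1}[dgam d c]mulr1 -mulrBr normrM -mulrA; apply: ler_pM => //.
    rewrite ler0_norm ?dgam_le0// /dgam mulNr opprK ler_wpM2l ?divr_ge0//.
    by rewrite ler_expR lerN2 ler_wpM2l ?divr_ge0// ler_ln.
  rewrite ger0_norm ?subr_ge0 ?chi_le1//.
  have cN : c < N by rewrite (le_lt_trans cb)// (lt_le_trans _ sN)// ltrDl.
  apply: (le_trans (chi_lower N0 c0 cN)); rewrite mulrDl; apply: lerD.
    by rewrite invfM mulrC ler_wpM2r ?invr_ge0 ?(ltW N0)// lef_pV2.
  rewrite invfM mulrC ler_wpM2r ?invr_ge0 ?(ltW N0)// invf_le1 ?subr_gt0//.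
  by rewrite lerBrDr addrC -lerBrDr (le_trans cb)// lerBrDr.
have aa : a <= 1 by rewrite ge_min lexx orbT.
have bb : 1 <= b by rewrite le_max lexx orbT.
have as_ : a <= s by rewrite ge_min lexx.
have sb : s <= b by rewrite le_max lexx.
rewrite mulrAC.
have [s1|s1] := leP s 1.
  rewrite [`|s - 1|]distrC [`|1 - s|]ger0_norm ?subr_ge0//.
  have -> : G s - G 1 - (gam d s - gam d 1) = (gam d 1 - gam d s) - (G 1 - G s).
    by move: (G s) (G 1) (gam d s) (gam d 1) => *; ring.
  exact: key as_ s1 bb.
rewrite distrC [`|s - 1|]gtr0_norm ?subr_gt0//.
exact: key aa (ltW s1) sb.
Qed.

End radial_approx.

(** * PART 15 *)

Section mmd_limit.
Context (R : realType) (d : nat).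
Hypothesis d2 : (2 <= d)%N.
Implicit Types rho mu nu : probability 'rV[R]_d R.
Variable A : R.

Let d0 : (0 < d)%N. Proof. exact: leq_trans d2. Qed.

Local Notation V := 'rV[R]_d.
Local Notation g := (@coulomb R d).
Local Notation q := (@qlog R d).

Let mq : measurable_fun setT q.
Proof. by apply: continuous_rV_measurable; exact: qlog_continuous. Qed.

Let mg : measurable_fun setT g.
Proof. exact: measurable_coulomb. Qed.

Let S (z : V) := g z + q z.

Lemma S_integrable : exists2 C, 0 <= C & forall rho (x : V), growth A rho ->
  rho.-integrable setT (EFin \o (fun y : V => S (x - y))) /\
  \int[rho]_y `|S (x - y)| <= C.
Proof.
have [C C0 hC] := coulomb_log_bound R d2.
exists `|C * (A * 2 ^+ d * 1) + C| => // rho x gr.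
have ms : measurable_fun setT (fun z => `|S z|).
  by apply: measurableT_comp => //; exact: measurable_funD.
have h (f : V -> R) : measurable_fun setT f -> (forall z, `|f z| = `|S z|) ->
   rho.-integrable setT (EFin \o (fun y : V => f (x - y))) /\
   `|\int[rho]_y f (x - y)| <= C * (A * 2 ^+ d * 1) + C.
  move=> mf fS.
  have fin (z : V) : z != 0 -> `|z| < 1 -> `|f z| <= C * `|z| ^- d.-1.
    by move=> z0 z1; rewrite fS; exact: (hC z z0).1.
  have fout (z : V) : 1 <= `|z| -> `|f z| <= C.
    move=> z1; rewrite fS; apply: (hC z _).2 => //.
    by rewrite -normr_gt0 (lt_le_trans _ z1).
  exact: (@singular_kernel_integral R d d0 A rho f x C 1 C gr C0 ltr01 (ltW C0) mf fin fout).
split; first by have [] := h S (measurable_funD mg mq) (fun=> erefl).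
have [_ h2] := h _ ms (fun=> normr_id _).
by rewrite (le_trans (ler_norm _))// (le_trans h2)// ler_norm.
Qed.

Lemma q_shift (x y : V) : q y <= q (x - y) + q x.
Proof.
rewrite -[X in X <= _]qlogN -[X in q X]add0r.
have -> : 0 - y = (x - y) + (- x) by rewrite addrAC subrr.
by rewrite (le_trans (qlog_sub _ _))// qlogN.
Qed.

Lemma q_sub (x y : V) : q (x - y) <= q x + q y.
Proof. by rewrite (le_trans (qlog_sub _ _))// qlogN. Qed.

Lemma coulomb_potential_cases rho : growth A rho ->
  (forall (x : V), (\int[rho]_y (g (x - y))%:E < +oo)%E) /\
  (rho.-integrable setT (EFin \o q) \/
   forall (x : V), (\int[rho]_y (g (x - y))%:E = -oo)%E).
Proof.
move=> gr; have [C C0 hS] := S_integrable.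
have mgx (x : V) : measurable_fun setT (fun y : V => (g (x - y))%:E).
  by apply: measurable_fun_EFin; exact: measurable_subl.
have pos (x : V) : (\int[rho]_y ((fun y : V => (g (x - y))%:E)^\+ y) < +oo)%E.
  have [iS _] := hS rho x gr.
  apply: (@le_lt_trans _ _ (\int[rho]_y `|(S (x - y))%:E|)%E).
    apply: ge0_le_integral => //.
    - exact: measurable_funepos.
    - by apply: measurableT_comp => //; exact: measurable_int iS.
    - move=> y _; rewrite funeposE -EFin_max lee_fin ge_max normr_ge0 andbT.
      by rewrite (le_trans _ (ler_norm _))// lerDl qlog_ge0.
  by have /integrableP[] := iS.
split=> [x|].
  rewrite integralE; apply: le_lt_trans (pos x).
  by rewrite -[leRHS]adde0 leeD2l// oppe_le0; apply: integral_ge0 => y _.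
have [iq|niq] := pselect (rho.-integrable setT (EFin \o q)); [by left|right => x].
apply: contrapT => /eqP nNy; apply: niq.
have neg : (\int[rho]_y ((fun y : V => (g (x - y))%:E)^\- y) < +oo)%E.
  rewrite ltNge leye_eq; apply/negP => /eqP e; move: nNy; rewrite integralE e.
  by move: (pos x); case: (\int[rho]_y _)%E => //.
have ig : rho.-integrable setT (EFin \o (fun y : V => g (x - y))).
  apply/integrableP; split; first exact: mgx.
  rewrite (_ : (fun y => _) = (fun y => ((fun y : V => (g (x - y))%:E)^\+ y) + ((fun y : V => (g (x - y))%:E)^\- y))%E).
    rewrite ge0_integralD//; first exact: lte_add_pinfty.
      exact: measurable_funepos.
    exact: measurable_funeneg.
  by apply/funext => y; rewrite -[RHS]/((_ \+ _)%E y) -fune_abse.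
have [iS _] := hS rho x gr.
have iqx : rho.-integrable setT (EFin \o (fun y : V => `|S (x - y) - g (x - y)| + q x)).
  have i1 := integrableB measurableT iS ig.
  have i2 : rho.-integrable setT (EFin \o (fun y : V => S (x - y) - g (x - y))) by exact: i1.
  have i3 := integrable_norm i2.
  have i4 : rho.-integrable setT (EFin \o (fun _ : V => q x)).
    by apply: (@bounded_integrable _ _ _ _ _ `|q x|).
  by have := integrableD measurableT i3 i4.
apply: (le_integrable measurableT _ _ iqx); first exact/measurable_EFinP.
move=> y _; rewrite /= lee_fin (ger0_norm (qlog_ge0 y)).
apply: le_trans (ler_norm _).
have -> : S (x - y) - g (x - y) = q (x - y) by rewrite /S addrAC subrr add0r.
by rewrite (le_trans (q_shift x y))// lerD2r ler_norm.
Qed.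

Lemma coulomb_integrable : exists2 C, 0 <= C & forall rho (x : V), growth A rho ->
  rho.-integrable setT (EFin \o q) ->
  rho.-integrable setT (EFin \o (fun y : V => g (x - y))) /\
  \int[rho]_y `|g (x - y)| <= C + q x + \int[rho]_y q y.
Proof.
have [C C0 hS] := S_integrable; exists C => // rho x gr iq.
have [iS SC] := hS rho x gr.
have inS := integrable_norm iS.
have icq : rho.-integrable setT (EFin \o (fun _ : V => q x)).
  by apply: (@bounded_integrable _ _ _ _ _ `|q x|).
have iqq : rho.-integrable setT (EFin \o (fun y : V => q x + q y)).
  by have := integrableD measurableT icq iq.
have ib : rho.-integrable setT (EFin \o (fun y : V => `|S (x - y)| + (q x + q y))).
  by have := integrableD measurableT inS iqq.
have le_g (y : V) : `|g (x - y)| <= `|S (x - y)| + (q x + q y).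
  have -> : g (x - y) = S (x - y) - q (x - y) by rewrite /S addrK.
  rewrite (le_trans (ler_normB _ _))// lerD2l ger0_norm ?qlog_ge0//.
  exact: q_sub.
have ig : rho.-integrable setT (EFin \o (fun y : V => g (x - y))).
  apply: (le_integrable measurableT _ _ ib).
    by apply: measurable_fun_EFin; exact: measurable_subl.
  move=> y _; rewrite /= lee_fin; apply: le_trans (ler_norm _); exact: le_g.
split => //.
apply: (@le_trans _ _ (\int[rho]_y (`|S (x - y)| + (q x + q y)))).
  by apply: le_Rintegral => //; exact: (integrable_norm ig).
by rewrite RintegralD// RintegralD// Rintegral_cst1 addrA !lerD2r.
Qed.

Lemma MMD2_finite_moments rho mu : growth A rho -> growth A mu ->
  (-oo < MMD2 rho mu)%E ->
  rho.-integrable setT (EFin \o q) /\ mu.-integrable setT (EFin \o q).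
Proof.
move=> gr gm; have [rlt rc] := coulomb_potential_cases gr.
have [mlt mc] := coulomb_potential_cases gm.
have csty (P : probability V R) (c : \bar R) : (\int[P]_x c = c)%E.
  by rewrite integral_cst// [X in (_ * X)%E](_ : _ = 1%E) ?mule1//; exact: probability_setT.
have mulNy : (2^-1%:E * -oo = -oo :> \bar R)%E by rewrite gt0_muleNy// lte_fin invr_gt0.
rewrite /MMD2; case: rc => [ir|rN].
  case: mc => [im|mN]; first by split.
  have fin (x : V) : (potential rho mu x = +oo)%E.
    rewrite /potential mN.
    have [C C0 hC] := coulomb_integrable.
    have [ig _] := hC rho x gr ir.
    have := integrable_fin_num measurableT ig.
    by rewrite /comp/=; case: (\int[rho]_y _)%E.
  under eq_integral do rewrite fin.
  under [X in (_ - X)%E]eq_integral do rewrite fin.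
  by rewrite !csty/= mulNy.
have fin (x : V) : (potential rho mu x = -oo)%E.
  by rewrite /potential rN.
under eq_integral do rewrite fin.
under [X in (_ - X)%E]eq_integral do rewrite fin.
by rewrite !csty/= mulNy.
Qed.


Variable G : nat -> R -> R.
Hypothesis dG : forall n s, is_derive s (1 : R) (G n) (wcut d n.+1%:R s).
Hypothesis GN : forall n s, n.+1%:R <= s -> G n s = 0.

Let K n (z : V) : R := G n (nsq z) + (gam d 1 - G n 1).

Let cn n : R := gam d 1 - G n 1.

Lemma K_dominated n z : z != 0 -> `|K n z| <= `|g z| + 2 * `|gam d (1 : R)|.
Proof.
move=> z0; have s0 := nsq_gt0 z0.
have h := radial_dominated d2 (dG n) s0; rewrite /K coulombE.
have -> : G n (nsq z) + (gam d 1 - G n 1) = (G n (nsq z) - G n 1) + gam d 1.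
  by rewrite addrA addrAC.
rewrite (le_trans (ler_normD _ _))// mulr_natl mulr2n addrA lerD2r.
by rewrite (le_trans h)// ler_normB.
Qed.

Lemma K_cvg z : z != 0 -> K n z @[n --> \oo] --> g z.
Proof.
move=> z0; have s0 := nsq_gt0 z0; rewrite coulombE.
apply/cvgrPdist_le => e e0.
set s := nsq z in s0 *.
pose C := kappa R d / 2 * expR (- (d%:R / 2 * ln (Num.min s 1))) * ((Num.min s 1)^-1 + 1) * `|s - 1|.
near=> n.
have n0 : (0 : R) < n.+1%:R by [].
have nb : Num.max s 1 + 1 <= n.+1%:R.
  rewrite (@le_trans _ _ n%:R)// ?ler_nat//.
  by near: n; exact: nbhs_infty_ger.
have h := radial_close d2 n0 (dG n) s0 nb; rewrite -/C in h.
rewrite distrC /K -/s.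
have -> : G n s + (gam d 1 - G n 1) - gam d s = (G n s - G n 1) - (gam d s - gam d 1).
  by move: (G n s) (G n 1) (gam d s) (gam d 1) => *; ring.
rewrite (le_trans h)// ler_pdivrMr// -ler_pdivrMl//.
rewrite (@le_trans _ _ n%:R)// ?ler_nat//.
by near: n; exact: nbhs_infty_ger.
Unshelve. all: by end_near. Qed.

Let mK n : measurable_fun setT (K n).
Proof.
apply: measurable_funD => //; apply: measurable_G.
Qed.

Let KE n rho x : rho.-integrable setT (EFin \o (fun y : V => G n (nsq (x - y)))) ->
  \int[rho]_y K n (x - y) = pot (G n) rho x + cn n.
Proof.
move=> iG; rewrite /K RintegralD// ?Rintegral_cst1.
  by congr (_ + _); rewrite /pot; apply: eq_Rintegral => y _; rewrite nsqB.
by apply: (@bounded_integrable _ _ _ _ _ `|gam d 1 - G n 1|).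
Qed.

Lemma potential_limit rho nu : growth A rho ->
  rho.-integrable setT (EFin \o q) -> nu.-integrable setT (EFin \o q) ->
  nu.-integrable setT (EFin \o (fun x => \int[rho]_y g (x - y))) /\
  (\int[nu]_x pot (G n) rho x + cn n) @[n --> \oo] -->
    \int[nu]_x \int[rho]_y g (x - y).
Proof.
move=> gr ir inu; have [C C0 hC] := coulomb_integrable.
pose M := 2 * `|gam d (1 : R)|.
have M0 : 0 <= M by rewrite mulr_ge0.
have Gi n : exists2 B, 0 <= B & forall z : V, `|G n (nsq z)| <= B.
  exact: (G_bounded d (dG n) (@GN n)).
have iG n x : rho.-integrable setT (EFin \o (fun y : V => G n (nsq (x - y)))).
  have [B B0 hB] := Gi n; apply: (@bounded_integrable _ _ _ _ _ B) => [|y]; last exact: hB.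
  exact: (measurable_subl x (measurable_G (dG n))).
have mpot n : measurable_fun setT (pot (G n) rho).
  have Cw k := @wcut_smooth R d n.+1%:R k (ltr0Sn R n).
  have w0 s := @wcut_le0 R d n.+1%:R s (ltr0Sn R n).
  have wN s := @wcut_ge R d n.+1%:R s (ltr0Sn R n).
  have [M' [L' [_ _ h]]] := potential_props d Cw w0 wN (dG n) (@GN n).
  by have [_ _] := h rho.
have inn x : \int[rho]_y K n (x - y) @[n --> \oo] --> \int[rho]_y g (x - y).
  have [ig _] := hC rho x gr ir.
  apply: (proj2 (@Rintegral_dominated _ _ R rho (fun n y => K n (x - y)) (fun y => g (x - y))
    (fun y => `|g (x - y)| + M) _ _ _ _ _)).
  - by move=> n; exact: (measurable_subl x (mK n)).
  - exact: (measurable_subl x mg).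
  - exists [set x]; split; [exact: rV_measurable_set1|exact: growth_set1 gr|].
    move=> y /= h; apply: contrapT => /eqP yx; apply: h.
    by apply: K_cvg; rewrite subr_eq0 eq_sym.
  - have icM : rho.-integrable setT (EFin \o (fun _ : V => M)).
      by apply: (@bounded_integrable _ _ _ _ _ `|M|).
    by have := integrableD measurableT (integrable_norm ig) icM.
  - exists [set x]; split; [exact: rV_measurable_set1|exact: growth_set1 gr|].
    move=> y /= h; apply: contrapT => /eqP yx; apply: h => n.
    by apply: K_dominated; rewrite subr_eq0 eq_sym.
pose B := C + \int[rho]_y q y + M.
have bound n x : `|\int[rho]_y K n (x - y)| <= q x + B.
  have [ig gC] := hC rho x gr ir.
  have iK : rho.-integrable setT (EFin \o (fun y : V => K n (x - y))).
    have icM : rho.-integrable setT (EFin \o (fun _ : V => cn n)).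
      by apply: (@bounded_integrable _ _ _ _ _ `|cn n|).
    by have := integrableD measurableT (iG n x) icM.
  have icM : rho.-integrable setT (EFin \o (fun _ : V => M)).
    by apply: (@bounded_integrable _ _ _ _ _ `|M|).
  have igM : rho.-integrable setT (EFin \o (fun y : V => `|g (x - y)| + M)).
    by have := integrableD measurableT (integrable_norm ig) icM.
  apply: (le_trans (le_normr_Rintegral measurableT iK)).
  apply: (@le_trans _ _ (\int[rho]_y (`|g (x - y)| + M))).
    rewrite /Rintegral fine_le//.
    + by apply: integrable_fin_num => //; exact: (integrable_norm iK).
    + exact: integrable_fin_num.
    apply: ae_ge0_le_integral => //.
    + by apply: measurable_fun_EFin; apply: measurableT_comp => //; exact: (measurable_subl x (mK n)).
    + by move=> y _; rewrite lee_fin addr_ge0.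
    + by have := measurable_int _ igM.
    exists [set x]; split; [exact: rV_measurable_set1|exact: growth_set1 gr|].
    move=> y /= h; apply: contrapT => /eqP yx; apply: h => _.
    by rewrite lee_fin; apply: K_dominated; rewrite subr_eq0 eq_sym.
  rewrite RintegralD//; last exact: (integrable_norm ig).
  rewrite Rintegral_cst1 /B !addrA lerD2r.
  by rewrite (le_trans gC)// [q x + C]addrC.
have mu_ n : measurable_fun setT (fun x : V => \int[rho]_y K n (x - y)).
  under eq_fun do rewrite KE//.
  exact: measurable_funD.
have mu_lim : measurable_fun setT (fun x : V => \int[rho]_y g (x - y)).
  exact: (measurable_fun_cvg mu_ (fun x _ => inn x)).
have [h1 h2] := @Rintegral_dominated _ _ R nu (fun n x => \int[rho]_y K n (x - y))
   (fun x => \int[rho]_y g (x - y)) (fun x => q x + B) mu_ mu_lim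
   (aeW _ inn)
   ltac:(have icB : nu.-integrable setT (EFin \o (fun _ : V => B));
     [by apply: (@bounded_integrable _ _ _ _ _ `|B|)|by have := integrableD measurableT inu icB])
   (aeW _ (fun x n => bound n x)).
split => //; apply: cvg_trans h2; apply: near_eq_cvg; apply: nearW => n.
under eq_Rintegral do rewrite KE//.
rewrite RintegralD// ?Rintegral_cst1//.
  have Cw k := @wcut_smooth R d n.+1%:R k (ltr0Sn R n).
  exact: (pot_integrable Cw (fun s => @wcut_le0 R d n.+1%:R s (ltr0Sn R n))
    (fun s => @wcut_ge R d n.+1%:R s (ltr0Sn R n)) (dG n) (@GN n)).
by apply: (@bounded_integrable _ _ _ _ _ `|cn n|).
Qed.

Lemma mmd_limit rho mu : growth A rho -> growth A mu -> (-oo < MMD2 rho mu)%E ->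
  exists2 M : R, MMD2 rho mu = M%:E &
  (2^-1 * (\int[rho]_y pot (G n) rho y) - (\int[mu]_y pot (G n) rho y)
     + 2^-1 * (\int[mu]_y pot (G n) mu y)) @[n --> \oo] --> M.
Proof.
move=> gr gm fin; have [ir im] := MMD2_finite_moments gr gm fin.
have [C C0 hC] := coulomb_integrable.
pose u nu (x : V) := \int[nu]_y g (x - y).
have [irr lrr] := potential_limit gr ir ir.
have [irm lrm] := potential_limit gr ir im.
have [imr lmr] := potential_limit gm im ir.
have [imm lmm] := potential_limit gm im im.
have pE (x : V) : (potential rho mu x = (u rho x - u mu x)%:E)%E.
  rewrite /potential /u /Rintegral EFinB !fineK//.
    by apply: integrable_fin_num => //; have [] := hC mu x gm im.
  by apply: integrable_fin_num => //; have [] := hC rho x gr ir.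
have sym : \int[rho]_x u mu x = \int[mu]_x u rho x.
  apply: (cvg_unique _ lmr); first exact: Rhausdorff.
  apply: cvg_trans lrm; apply: near_eq_cvg; apply: nearW => n.
  by rewrite (pot_sym (dG n) (@GN n)).
exists (2^-1 * (\int[rho]_x (u rho x - u mu x) - \int[mu]_x (u rho x - u mu x))).
  rewrite /MMD2 EFinM; congr (_ * _)%E; rewrite EFinB /Rintegral !fineK.
  - by congr (_ - _)%E; apply: eq_integral => x _; exact: pE.
  - apply: integrable_fin_num => //; by have := integrableB measurableT irm imm.
  - apply: integrable_fin_num => //; by have := integrableB measurableT irr imr.
rewrite RintegralB// RintegralB// sym.
have -> : 2^-1 * (\int[rho]_x u rho x - \int[mu]_x u rho x - (\int[mu]_x u rho x - \int[mu]_x u mu x))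
  = 2^-1 * (\int[rho]_x u rho x) - (\int[mu]_x u rho x) + 2^-1 * (\int[mu]_x u mu x).
  by move: (\int[rho]_x _) (\int[mu]_x u rho x) (\int[mu]_x u mu x) => a b c; lra.
have a1 : 2^-1 * (\int[rho]_x pot (G n) rho x + cn n) @[n --> \oo] --> 2^-1 * \int[rho]_x u rho x.
  by apply: cvgMr; exact: lrr.
have a2 : 2^-1 * (\int[mu]_x pot (G n) mu x + cn n) @[n --> \oo] --> 2^-1 * \int[mu]_x u mu x.
  by apply: cvgMr; exact: lmm.
have h := cvgD (cvgB a1 lrm) a2.
rewrite [X in X @ _ --> _](_ : _ = fun n => 2^-1 * (\int[rho]_x pot (G n) rho x + cn n) -
   (\int[mu]_x pot (G n) rho x + cn n) + 2^-1 * (\int[mu]_x pot (G n) mu x + cn n)).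
  exact: h.
apply/funext => n.
by move: (\int[rho]_x _) (\int[mu]_x pot (G n) rho x) (\int[mu]_x pot (G n) mu x) (cn n) => a b c e; lra.
Unshelve. all: by end_near. Qed.

End mmd_limit.

(** * PART 16 *)

Section growth_of_densities.
Context (R : realType) (d : nat).
Hypothesis d0 : (0 < d)%N.
Implicit Types rho mu : probability 'rV[R]_d R.

Lemma leb_ball (x : 'rV[R]_d) r : 0 < r -> leb R d (ball x r) = ((2 * r) ^+ d)%:E.
Proof.
move=> r0.
have -> : ball x r = [set y : 'rV[R]_d | forall i, `]x 0 i - r, x 0 i + r[%classic (y 0 i)].
  apply/seteqP; split=> y.
    rewrite rV_ballE => xy i /=; rewrite in_itv/= -ltr_distl.
    by rewrite distrC (le_lt_trans _ xy)// (le_trans _ (coord_le_norm (x - y) i))// !mxE.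
  move=> h; split => // a i; rewrite (ord1 a).
  by have := h i; rewrite /= in_itv/= -ltr_distl /ball/= distrC.
rewrite (leb_box (A := fun i => `]x 0 i - r, x 0 i + r[%classic))//.
under eq_bigr => i _.
  rewrite lebesgue_measure_itv/= lte_fin ifT; last by rewrite ltrD2l gtrN.
  rewrite -EFinB (_ : x 0 i + r - (x 0 i - r) = 2 * r); last by ring.
  over.
by rewrite prodEFin prodr_const card_ord.
Qed.

Lemma density_le rho f M (B : set 'rV[R]_d) : has_density rho f ->
  ('N[leb R d]_+oo [EFin \o f] <= M%:E)%E -> measurable B -> 0 <= M ->
  (rho B <= M%:E * leb R d B)%E.
Proof.
move=> [mf f0 rhoE] fM mB M0; rewrite rhoE//.
have ae : {ae leb R d, forall x, f x <= M}.
  move: fM; rewrite unlock; case: ifPn => [_ /ess_supP h|].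
    by apply: filterS h => x /=; rewrite lee_fin; apply: le_trans; exact: ler_norm.
  rewrite -leNgt measure_le0 => /eqP l0 _; exists setT; split => //.
rewrite -integral_cst//; apply: ae_ge0_le_integral => //.
- by move=> x _; rewrite lee_fin.
- by apply: measurable_fun_EFin; exact: measurable_funTS.
- by apply: filterS ae => x h _; rewrite lee_fin.
Qed.

Lemma Linfty_growth rho M : 0 <= M -> (Linfty_norm rho <= M%:E)%E ->
  growth ((M + 1) * 2 ^+ d) rho.
Proof.
move=> M0 hM x r r0.
have : (Linfty_norm rho < (M + 1)%:E)%E by rewrite (le_lt_trans hM)// lte_fin ltrDl.
move=> /ereal_inf_lt[_ [f hf <-] /ltW fM].
rewrite (le_trans (density_le hf fM (rV_measurable_ball x r) _)) ?addr_ge0//.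
by rewrite leb_ball// -EFinM lee_fin exprMn mulrA.
Qed.

Lemma growthW rho A B : A <= B -> growth A rho -> growth B rho.
Proof.
move=> AB gr x r r0; rewrite (le_trans (gr x r r0))// lee_fin ler_wpM2r//.
by rewrite exprn_ge0// ltW.
Qed.

Lemma Linfty_fin_growth rho : (Linfty_norm rho < +oo)%E -> exists A, growth A rho.
Proof.
move=> h; have [M M0 hM] : exists2 M, 0 <= M & (Linfty_norm rho <= M%:E)%E.
  case: (Linfty_norm rho) h => [x _|//|_]; last by exists 0 => //; rewrite leNye.
  by exists `|x| => //; rewrite lee_fin ler_norm.
by exists ((M + 1) * 2 ^+ d); exact: Linfty_growth.
Qed.

End growth_of_densities.

Lemma prob_integral_indic dT (T : measurableType dT) (R : realType) (P : probability T R)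
  (B : set T) : measurable B -> (\int[P]_x (\1_B x)%:E = P B)%E.
Proof. by move=> mB; rewrite integral_indic// setIT. Qed.

Section clamped_curve.
Context (R : realType) (d : nat).
Hypothesis d0 : (0 < d)%N.
Variables (rho : R -> probability 'rV[R]_d R) (T : R).
Hypothesis T0 : 0 < T.
Hypothesis rho_narrow : narrowly_continuous rho.
Hypothesis rho_bounded : locally_bounded rho.

Definition clamp (t : R) : R := Num.min (Num.max t 0) T.

Lemma clamp_ge0 t : 0 <= clamp t.
Proof. by rewrite /clamp le_min (ltW T0) le_max lexx orbT. Qed.

Lemma clamp_id t : 0 <= t <= T -> clamp t = t.
Proof. by move=> /andP[t0 tT]; rewrite /clamp max_l// min_l. Qed.

Lemma clamp_leT t : clamp t <= T.
Proof. by rewrite /clamp ge_min lexx orbT. Qed.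

Lemma clamp_continuous : continuous clamp.
Proof.
move=> t; have cmax : {for t, continuous (fun t : R => Num.max t 0)}.
  by apply: continuous_max; [exact: cvg_id|exact: cst_continuous].
have cT : {for t, continuous (fun _ : R => T)} by exact: cst_continuous.
exact: (continuous_min cmax cT).
Qed.

Definition crv (t : R) := rho (clamp t).

Lemma crv_narrow (f : 'rV[R]_d -> R) : continuous f ->
  (exists M : R, forall x, `|f x| <= M) ->
  continuous (fun t : R => \int[crv t]_x f x).
Proof.
move=> cf bf t.
have h := rho_narrow cf bf.
have h' := (@subspace_continuousP _ _ _ _).1 h (clamp t).
have in0 : `[0, +oo[%classic (clamp t) by rewrite /= in_itv/= andbT clamp_ge0.
have {}h' := h' in0.
apply: (@cvg_comp _ _ _ clamp (fun t => \int[rho t]_x f x) _ _ _ _ h').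
move=> B /= wB.
have h1 : nbhs (clamp t) (fun u => `[0, +oo[%classic u -> B u) by exact: wB.
have h2 : \forall s \near t, `[0, +oo[%classic (clamp s) -> B (clamp s).
  exact: (@clamp_continuous t _ h1).
by apply: filterS h2 => s /=; apply; rewrite in_itv/= andbT clamp_ge0.
Qed.

Lemma crv_growth : exists2 A, 0 <= A & forall t, growth A (crv t).
Proof.
have [M0 hM0] := rho_bounded T0.
pose M := `|M0|; pose A0 := (M + 1) * 2 ^+ d.
have Mp : 0 <= M by exact: normr_ge0.
exists (A0 * 2 ^+ d); first by rewrite mulr_ge0 ?exprn_ge0// mulr_ge0 ?exprn_ge0// addr_ge0.
move=> t x r r0.
pose f (y : 'rV[R]_d) : R := Num.max 0 (Num.min 1 (2 - `|x - y| / r)).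
have f0 y : 0 <= f y by rewrite /f le_max lexx.
have f1 y : f y <= 1 by rewrite /f ge_max ler01 ge_min lexx.
have bf : exists M : R, forall x, `|f x| <= M by exists 1 => y; rewrite ger0_norm.
have cf : continuous f.
  apply: (@lipschitz_continuous _ _ _ r^-1) => z z'.
  have h : `| `|x - z| - `|x - z'| | <= `|z - z'|.
    rewrite (le_trans (ler_dist_dist _ _))//.
    by rewrite opprB addrC subrKA distrC.
  have h2 : `|(2 - `|x - z| / r) - (2 - `|x - z'| / r)| <= r^-1 * `|z - z'|.
    have -> : (2 - `|x - z| / r) - (2 - `|x - z'| / r) = - r^-1 * (`|x - z| - `|x - z'|) by ring.
    have ri : 0 < r^-1 by rewrite invr_gt0.
    by rewrite normrM normrN (gtr0_norm ri) ler_wpM2l// ltW.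
  rewrite /f; move: h2; move: (2 - _) (2 - _) (r^-1 * _) => a b c; rewrite !ler_norml.
  move=> /andP[h1 h3]; apply/andP.
  have clip (u : R) : exists v : R, v = Num.max 0 (Num.min 1 u) /\
      ((u <= 0 /\ v = 0) \/ (0 <= u <= 1 /\ v = u) \/ (1 <= u /\ v = 1)).
    exists (Num.max 0 (Num.min 1 u)); split => //.
    have [u1|u1] := leP 1 u; first by right; right; rewrite max_r.
    have [u0|u0] := leP 0 u; first by right; left; rewrite (ltW u1).
    by left; rewrite ltW.
  have [va [<- ca]] := clip a; have [vb [<- cb]] := clip b.
  by split; case: ca => [[? ?]|[[/andP[? ?] ?]|[? ?]]]; case: cb => [[? ?]|[[/andP[? ?] ?]|[? ?]]]; lra.
have lo : (crv t (ball x r) <= (\int[crv t]_y f y)%:E)%E.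
  rewrite /Rintegral fineK; last first.
    apply: integrable_fin_num => //.
    by apply: (@bounded_integrable _ _ _ _ _ 1) => [|y]; [exact: continuous_rV_measurable|rewrite ger0_norm].
  rewrite -prob_integral_indic; last exact: rV_measurable_ball.
  apply: ge0_le_integral => //.
  - by apply: measurable_fun_EFin; apply: measurable_indic; exact: rV_measurable_ball.
  - by apply: measurable_fun_EFin; exact: continuous_rV_measurable.
  move=> y _; rewrite lee_fin indicE; case: (boolP (y \in (ball x r : set 'rV[R]_d))) => // /[!inE] /[!rV_ballE] xy.
  rewrite /f le_max; apply/orP; right; rewrite le_min lexx/= lerBrDr -lerBrDl.
  by rewrite ler_pdivrMr//; lra.
have hi s : (Linfty_norm (rho s) <= M%:E)%E -> \int[rho s]_y f y <= A0 * (2 * r) ^+ d.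
  move=> hs; have gs := Linfty_growth Mp hs.
  rewrite -lee_fin (le_trans _ (gs x (2 * r) _)) ?mulr_gt0//.
  rewrite /Rintegral fineK; last first.
    apply: integrable_fin_num => //.
    by apply: (@bounded_integrable _ _ _ _ _ 1) => [|y]; [exact: continuous_rV_measurable|rewrite ger0_norm].
  rewrite -[leRHS]prob_integral_indic; last exact: rV_measurable_ball.
  apply: ge0_le_integral => //.
  - by move=> y _; rewrite lee_fin.
  - by apply: measurable_fun_EFin; exact: continuous_rV_measurable.
  - by apply: measurable_fun_EFin; apply: measurable_indic; exact: rV_measurable_ball.
  move=> y _; rewrite lee_fin indicE; case: (boolP (y \in _)) => // /negP nb.
  rewrite /f ge_max lexx/= ge_min; apply/orP; right.
  rewrite subr_le0 ler_pdivlMr// leNgt; apply/negP => h; apply: nb.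
  by rewrite inE rV_ballE.
rewrite (le_trans lo)// lee_fin -mulrA -exprMn leNgt; apply/negP => gt.
pose p := clamp t.
have p0 : 0 <= p := clamp_ge0 t.
have pT : p <= T := clamp_leT t.
have crvp : crv p = crv t by rewrite /crv (@clamp_id p)// p0.
clearbody p.
have : \forall s \near p, A0 * (2 * r) ^+ d < \int[crv s]_y f y.
  by apply: (cvgr_gt _ (crv_narrow cf bf (x0 := p))); rewrite crvp.
move=> /nbhs_ballP[e /= e0 he].
have [N [mN N0 hN]] := hM0.
pose a := Num.max 0 (p - e); pose b := Num.min T (p + e).
have e0' : (0 : R) < e by exact: e0.
have ab : a < b.
  rewrite /a /b gt_max !lt_min T0 ltr_wpDl//= ltrBlDr (le_lt_trans pT) ?ltrDl//=.
  by rewrite ltrBlDr -addrA ltrDl addr_gt0.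
have sub s : a < s < b -> [/\ 0 <= s, s <= T & ball p e s].
  rewrite /a /b gt_max lt_min => /andP[/andP[s0 s1] /andP[s2 s3]].
  by split; [exact: ltW|exact: ltW|rewrite /ball/= ltr_distlC s1].
have bad s : a < s < b -> N s.
  move=> /sub[s0 sT sb]; apply: hN => /= good.
  have := he s sb; rewrite /crv clamp_id ?s0// ltNge => /negP; apply; apply: hi.
  by rewrite (le_trans (good _)) ?s0// lee_fin ler_norm.
have : (lebesgue_measure (`]a, b[%classic : set R) <= lebesgue_measure N)%E.
  by apply: le_measure; rewrite ?inE// => s /=; rewrite in_itv/=; exact: bad.
rewrite N0 lebesgue_measure_itv/= lte_fin ab -EFinB lee_fin; lra.
Qed.

End clamped_curve.

(** * PART 17 *)

Section good_time.
Context (R : realType) (d : nat).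
Hypothesis d2 : (2 <= d)%N.
Variables (mu rho0 : probability 'rV[R]_d R) (rho : R -> probability 'rV[R]_d R) (T : R).
Hypothesis T0 : 0 < T.
Hypothesis mu_bounded : (Linfty_norm mu < +oo)%E.
Hypothesis sol : bounded_solution mu rho0 rho.

Let d0 : (0 < d)%N. Proof. exact: leq_trans d2. Qed.

Let r := crv rho T.

Lemma measurable_field_sq (A : R) (nu : probability 'rV[R]_d R) :
  growth A nu -> growth A mu ->
  measurable_fun setT (fun x => enorm (field nu mu x) ^+ 2) /\
  forall x, enorm (field nu mu x) ^+ 2 = \sum_i (cf i nu x - cf i mu x) ^+ 2.
Proof.
move=> gn gm.
have E x : enorm (field nu mu x) ^+ 2 = \sum_i (cf i nu x - cf i mu x) ^+ 2.
  rewrite /enorm sqr_sqrtr; last by apply: sumr_ge0 => i _; exact: sqr_ge0.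
  by apply: eq_bigr => i _; rewrite (fieldE d0 _ _ gn gm).
split => //; under eq_fun do rewrite E.
apply: measurable_sum => i; apply: measurable_funX; apply: measurable_funB.
  exact: (measurable_cf d0 i d2 gn).
exact: (measurable_cf d0 i d2 gm).
Qed.

Section weak_form.
Variables (A : R) (w G : R -> R) (N : R).
Hypothesis gr : forall t, growth A (r t).
Hypothesis gmu : growth A mu.
Hypothesis Cw : forall k, Ck k (w : R^o -> R).
Hypothesis w0 : forall s, s <= 0 -> w s = 0.
Hypothesis wN : forall s, N <= s -> w s = 0.
Hypothesis dG : forall s, is_derive s (1 : R) G (w s).
Hypothesis CG : forall k, Ck k (G : R^o -> R).
Hypothesis GN : forall s, N <= s -> G s = 0.

Lemma weak_form_integrand (eta eta' : R -> R) (y : 'rV[R]_d) t : 0 <= t <= T ->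
  (forall t, is_derive t (1 : R) eta (eta' t)) ->
  \int[rho t]_x (dt (tfun eta G y) (t, x)
     + dotp (velocity (rho t) mu x) (gradient (fun z => tfun eta G y (t, z)) x)) =
  eta' t * pot G (r t) y + eta t * fl r mu w y t.
Proof.
move=> tT deta.
have rt : r t = rho t by rewrite /r /crv clamp_id.
have gt : growth A (rho t) by rewrite -rt.
have [M [L [M0 L0 hM hL mp]]] := ek_subr_bounded d Cw w0 wN.
have iflux := flux_integrable d2 gr gmu t (mp y) (hM y).
have [B B0 hB] := G_bounded d dG GN.
have iG : (r t).-integrable setT (EFin \o (fun x : 'rV[R]_d => G (nsq (x - y)))).
  apply: (@bounded_integrable _ _ _ _ _ B) => [|x]; last exact: hB.
  exact: (measurable_subr y (measurable_G dG)).
rewrite -rt; transitivity (\int[r t]_x (eta' t * G (nsq (x - y)) +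
    (- eta t) * \sum_i fluct r mu i t x * ek w i (x - y))).
  apply: eq_Rintegral => x _.
  rewrite (tfun_dt G x y (deta t)) (tfun_gradient eta t (dG _)); congr (_ + _).
  rewrite /dotp mulr_sumr; apply: eq_bigr => i _.
  have vE : velocity (rho t) mu x 0 i = - (cf i (rho t) x - cf i mu x).
    by rewrite /velocity mxE (fieldE d0 x i gt gmu).
  rewrite /fluct !rt vE mxE /ek.
  move: (cf i _ x) (cf i _ x) (eta t) (w _) ((x - y) 0 i) => a b c e f.
  ring.
rewrite RintegralD//; last 2 first.
- by have := integrableZl measurableT (eta' t) iG.
- by have := integrableZl measurableT (- eta t) iflux.
by rewrite RintegralZl// RintegralZl// /fl /flux mulNr mulrN.
Qed.

Lemma dpot_of_weak (y : 'rV[R]_d) t : 0 < t < T ->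
  is_derive t (1 : R) (fun t => pot G (r t) y) (fl r mu w y t).
Proof.
have [rb rn rw] := sol.
have narrow := crv_narrow T0 rn.
have [M [L [M0 L0 hM hL mp]]] := ek_subr_bounded d Cw w0 wN.
move=> tT; apply: (@weak_derivative R (fun t => pot G (r t) y) (fl r mu w y) T _ _ _ t tT).
- exact: (pot_continuous_t narrow Cw w0 wN dG GN).
- have [L' L'0 hL'] := ek_lipschitz Cw w0 wN d.
  apply: (@flux_continuous R d d2 r mu A narrow gr gmu _ M L' (hM y)) => i x x'.
  by apply: (le_trans (hL' _ _ _)); rewrite opprB subrKA.
move=> eta eta' u v deta Ceta u0 vT eta0 eta1.
have test := tfun_test y vT Ceta CG eta0 eta1 GN.
have := rw T (tfun eta G y) T0 test.
rewrite [X in _ + X](_ : _ = 0) ?addr0; last first.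
  rewrite (_ : (fun x => _) = fun=> 0) ?Rintegral_cst1//.
  by apply/funext => x; rewrite /tfun /= eta0 ?mul0r.
move=> h; rewrite -[RHS]h; apply: eq_Rintegral => s; rewrite inE/= in_itv/= => sT.
by rewrite weak_form_integrand.
Qed.

End weak_form.

Lemma good_time (a b : R) : 0 < b ->
  (b%:E <= MMD2 (rho 0) mu)%E -> (MMD2 (rho 0) mu <= a%:E)%E ->
  (b%:E <= MMD2 (rho T) mu)%E ->
  exists2 tau, 0 < tau < T & (dissipation (rho tau) mu <= (a / T)%:E)%E.
Proof.
move=> b0 h0 h0' hT.
have [rb rn rw] := sol.
have [A1 A10 gr1] := crv_growth T0 rn rb.
have [A2 gm2] := Linfty_fin_growth mu_bounded.
pose A := Num.max A1 A2.
have gr t : growth A (r t) by apply: growthW (gr1 t); rewrite le_max lexx.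
have gmu : growth A mu by apply: growthW gm2; rewrite le_max lexx orbT.
have A0 : 0 <= A by rewrite le_max A10.
have narrow := crv_narrow T0 rn.
have r0E : r 0 = rho 0 by rewrite /r /crv clamp_id// lexx ltW.
have rTE : r T = rho T by rewrite /r /crv clamp_id// lexx ltW.
have N0 n : (0 : R) < n.+1%:R by [].
have Cw n k := @wcut_smooth R d n.+1%:R k (N0 n).
have w0 n s := @wcut_le0 R d n.+1%:R s (N0 n).
have wN n s := @wcut_ge R d n.+1%:R s (N0 n).
have [G hG] := choice (fun n => compact_primitive (Cw n) (w0 n) (wN n)).
have dG n s : is_derive s (1 : R) (G n) (wcut d n.+1%:R s) by have [] := hG n.
have CG n k : Ck k (G n : R^o -> R) by have [] := hG n.
have GN n s : n.+1%:R <= s -> G n s = 0 by have [_ _] := hG n; exact.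
have ltNy nu : (b%:E <= MMD2 nu mu)%E -> (-oo < MMD2 nu mu)%E.
  by apply: lt_le_trans; exact: ltNyr.
have g0 : growth A (rho 0) by rewrite -r0E.
have gT : growth A (rho T) by rewrite -rTE.
have [M0 M0E lim0] := mmd_limit d2 dG GN g0 gmu (ltNy _ h0).
have [MT MTE limT] := mmd_limit d2 dG GN gT gmu (ltNy _ hT).
have M0a : M0 <= a by move: h0'; rewrite M0E lee_fin.
have MTb : b <= MT by move: hT; rewrite MTE lee_fin.
pose V : R := 2 * vmax d A.
have V0 : 0 <= V by exact: (vmax2_ge0 d2 gmu).
pose e := b / 4 / T / (d%:R * (V * 2) + 1).
have q0 : 0 < d%:R * (V * 2) + 1 by rewrite ltr_wpDl// mulr_ge0// mulr_ge0.
have e0 : 0 < e by rewrite !divr_gt0.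
have [Ne Ne0 hNe] := ce_cf d0 d2 A0 e0.
have b4 : 0 < b / 4 by rewrite divr_gt0.
have [n [hn1 hn2 hn3]] : exists n, [/\ Ne <= n.+1%:R,
   `|M0 - (2^-1 * (\int[rho 0]_y pot (G n) (rho 0) y) - (\int[mu]_y pot (G n) (rho 0) y)
     + 2^-1 * (\int[mu]_y pot (G n) mu y))| <= b / 4 &
   `|MT - (2^-1 * (\int[rho T]_y pot (G n) (rho T) y) - (\int[mu]_y pot (G n) (rho T) y)
     + 2^-1 * (\int[mu]_y pot (G n) mu y))| <= b / 4].
  have near1 := cvgr_dist_le _ _ lim0 _ b4.
  have near2 := cvgr_dist_le _ _ limT _ b4.
  near \oo => n; exists n; split.
  - rewrite (@le_trans _ _ n%:R)// ?ler_nat//.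
    by near: n; exact: nbhs_infty_ger.
  - by near: n; exact: near1.
  - by near: n; exact: near2.
have [tau tauT hE] := energy_mvt d2 narrow gr gmu (Cw n) (w0 n) (wN n) (dG n) (GN n) T0
  (fun y t => @dpot_of_weak A (wcut d n.+1%:R) (G n) n.+1%:R gr gmu (Cw n) (w0 n) (wN n) (dG n)
     (CG n) (GN n) y t).
exists tau => //.
have dis : T * dissip r mu (wcut d n.+1%:R) tau <= a - b / 2.
  rewrite -hE /energy -/r r0E rTE; move: hn2 hn3; rewrite !ler_distl.
  move: (2^-1 * _) (\int[mu]_y _) (2^-1 * \int[rho T]_y _) (\int[mu]_y pot (G n) (rho T) y)
    (2^-1 * \int[mu]_y _) => x1 x2 x3 x4 x5 /andP[? ?] /andP[? ?]; lra.
have tauE : r tau = rho tau by rewrite /r /crv clamp_id//; case/andP: tauT => ? ?; rewrite !ltW.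
have gt : growth A (rho tau) by rewrite -tauE.
have [mf fE] := measurable_field_sq gt gmu.
have fb (x : 'rV[R]_d) (i : 'I_d) : `|cf i (rho tau) x - cf i mu x| <= V.
  by have := fluct_bound d2 gr gmu i tau x; rewrite /fluct tauE.
rewrite /dissipation.
have -> : (\int[rho tau]_x (enorm (field (rho tau) mu x) ^+ 2)%:E =
   (\int[rho tau]_x \sum_i (cf i (rho tau) x - cf i mu x) ^+ 2)%:E)%E.
  rewrite /Rintegral fineK; first by apply: eq_integral => x _; rewrite fE.
  apply: integrable_fin_num => //; apply: (@bounded_integrable _ _ _ _ _ (d%:R * (V * V))).
    by under eq_fun do rewrite -fE.
  by move=> x; apply: norm_sum_le => i; rewrite expr2 normrM ler_pM.
rewrite lee_fin ler_pdivlMr// mulrC.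
pose p (i : 'I_d) (x : 'rV[R]_d) := ce (wcut d n.+1%:R) i (rho tau) x - ce (wcut d n.+1%:R) i mu x.
have pe (i : 'I_d) (x : 'rV[R]_d) : `|(cf i (rho tau) x - cf i mu x) - p i x| <= 2 * e.
  rewrite /p subrB4 (le_trans (ler_normB _ _))// mulr_natl mulr2n lerD//.
    by rewrite distrC hNe.
  by rewrite distrC hNe.
have [Mc [Lc [Mc0 Lc0 hce]]] := ce_lipschitz d (Cw n) (w0 n) (wN n).
have mce (i : 'I_d) (nu : probability 'rV[R]_d R) : measurable_fun setT (ce (wcut d n.+1%:R) i nu).
  have [_ _ hl] := hce i nu.
  by apply: continuous_rV_measurable; exact: lipschitz_continuous hl.
have mcf (i : 'I_d) (nu : probability 'rV[R]_d R) : growth A nu -> measurable_fun setT (cf i nu).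
  by move=> gnu; exact: (measurable_cf d0 i d2 gnu).
have disE : dissip r mu (wcut d n.+1%:R) tau =
    \int[rho tau]_x \sum_i (cf i (rho tau) x - cf i mu x) * p i x.
  by rewrite /dissip tauE; apply: eq_Rintegral => x _; rewrite /fluct tauE.
have pb (i : 'I_d) (x : 'rV[R]_d) : `|p i x| <= 2 * Mc.
  rewrite /p (le_trans (ler_normB _ _))// mulr_natl mulr2n lerD//.
    by have [_ + _] := hce i (rho tau); exact.
  by have [_ + _] := hce i mu; exact.
have i1 : (rho tau).-integrable setT (EFin \o (fun x => \sum_i (cf i (rho tau) x - cf i mu x) ^+ 2)).
  apply: (@bounded_integrable _ _ _ _ _ (d%:R * (V * V))).
    by under eq_fun do rewrite -fE.
  by move=> x; apply: norm_sum_le => i; rewrite expr2 normrM ler_pM.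
have mfl (i : 'I_d) : measurable_fun setT (fun x => cf i (rho tau) x - cf i mu x).
  by apply: measurable_funB; exact: mcf.
have mp (i : 'I_d) : measurable_fun setT (p i) by exact: measurable_funB.
have i2 : (rho tau).-integrable setT (EFin \o (fun x => \sum_i (cf i (rho tau) x - cf i mu x) * p i x)).
  apply: (@bounded_integrable _ _ _ _ _ (d%:R * (V * (2 * Mc)))).
    by apply: measurable_sum => i; exact: measurable_funM.
  by move=> x; apply: norm_sum_le => i; rewrite normrM ler_pM.
have close : \int[rho tau]_x (\sum_i (cf i (rho tau) x - cf i mu x) ^+ 2) -
   \int[rho tau]_x (\sum_i (cf i (rho tau) x - cf i mu x) * p i x) <= d%:R * (V * (2 * e)).
  rewrite -RintegralB//; apply: (le_trans (ler_norm _)); apply: norm_Rintegral_le.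
    apply: measurable_funB; first by under eq_fun do rewrite -fE.
    by apply: measurable_sum => i; exact: measurable_funM.
  move=> x; rewrite -sumrB; apply: norm_sum_le => i.
  by rewrite expr2 -mulrBr normrM ler_pM.
have Te : T * (d%:R * (V * (2 * e))) <= b / 4.
  rewrite /e (_ : T * (d%:R * (V * (2 * (b / 4 / T / (d%:R * (V * 2) + 1))))) =
     (b / 4) * (d%:R * (V * 2) / (d%:R * (V * 2) + 1))); last first.
    have qn := lt0r_neq0 q0; have Tn := lt0r_neq0 T0.
    move: (d%:R * (V * 2) + 1) qn => q qn.
    by field; rewrite qn Tn.
  by rewrite ler_piMr ?(ltW b4)// ler_pdivrMr// mul1r lerDl.
move: close dis; rewrite disE -(ler_pM2l T0) mulrBr.
move: (T * \int[_]_x _) (T * \int[_]_x _) (T * (_ * _)) Te => x1 x2 x3 *; lra.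
Unshelve. all: by end_near. Qed.

End good_time.

(** * PART 18 *)

Section field_measurability.
Context (R : realType) (d : nat).
Hypothesis d0 : (0 < d)%N.
Implicit Types nu mu : probability 'rV[R]_d R.

Lemma gk_bound_d1 i (z : 'rV[R]_d) : d = 1%N -> `|gk i z| <= 2^-1.
Proof.
move=> d1; have [->|z0] := eqVneq z 0; first by rewrite gk0 normr0.
rewrite (le_trans (gk_bound i z0))// /kappa.
by case: d d1 i z z0 => [//|[|//]] _ i z z0; rewrite expr0 invr1 mulr1.
Qed.

Lemma cf_bound_d1 nu i x : d = 1%N -> `|cf i nu x| <= 2^-1.
Proof.
move=> d1; apply: norm_Rintegral_le => [|y]; last exact: gk_bound_d1.
exact: (measurable_subl x (measurable_gk i)).
Qed.

Lemma measurable_field_component (A : R) nu i : growth A nu -> measurable_fun setT (cf i nu).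
Proof.
move=> gn; have [d2|d2] := leqP 2 d; first exact: (measurable_cf d0 i d2 gn).
have d1 : d = 1%N by apply/eqP; rewrite eqn_leq d0 -ltnS d2.
apply: (@Rintegral_measurable1 R _ _ _ _ nu nu (fun z => gk i (z.1 - z.2)) 2^-1).
  exact: (measurable_sub2 (measurable_gk i)).
by move=> z; exact: gk_bound_d1.
Qed.

Lemma field_sqE (A : R) nu mu x : growth A nu -> growth A mu ->
  enorm (field nu mu x) ^+ 2 = \sum_i (cf i nu x - cf i mu x) ^+ 2.
Proof.
move=> gn gm.
rewrite /enorm sqr_sqrtr; last by apply: sumr_ge0 => i _; exact: sqr_ge0.
by apply: eq_bigr => i _; rewrite (fieldE d0 _ _ gn gm).
Qed.

Lemma dissipation_le (A B : R) nu mu : growth A nu -> growth A mu -> 0 <= B ->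
  {ae nu, forall x, forall i, `|cf i nu x - cf i mu x| <= B} ->
  (dissipation nu mu <= (d%:R * B ^+ 2)%:E)%E.
Proof.
move=> gn gm B0 hB; rewrite /dissipation -(prob_integral_cst nu (d%:R * B ^+ 2)).
apply: ae_ge0_le_integral => //.
- by move=> x _; rewrite lee_fin sqr_ge0.
- apply: measurable_fun_EFin; under eq_fun do rewrite (field_sqE _ gn gm).
  apply: measurable_sum => i; apply: measurable_funX; apply: measurable_funB.
    exact: (measurable_field_component i gn).
  exact: (measurable_field_component i gm).
- by move=> x _; rewrite lee_fin mulr_ge0// sqr_ge0.
apply: filterS hB => x hx _; rewrite lee_fin (field_sqE _ gn gm).
rewrite (le_trans (ler_norm _))//; apply: norm_sum_le => i.
by rewrite normrX lerXn2r ?nnegrE.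
Qed.

End field_measurability.

Lemma ratio_le (R : realType) (D M : \bar R) (a b : R) : 0 < b -> (D <= a%:E)%E -> 0 <= a ->
  (b%:E <= M)%E -> (M < +oo)%E -> (D / M <= (a / b)%:E)%E.
Proof.
move=> b0 Da a0 bM; case: M bM => [m|//|//].
rewrite lee_fin => bm _.
have m0 : 0 < m := lt_le_trans b0 bm.
rewrite inver gt_eqF//.
apply: (@le_trans _ _ (a%:E * m^-1%:E)%E).
  by apply: lee_wpmul2r => //; rewrite lee_fin invr_ge0 ltW.
by rewrite -EFinM lee_fin ler_wpM2l// lef_pV2.
Qed.

Lemma Phi_gt0 (R : realType) d (D : R) : 2 <= D -> 0 < Phi d D.
Proof.
move=> D2; rewrite /Phi; case: d => [|[|[|n]]] //; first by apply: lt_le_trans D2.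
by rewrite ln_gt0//; apply: lt_le_trans D2; rewrite ltr1n.
Qed.

Theorem small_ratio_times (R : realType) (d : nat) (mu : probability 'rV[R]_d R)
    (hd : (1 <= d)%N) (mu_bounded : (Linfty_norm mu < +oo)%E)
    (rho0 : nat -> probability 'rV[R]_d R)
    (rho : nat -> R -> probability 'rV[R]_d R) (Dn : nat -> R)
    (c0 c1 C1 : R) (n0 : nat) :
  Dn n @[n --> \oo] --> +oo ->
  (forall n, bounded_solution mu (rho0 n) (rho n)) ->
  persistence mu rho0 rho Dn c0 c1 C1 n0 ->
  exists (t : nat -> R) (C : R),
    (forall n, (n0 <= n)%N ->
      0 < t n < c0 * Dn n /\
      (dissipation (rho n (t n)) mu / MMD2 (rho n (t n)) mu <= (C / Dn n)%:E)%E) /\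
      C / Dn n @[n --> \oo] --> 0.
Proof.
move=> Doo sol [c00 c10 C10 pers].
pose C := Num.max c1^-1 (C1 / (c0 * c1)).
have key n : exists t, (n0 <= n)%N -> 0 < t < c0 * Dn n /\
      (dissipation (rho n t) mu / MMD2 (rho n t) mu <= (C / Dn n)%:E)%E.
  have [nn|nn] := leqP n0 n; last by exists 0.
  have [D2 hp] := pers n nn.
  have D0 : 0 < Dn n := lt_le_trans (ltr0Sn R 1) D2.
  have T0 : 0 < c0 * Dn n by rewrite mulr_gt0.
  have Ph := Phi_gt0 d D2.
  have b0 : 0 < c1 * Phi d (Dn n) by rewrite mulr_gt0.
  have a0 : 0 < C1 * Phi d (Dn n) by rewrite mulr_gt0.
  have fin t : 0 <= t <= c0 * Dn n ->
      (MMD2 (rho n t) mu <= (C1 * Phi d (Dn n))%:E)%E.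
    by move=> ht; have [_ h1 h2] := hp t ht; exact: le_trans h2.
  have finy t : 0 <= t <= c0 * Dn n -> (MMD2 (rho n t) mu < +oo)%E.
    by move=> ht; rewrite (le_lt_trans (fin t ht))// ltry.
  have [d2|d2] := leqP 2 d.
    have l0 : (0 : R) <= (0 : R) <= c0 * Dn n by apply/andP; split => //; exact: ltW.
    have lT : 0 <= c0 * Dn n <= c0 * Dn n by apply/andP; split => //; exact: ltW.
    have [h0 _ _] := hp _ l0; have [hT _ _] := hp _ lT.
    have [tau tT hD] := good_time d2 T0 mu_bounded (sol n) b0 h0 (fin _ l0) hT.
    exists tau => _; split => //.
    have lt : 0 <= tau <= c0 * Dn n by case/andP: tT => ? ?; rewrite !ltW.
    have [h1 _ _] := hp _ lt.
    have ap : 0 <= C1 * Phi d (Dn n) / (c0 * Dn n) by rewrite divr_ge0// ltW.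
    apply: (le_trans (ratio_le b0 hD ap h1 (finy _ lt))).
    rewrite lee_fin [leLHS](_ : _ = C1 / (c0 * c1) / Dn n).
      by rewrite ler_wpM2r ?invr_ge0 ?(ltW D0)// le_max lexx orbT.
    have := lt0r_neq0 Ph; have := lt0r_neq0 D0; have := lt0r_neq0 c00; have := lt0r_neq0 c10.
    move: (Phi d (Dn n)) => y; move: (Dn n) => x u v z q; field.
    by rewrite u v z q.
  have d1 : d = 1%N by apply/eqP; rewrite eqn_leq hd -ltnS d2.
  have tT : 0 < c0 * Dn n / 2 < c0 * Dn n by apply/andP; lra.
  move: tT; set tau := c0 * Dn n / 2 => tT.
  exists tau => _; split => //.
  have lt : 0 <= tau <= c0 * Dn n by case/andP: tT => ? ?; rewrite !ltW.
  have [h1 _ _] := hp _ lt.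
  have [rb rn _] := sol n.
  have [A1 A10 gr1] := crv_growth T0 rn rb.
  have [A2 gm2] := Linfty_fin_growth mu_bounded.
  have gr : growth (Num.max A1 A2) (rho n tau).
    have := gr1 tau; rewrite /crv clamp_id//.
    by apply: growthW; rewrite le_max lexx.
  have gmu : growth (Num.max A1 A2) mu by apply: growthW gm2; rewrite le_max lexx orbT.
  have hD : (dissipation (rho n tau) mu <= (d%:R * 1 ^+ 2)%:E)%E.
    apply: (dissipation_le hd gr gmu ler01); apply: aeW => x i.
    rewrite (le_trans (ler_normB _ _))//.
    have := cf_bound_d1 (rho n tau) i x d1.
    have := cf_bound_d1 mu i x d1.
    by lra.
  apply: (le_trans (ratio_le b0 hD _ h1 (finy _ lt))) => //.
  rewrite d1 expr1n mulr1 /= mul1r invfM lee_fin.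
  by rewrite ler_wpM2r ?invr_ge0 ?(ltW D0)// le_max lexx.
have [t ht] := choice key.
exists t, C; split; first exact: ht.
apply/cvgrPdist_le => e e0.
have C0 : 0 <= C by rewrite /C le_max invr_ge0 (ltW c10).
near=> n.
have Dp : 0 < Dn n by near: n; exact: ((cvgryPgt _).1 Doo 0).
have De : C / e <= Dn n by near: n; exact: ((cvgryPge _).1 Doo (C / e)).
rewrite sub0r normrN ger0_norm ?divr_ge0 ?(ltW Dp)// ler_pdivrMr//.
by rewrite mulrC -ler_pdivrMr.
Unshelve. all: by end_near. Qed.

(** * PART 19 *)

Section ae_integrals.
Context (dT : measure_display) (T : measurableType dT) (R : realType) (P : probability T R).

Lemma ae_le_integral (f h : T -> \bar R) : measurable_fun setT f -> measurable_fun setT h ->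
  {ae P, forall x, (f x <= h x)%E} -> (\int[P]_x f x <= \int[P]_x h x)%E.
Proof.
move=> mf mh fh; rewrite integralE [leRHS]integralE; apply: leeB.
  apply: ae_ge0_le_integral => //; [exact: measurable_funepos|exact: measurable_funepos|].
  by apply: filterS fh => x fhx _; rewrite !funeposE; apply: le_max2 => //; exact: fhx.
apply: ae_ge0_le_integral => //; [exact: measurable_funeneg|exact: measurable_funeneg|].
by apply: filterS fh => x fhx _; rewrite !funenegE; apply: le_max2 => //; rewrite leeN2.
Qed.

Lemma ae_ge_integral_cst (f : T -> \bar R) (a : R) : measurable_fun setT f ->
  {ae P, forall x, (a%:E <= f x)%E} -> (a%:E <= \int[P]_x f x)%E.
Proof. by move=> mf af; rewrite -(prob_integral_cst P a); exact: ae_le_integral. Qed.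

Lemma ae_le_integral_cst (f : T -> \bar R) (a : R) : measurable_fun setT f ->
  {ae P, forall x, (f x <= a%:E)%E} -> (\int[P]_x f x <= a%:E)%E.
Proof. by move=> mf af; rewrite -(prob_integral_cst P a); exact: ae_le_integral. Qed.

Lemma ae_norm_Rintegral_le (f : T -> R) (M : R) : measurable_fun setT f ->
  {ae P, forall x, `|f x| <= M} -> `|\int[P]_x f x| <= M.
Proof.
move=> mf fM; apply: (norm_Rintegral_fine mf _).2.
by apply: ae_le_integral_cst => //; apply: measurable_fun_EFin; exact: measurableT_comp.
Qed.

End ae_integrals.

Section support.
Context (R : realType) (d : nat).
Implicit Types rho mu : probability 'rV[R]_d R.

Lemma rational_ball (U : set 'rV[R]_d) x : open U -> U x ->
  exists p : 'rV[rat]_d * nat,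
    ball (map_mx ratr p.1 : 'rV[R]_d) p.2.+1%:R^-1 `<=` U /\
    ball (map_mx ratr p.1 : 'rV[R]_d) p.2.+1%:R^-1 x.
Proof.
move=> oU Ux; have : nbhs x U by exact: open_nbhs_nbhs.
move=> /nbhs_ballP[r /= r0 rU].
have [n nr] : exists n : nat, n.+1%:R^-1 < r / 2.
  have r20 : 0 < r / 2 by rewrite divr_gt0.
  by have /ltr_add_invr[k] := r20; rewrite add0r; exists k.
have n0 : (0 : R) < n.+1%:R^-1 by rewrite invr_gt0.
have qx i : exists q : rat, `|ratr q - x 0 i| < n.+1%:R^-1 :> R.
  have [q] := @rat_in_itvoo R (x 0 i - n.+1%:R^-1) (x 0 i + n.+1%:R^-1)
    ltac:(by rewrite ltrBlDr -addrA ltrDl addr_gt0).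
  by rewrite in_itv/= => q12; exists q; rewrite ltr_distl.
pose q := (\row_i projT1 (cid (qx i))) : 'rV[rat]_d.
have xq : ball (map_mx ratr q : 'rV[R]_d) n.+1%:R^-1 x.
  split => // a i; rewrite (ord1 a) /ball/= !mxE; by case: cid.
exists (q, n); split=> // y qy; apply: rU; rewrite rV_ballE.
move: qy xq; rewrite !rV_ballE /=; set c := map_mx _ _ => qy xq.
rewrite (_ : x - y = (c - y) - (c - x)); last by rewrite opprB [RHS]addrC addrA subrK.
by rewrite (le_lt_trans (ler_normB _ _))// (splitr r) ltrD// (lt_trans _ nr).
Qed.

Lemma ae_supp mu : {ae mu, forall x, supp mu x}.
Proof.
pose B (p : 'rV[rat]_d * nat) : set 'rV[R]_d := ball (map_mx ratr p.1 : 'rV[R]_d) p.2.+1%:R^-1.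
pose F (k : nat) : set 'rV[R]_d :=
  if unpickle k is Some p then if mu (B p) == 0%E then B p else set0 else set0.
have nF k : mu.-negligible (F k).
  rewrite /F; case: unpickle => [p|]; last exact: negligible_set0.
  case: ifPn => [/eqP h|_]; last exact: negligible_set0.
  by exists (B p); split => //; exact: rV_measurable_ball.
apply: (negligibleS _ (negligible_bigcup nF)) => x /=.
move=> /existsNP[U /not_implyP[oU /not_implyP[Ux /negP]]].
rewrite -leNgt measure_le0 => /eqP U0.
have [p [pU px]] := rational_ball oU Ux.
exists (pickle p) => //; rewrite /F pickleK ifT//.
rewrite -measure_le0 -U0; apply: le_measure => //; rewrite inE.
  exact: rV_measurable_ball.
exact: rV_open_measurable.
Qed.

Lemma closed_supp mu : closed (supp mu).
Proof.
rewrite -openC openE => x /= /existsNP[U /not_implyP[oU /not_implyP[Ux nU]]].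
apply: (@filterS _ _ _ U); last exact: open_nbhs_nbhs.
by move=> y Uy /(_ U oU Uy).
Qed.

Lemma ae_norm_bound mu : compact (supp mu) -> exists2 r, 1 <= r & {ae mu, forall y, `|y| <= r}.
Proof.
move=> /compact_bounded[M [Mr hM]].
exists (`|M| + 1); first by rewrite lerDr.
apply: filterS (ae_supp mu) => y sy.
by apply: (hM _ _ y sy); rewrite (le_lt_trans (ler_norm M))// ltrDl.
Qed.

End support.

(** * PART 20 *)

Section uniform_cube.
Context (R : realType) (d : nat).
Variables (P : probability 'rV[R]_d R) (S : R).
Hypothesis S1 : 1 <= S.

Let S0 : 0 < S. Proof. exact: lt_le_trans S1. Qed.

Definition cube : set 'rV[R]_d := [set x | forall i, `[2 * S, 3 * S]%classic (x 0 i)].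

Lemma cube_compact : compact cube.
Proof.
apply: (@rV_compact _ d (fun=> `[2 * S, 3 * S]%classic)) => i.
exact: segment_compact.
Qed.

Lemma cube_closed : closed cube.
Proof. by apply: compact_closed; [exact: norm_hausdorff|exact: cube_compact]. Qed.

Lemma measurable_cube : measurable cube.
Proof.
rewrite -[cube]setCK; apply: measurableC; apply: rV_open_measurable.
by rewrite openC; exact: cube_closed.
Qed.

Lemma leb_cube : leb R d cube = (S ^+ d)%:E.
Proof.
rewrite /cube (leb_box (A := fun=> `[2 * S, 3 * S]%classic))//.
under eq_bigr => i _.
  rewrite lebesgue_measure_itv/= lte_fin ifT; last by move: S0; lra.
  rewrite -EFinB (_ : 3 * S - 2 * S = S); last by ring.
  over.
by rewrite prodEFin prodr_const card_ord.
Qed.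

Definition uniform_cube : probability 'rV[R]_d R :=
  mnormalize (mrestr (leb R d) measurable_cube) P.

Lemma uniform_cubeE B : uniform_cube B = (leb R d (B `&` cube) * (S ^- d)%:E)%E.
Proof.
rewrite /uniform_cube /= /mnormalize /= /mrestr setTI leb_cube/=.
by rewrite gt_eqF//= lte_fin exprn_gt0.
Qed.

Lemma ae_cube : {ae uniform_cube, forall x, cube x}.
Proof.
exists (~` cube); split => //; first by apply: measurableC; exact: measurable_cube.
by rewrite /= uniform_cubeE setICl measure0 mul0e.
Qed.

Lemma supp_cube : compact (supp uniform_cube).
Proof.
apply: subclosed_compact cube_compact _ => [|x sx]; first exact: closed_supp.
apply: contrapT => nx.
have := sx (~` cube) (closed_openC cube_closed) nx.
by rewrite uniform_cubeE setICl measure0 mul0e ltxx.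
Qed.

Let SdV_ge0 : 0 <= S ^- d. Proof. by rewrite invr_ge0 exprn_ge0// ltW. Qed.

Lemma growth_cube : growth (S ^- d * 2 ^+ d) uniform_cube.
Proof.
move=> x r r0; rewrite uniform_cubeE.
apply: (@le_trans _ _ (leb R d (ball x r) * (S ^- d)%:E)%E).
  apply: lee_wpmul2r; first by rewrite lee_fin.
  apply: le_measure => //; rewrite inE; last exact: rV_measurable_ball.
  by apply: measurableI; [exact: rV_measurable_ball|exact: measurable_cube].
by rewrite leb_ball// -EFinM lee_fin exprMn mulrC mulrA.
Qed.

Lemma Linfty_cube : (Linfty_norm uniform_cube <= 1%:E)%E.
Proof.
pose f (x : 'rV[R]_d) : R := S ^- d * \1_cube x.
have mf : measurable_fun setT f.
  by apply: measurable_funM => //; apply: measurable_indic; exact: measurable_cube.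
have f0 x : 0 <= f x by rewrite mulr_ge0// indicE.
apply: (@le_trans _ _ ('N[leb R d]_+oo [EFin \o f])%E).
  apply: ereal_inf_lbound; exists f => //; split => // B mB.
  under eq_integral do rewrite /f EFinM.
  rewrite ge0_integralZl//; last first.
    by apply: measurable_fun_EFin; apply: measurable_funTS; apply: measurable_indic; exact: measurable_cube.
  rewrite integral_indic//; last exact: measurable_cube.
  by rewrite uniform_cubeE muleC setIC.
rewrite unlock; case: ifPn => // _; apply/ess_supP; apply: aeW => x /=.
rewrite lee_fin ger0_norm// /f indicE; case: (x \in cube); rewrite ?mulr0// mulr1.
by rewrite invf_le1 ?exprn_gt0// exprn_ege1.
Qed.

End uniform_cube.

(** * PART 21 *)

Section potential_bounds.
Context (R : realType) (d : nat).
Hypothesis d0 : (0 < d)%N.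
Implicit Types nu rho mu : probability 'rV[R]_d R.

Lemma gam_nonincreasing (s t : R) : 0 < s -> s <= t -> gam d t <= gam d s.
Proof.
move=> s0 st; have dg (x : R) : s <= x <= t -> is_derive x (1 : R) (gam d) (dgam d x).
  by move=> /andP[sx _]; apply: gam_derive => //; exact: lt_le_trans sx.
have [c _ h] := nonincr_derive st dg.
by rewrite -subr_le0 h mulr_le0_ge0 ?dgam_le0// subr_ge0.
Qed.

Lemma measurable_coulomb_all : measurable_fun setT (@coulomb R d).
Proof.
have mq : measurable_fun setT (fun z : 'rV[R]_d => Num.sqrt (nsq z)).
  apply: measurableT_comp; last exact: measurable_nsq.
  by apply: continuous_measurable_fun; exact: sqrt_continuous.
have -> : @coulomb R d = fun z => gam d (nsq z) by apply/funext => z; rewrite coulombE.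
have mpow k : measurable_fun setT (fun z : 'rV[R]_d => Num.sqrt (nsq z) ^- k).
  under eq_fun => z do rewrite -powR_inv1 ?exprn_ge0 ?sqrtr_ge0//.
  by apply: (measurableT_comp (measurable_powR _)); exact: measurable_funX.
rewrite /gam; case: d mq mpow => [|[|[|n]]] mq mpow; try exact: measurable_funM.
  by apply: measurableT_comp => //; exact: measurable_funM.
apply: measurableT_comp => //; apply: measurable_funM => //.
by apply: measurableT_comp => //; exact: measurable_ln.
Qed.

Let mgx (x : 'rV[R]_d) : measurable_fun setT (fun y : 'rV[R]_d => (coulomb (x - y))%:E).
Proof. by apply: measurable_fun_EFin; apply: measurable_subl; exact: measurable_coulomb_all. Qed.

Lemma measurable_coulomb_potential nu :
  measurable_fun setT (fun x : 'rV[R]_d => \int[nu]_y (coulomb (x - y))%:E)%E.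
Proof.
pose g2 := fun p : 'rV[R]_d * 'rV[R]_d => (coulomb (p.1 - p.2))%:E.
have mg2 : measurable_fun setT g2.
  by apply: measurable_fun_EFin; apply: measurable_sub2; exact: measurable_coulomb_all.
have mp : measurable_fun setT (fun x => \int[nu]_y g2^\+ (x, y))%E.
  by apply: measurable_fun_fubini_tonelli_F => //; exact: measurable_funepos.
have mn : measurable_fun setT (fun x => \int[nu]_y g2^\- (x, y))%E.
  by apply: measurable_fun_fubini_tonelli_F => //; exact: measurable_funeneg.
apply: eq_measurable_fun (emeasurable_funB mp mn) => x _.
rewrite [RHS]integralE; congr (_ - _)%E; apply: eq_integral => y _.
  by rewrite !funeposE.
by rewrite !funenegE.
Qed.

Lemma measurable_potential rho mu : measurable_fun setT (potential rho mu).
Proof. by apply: emeasurable_funB; exact: measurable_coulomb_potential. Qed.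

Lemma coulomb_potential_ge (A b : R) nu x : growth A nu ->
  {ae nu, forall y, `|x - y| <= b} ->
  ((gam d (d%:R * b ^+ 2))%:E <= \int[nu]_y (coulomb (x - y))%:E)%E.
Proof.
move=> gn hb; apply: ae_ge_integral_cst => //.
have nx : {ae nu, forall y, y != x}.
  exists [set x]; split; [exact: rV_measurable_set1|exact: growth_set1 gn|].
  by move=> y /= h; apply: contrapT => /eqP.
apply: filterS2 hb nx => y yb yx; rewrite lee_fin coulombE.
apply: gam_nonincreasing; first by apply: nsq_gt0; rewrite subr_eq0 eq_sym.
rewrite (le_trans (nsq_le_norm2 _))// ler_wpM2l// lerXn2r ?nnegrE//.
exact: le_trans yb.
Qed.

Lemma coulomb_potential_le (a : R) nu x : 0 < a ->
  {ae nu, forall y, a <= `|x - y|} ->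
  (\int[nu]_y (coulomb (x - y))%:E <= (gam d (a ^+ 2))%:E)%E.
Proof.
move=> a0 ha; apply: ae_le_integral_cst => //.
apply: filterS ha => y ya; rewrite lee_fin coulombE.
apply: gam_nonincreasing; first by rewrite exprn_gt0.
by rewrite (le_trans _ (norm2_le_nsq _))// lerXn2r ?nnegrE ?(ltW a0).
Qed.

End potential_bounds.

Section sphere.
Context (R : realType) (d : nat).
Hypothesis d0 : (0 < d)%N.

Lemma cone_sphereE : cone (@unit_sphere R d) = [set x | 0 < nsq x <= 1].
Proof.
apply/seteqP; split=> [_ /= [r r01 [z z1] <-]|x /= /andP[x0 x1]].
  move: r01; rewrite /= in_itv/= => /andP[r0 r1].
  have -> : nsq (r *: z) = r ^+ 2.
    rewrite /nsq; under eq_bigr do rewrite !mxE exprMn.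
    rewrite -mulr_sumr [X in _ * X](_ : _ = 1) ?mulr1//.
    have := congr1 (fun t => t ^+ 2) z1; rewrite /enorm sqr_sqrtr ?expr1n//.
    exact: nsq_ge0.
  by rewrite exprn_gt0// expr_le1// ltW.
have e0 : 0 < enorm x by rewrite sqrtr_gt0.
exists (enorm x) => /=.
  by rewrite in_itv/= e0 -sqrtr1 ler_sqrt.
exists ((enorm x)^-1 *: x); last by rewrite scalerA mulfV ?scale1r ?gt_eqF.
rewrite /unit_sphere/= /enorm.
under eq_bigr do rewrite !mxE exprMn.
rewrite -mulr_sumr sqrtrM ?sqr_ge0// sqrtr_sqr -[Num.sqrt _]/(enorm x).
by rewrite ger0_norm ?invr_ge0 ?(ltW e0)// mulVf// gt_eqF.
Qed.

Lemma sphere_area_gt0 : 0 < sphere_area R d.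
Proof.
have mC : measurable (cone (@unit_sphere R d)).
  rewrite cone_sphereE (_ : mkset _ = (@nsq R d) @^-1` `]0, 1]%classic).
    by rewrite -[X in measurable X]setTI; exact: (measurable_nsq measurableT).
  by apply/seteqP; split=> x /=; rewrite in_itv.
have dR : (0 : R) < d%:R by rewrite ltr0n.
have dR1 : (1 : R) <= d%:R by rewrite ler1n.
have sub1 : ball (const_mx ((2 * d%:R)^-1) : 'rV[R]_d) (4 * d%:R)^-1 `<=` cone (@unit_sphere R d).
  move=> x; rewrite cone_sphereE rV_ballE => xb.
  have hx i : (4 * d%:R)^-1 <= x 0 i <= (d%:R)^-1.
    have := le_lt_trans (coord_le_norm (const_mx ((2 * d%:R)^-1) - x) i) xb.
    rewrite !mxE !invfM ltr_norml.
    have : 0 < d%:R^-1 :> R by rewrite invr_gt0.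
    by move: (d%:R^-1) (x 0 i) => u v u0 /andP[h1 h2]; apply/andP; lra.
  have xn : `|x| <= d%:R^-1.
    apply: norm_le_coord => [|i]; first by rewrite invr_ge0 ltW.
    have /andP[h1 h2] := hx i; rewrite ger0_norm//.
    by rewrite (le_trans _ h1)// invr_ge0 mulr_ge0// ltW.
  apply/andP; split.
    apply: nsq_gt0; apply/eqP => x0.
    have /andP[+ _] := hx (Ordinal d0); rewrite x0 mxE.
    by rewrite leNgt invr_gt0 mulr_gt0.
  rewrite (le_trans (nsq_le_norm2 x))// (@le_trans _ _ (d%:R * d%:R^-1 ^+ 2))//.
    by rewrite ler_wpM2l ?(ltW dR)// lerXn2r ?nnegrE ?invr_ge0 ?(ltW dR).
  by rewrite expr2 mulrA mulfV ?gt_eqF// mul1r invf_le1.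
have sub2 : cone (@unit_sphere R d) `<=` ball (0 : 'rV[R]_d) 2.
  move=> x; rewrite cone_sphereE rV_ballE sub0r normrN => /andP[_ x1].
  rewrite (@le_lt_trans _ _ 1) ?ltr1n//.
  by rewrite -(@expr_le1 _ 2)// (le_trans (norm2_le_nsq x)).
have l1 : (0 < leb R d (cone (@unit_sphere R d)))%E.
  apply: (@lt_le_trans _ _ (leb R d (ball (const_mx ((2 * d%:R)^-1) : 'rV[R]_d) (4 * d%:R)^-1))).
    by rewrite leb_ball ?invr_gt0 ?mulr_gt0// lte_fin exprn_gt0// mulr_gt0// invr_gt0 mulr_gt0.
  by apply: le_measure => //; rewrite inE//; exact: rV_measurable_ball.
have l2 : (leb R d (cone (@unit_sphere R d)) < +oo)%E.
  apply: (@le_lt_trans _ _ (leb R d (ball (0 : 'rV[R]_d) 2))).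
    by apply: le_measure => //; rewrite inE//; exact: rV_measurable_ball.
  by rewrite leb_ball// ltry.
rewrite /sphere_area /sphere_measure; apply: fine_gt0; apply/andP; split.
  by rewrite mule_gt0// lte_fin.
by rewrite lte_mul_pinfty// lee_fin ltW.
Qed.

End sphere.

(** * PART 22 *)

Section no_constant.
Context (R : realType) (d : nat).
Hypothesis d0 : (0 < d)%N.
Implicit Types rho mu : probability 'rV[R]_d R.

Lemma energy_beats_dissipation (c K r : R) : 0 < c -> 1 <= r ->
  exists2 S : R, r <= S & d%:R * (K * S ^- d.-1) ^+ 2 <
    c * (2^-1 * ((gam d (d%:R * S ^+ 2) - gam d (S ^+ 2)) -
                 (gam d (S ^+ 2) - gam d (d%:R * (2 * r) ^+ 2)))).
Proof.
move=> c0 r1; have r0 : 0 < r := lt_le_trans ltr01 r1.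
have K2 : 0 <= K ^+ 2 by exact: sqr_ge0.
have sqS (S : R) : r <= S -> Num.sqrt (S ^+ 2) = S.
  by move=> rS; rewrite sqrtr_sqr ger0_norm// (le_trans (ltW r0)).
have r2 : r <= 2 * r by lra.
case: d d0 => [//|[|[|n]]] _.
- exists (2 * r + 4 * K ^+ 2 / c + 1).
    have : 0 <= 4 * K ^+ 2 / c by rewrite divr_ge0 ?(ltW c0)// mulr_ge0.
    by lra.
  set S := (X in X ^- _); have rS : r <= S.
    have : 0 <= 4 * K ^+ 2 / c by rewrite divr_ge0 ?(ltW c0)// mulr_ge0.
    by rewrite /S; lra.
  rewrite /gam !mul1r expr0 invr1 mulr1 (sqS S rS) (sqS (2 * r) r2).
  have -> : c * (2^-1 * (- (S / 2) - - (S / 2) - (- (S / 2) - - (2 * r / 2)))) =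
     K ^+ 2 + c / 4.
    by rewrite /S; field; rewrite gt_eqF.
  by rewrite ltrDl divr_gt0.
- have s2 : (0 : R) < Num.sqrt 2 by rewrite sqrtr_gt0.
  have lnS (S : R) : r <= S -> ln (Num.sqrt (2 * S ^+ 2)) = ln (Num.sqrt 2) + ln S.
    by move=> rS; rewrite sqrtrM// sqS// lnM ?posrE// (lt_le_trans r0).
  have p0 : (0 : R) < 2 * pi by rewrite mulr_gt0// pi_gt0.
  pose L := ln (Num.sqrt 2) + (ln (Num.sqrt 2) + ln (2 * r)).
  pose N := `|L| + 2 * pi * (4 * K ^+ 2 / c + 1).
  have N0 : 0 <= N.
    by rewrite addr_ge0// mulr_ge0 ?(ltW p0)// addr_ge0// divr_ge0 ?(ltW c0)// mulr_ge0.
  have eN : 1 <= expR N by rewrite -expR0 ler_expR.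
  have rS : r <= r * expR N by rewrite ler_peMr// ltW.
  exists (r * expR N) => //; set S := r * expR N in rS *.
  have lS : N <= ln S by rewrite lnM ?posrE ?expR_gt0// expRK lerDr ln_ge0.
  have S1 : 1 <= S := le_trans r1 rS.
  rewrite /gam (lnS _ rS) (lnS _ r2) (sqS _ rS).
  apply: (@le_lt_trans _ _ (2 * K ^+ 2)).
    rewrite ler_wpM2l// exprMn ler_piMr// expr1 expr_le1// ?invr_ge0 ?(le_trans ler01 S1)//.
    by rewrite invf_le1// (lt_le_trans ltr01).
  have -> : - ((ln (Num.sqrt 2) + ln S) / (2 * pi)) - - (ln S / (2 * pi)) -
    (- (ln S / (2 * pi)) - - ((ln (Num.sqrt 2) + ln (2 * r)) / (2 * pi))) = (ln S - L) / (2 * pi).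
    rewrite /L; move: (2 * pi) p0 (ln S) (ln (Num.sqrt 2)) (ln (2 * r)) => w w0 x y z.
    by field; rewrite gt_eqF.
  have hL : 4 * K ^+ 2 / c + 1 <= (ln S - L) / (2 * pi).
    rewrite ler_pdivlMr// mulrC lerBrDr (le_trans _ lS)// /N addrC.
    by rewrite lerD2r ler_norm.
  have -> : 2 * K ^+ 2 = c * (2^-1 * (4 * K ^+ 2 / c)) by field; rewrite gt_eqF.
  by rewrite ltr_pM2l// ltr_pM2l ?invr_gt0// (lt_le_trans _ hL)// ltrDl.
pose a : R := (n.+1%:R * sphere_area R n.+3)^-1.
have a0 : 0 < a by rewrite invr_gt0 mulr_gt0// sphere_area_gt0.
have gE (s : R) : gam n.+3 s = a * Num.sqrt s ^- n.+1 by [].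
pose G0 := gam n.+3 (n.+3%:R * (2 * r) ^+ 2).
have G00 : 0 < G0.
  rewrite /G0 gE; apply: mulr_gt0 => //; rewrite invr_gt0; apply: exprn_gt0.
  by rewrite sqrtr_gt0; apply: mulr_gt0 => //; apply: exprn_gt0; exact: mulr_gt0.
pose q : R := n.+3%:R * K ^+ 2 + c * a.
have q0 : 0 < q by rewrite ltr_wpDl ?mulr_gt0// mulr_ge0.
exists (r + 4 * q / (c * G0)).
  by rewrite lerDl; apply: divr_ge0; apply: mulr_ge0 => //; exact: ltW.
set S := r + _.
have cG : 0 < c * G0 by exact: mulr_gt0 c0 G00.
have rS : r < S by rewrite ltrDl; apply: divr_gt0 => //; apply: mulr_gt0.
have S1 : 1 <= S := le_trans r1 (ltW rS).
have S0 : 0 < S := lt_le_trans ltr01 S1.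
have Sk k : S ^- k.+1 <= S^-1.
  by rewrite lef_pV2 ?posrE ?exprn_gt0// exprS ler_peMr ?(ltW S0)// exprn_ege1.
have Sq : q * S^-1 < c * (2^-1 * G0).
  have c2 : 0 < c * (2^-1 * G0) by apply: mulr_gt0 => //; apply: mulr_gt0 => //; rewrite invr_gt0.
  rewrite ltr_pdivrMr// -ltr_pdivrMl//.
  apply: (@le_lt_trans _ _ (4 * q / (c * G0))); last by rewrite /S ltrDr.
  have : 0 <= q / (c * G0) by apply: divr_ge0; [|apply: mulr_ge0]; exact: ltW.
  have -> : (c * (2^-1 * G0))^-1 * q = 2 * (q / (c * G0)).
    by field; rewrite !gt_eqF.
  by rewrite -mulrA; lra.
have D1 : n.+3%:R * (K * S ^- n.+3.-1) ^+ 2 <= n.+3%:R * K ^+ 2 * S^-1.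
  rewrite -mulrA ler_wpM2l// exprMn ler_wpM2l//.
  by rewrite exprVn -exprM mulnC/= (Sk (2 * n.+2).-1).
have g1 : gam n.+3 (S ^+ 2) <= a * S^-1.
  by rewrite gE (sqS _ (ltW rS)) ler_wpM2l ?(ltW a0).
have g2 : 0 <= gam n.+3 (n.+3%:R * S ^+ 2).
  by rewrite gE mulr_ge0 ?(ltW a0)// invr_ge0 exprn_ge0// sqrtr_ge0.
apply: (le_lt_trans D1).
apply: (@lt_le_trans _ _ (c * (2^-1 * (- (2 * (a * S^-1)) + G0)))).
  have -> : c * (2^-1 * (- (2 * (a * S^-1)) + G0)) = c * (2^-1 * G0) - c * a * S^-1.
    by field; rewrite gt_eqF.
  by rewrite ltrBrDr -mulrDl.
rewrite ler_pM2l// ler_pM2l ?invr_gt0// -/G0.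
by move: g1 g2; lra.
Qed.

Lemma cube_dist (S : R) (x y : 'rV[R]_d) : 0 <= S -> cube S x -> cube S y -> `|x - y| <= S.
Proof.
move=> S0 qx qy; apply: norm_le_coord => // i; rewrite !mxE ler_norml.
have := qx i; have := qy i; rewrite /= !in_itv/= => /andP[? ?] /andP[? ?].
by apply/andP; lra.
Qed.

Lemma cube_far (S r : R) (x y : 'rV[R]_d) : 0 <= r -> r <= S -> cube S x -> `|y| <= r ->
  S <= `|x - y|.
Proof.
move=> r0 rS qx yr; pose i := Ordinal d0.
have h1 := coord_le_norm (x - y) i; have h2 := coord_le_norm y i.
have := qx i; rewrite /= in_itv/= => /andP[xi _].
apply: (le_trans _ h1); rewrite !mxE (le_trans _ (ler_norm _))//.
by have := ler_norm (y 0 i); lra.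
Qed.

Lemma dissipation_cube mu A (S r : R) : growth A mu -> 1 <= r -> r <= S ->
  {ae mu, forall y, `|y| <= r} ->
  (dissipation (uniform_cube mu S) mu <=
    (d%:R * (kap1 R d * (4 ^+ d + 2) * S ^- d.-1) ^+ 2)%:E)%E.
Proof.
move=> gm r1 rS hm; have r0 : 0 <= r := le_trans ler01 r1.
have S1 := le_trans r1 rS; have S0 : 0 < S := lt_le_trans ltr01 S1.
set rho := uniform_cube mu S.
have gr : growth (S ^- d * 2 ^+ d) rho := growth_cube mu S1.
have k0 := kap1_gt0 R d.
have kb i (z : 'rV[R]_d) : S <= `|z| -> `|gk i z| <= kap1 R d * S ^- d.-1.
  move=> Sz; have z0 : z != 0 by rewrite -normr_gt0 (lt_le_trans S0).
  rewrite (le_trans (gk_bound1 i z0))// ler_wpM2l ?(ltW k0)//.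
  rewrite lef_pV2 ?posrE ?exprn_gt0 ?normr_gt0// lerXn2r ?nnegrE// ltW//.
pose M := Num.max (S ^- d * 2 ^+ d) A.
have gr' : growth M rho by apply: growthW gr; rewrite le_max lexx.
have gm' : growth M mu by apply: growthW gm; rewrite le_max lexx orbT.
have B0 : 0 <= kap1 R d * S ^- d.-1 by rewrite mulr_ge0 ?(ltW k0)// invr_ge0 exprn_ge0// ltW.
apply: (dissipation_le d0 gr' gm').
  by rewrite mulrAC mulr_ge0// addr_ge0// exprn_ge0.
apply: filterS (ae_cube mu S1) => x qx i.
have h1 : `|cf i rho x| <= kap1 R d * S ^- d.-1 * (4 ^+ d + 1).
  have [_] := @singular_kernel_integral R d d0 _ rho (gk i) x (kap1 R d) S _ gr k0 S0 B0
     (measurable_gk i) (fun z z0 _ => gk_bound1 i z0) (kb i).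
  move=> /le_trans; apply; rewrite le_eqVlt; apply/orP; left; apply/eqP.
  have -> : S ^- d * 2 ^+ d * 2 ^+ d * S = S ^- d.-1 * 4 ^+ d.
    have -> : (4 : R) = 2 * 2 by rewrite -natrM.
    rewrite exprMn -[X in S ^- X](prednK d0) exprS invfM.
    by field; rewrite ?expf_neq0 gt_eqF.
  by rewrite mulrDr mulr1 mulrA.
have h2 : `|cf i mu x| <= kap1 R d * S ^- d.-1.
  apply: ae_norm_Rintegral_le; first exact: (measurable_subl x (measurable_gk i)).
  by apply: (filterS _ hm) => y yr; apply: kb; exact: (cube_far r0 rS).
rewrite (le_trans (ler_normB _ _))// (le_trans (lerD h1 h2))//.
by rewrite le_eqVlt; apply/orP; left; apply/eqP; ring.
Qed.

Lemma MMD2_cube mu A (S r : R) : growth A mu -> 1 <= r -> r <= S ->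
  {ae mu, forall y, `|y| <= r} ->
  ((2^-1 * ((gam d (d%:R * S ^+ 2) - gam d (S ^+ 2)) -
            (gam d (S ^+ 2) - gam d (d%:R * (2 * r) ^+ 2))))%:E
     <= MMD2 (uniform_cube mu S) mu)%E.
Proof.
move=> gm r1 rS hm; have r0 : 0 <= r := le_trans ler01 r1.
have S1 := le_trans r1 rS; have S0 : 0 < S := lt_le_trans ltr01 S1.
set rho := uniform_cube mu S.
have gr : growth (S ^- d * 2 ^+ d) rho := growth_cube mu S1.
have hq := ae_cube mu S1; rewrite -/rho in hq.
rewrite /MMD2 EFinM lee_wpmul2l// EFinB leeB//.
  apply: ae_ge_integral_cst; first exact: measurable_potential.
  apply: (filterS _ hq) => x qx; rewrite EFinB leeB//.
    by apply: (coulomb_potential_ge d0 gr); apply: (filterS _ hq) => y; exact: cube_dist (ltW S0) qx.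
  apply: (coulomb_potential_le d0 S0); apply: (filterS _ hm) => y; exact: (cube_far r0 rS qx).
apply: ae_le_integral_cst; first exact: measurable_potential.
apply: (filterS _ hm) => x xr; rewrite EFinB leeB//.
  apply: (coulomb_potential_le d0 S0); apply: (filterS _ hq) => y qy.
  by rewrite distrC; exact: (cube_far r0 rS qy).
apply: (coulomb_potential_ge d0 gm); apply: (filterS _ hm) => y yr.
by rewrite (le_trans (ler_normB _ _))// mulr_natl mulr2n lerD.
Qed.

Theorem no_PL_constant mu : (Linfty_norm mu < +oo)%E -> compact (supp mu) ->
  ~ (exists c : R -> R,
      (forall M : R, 0 < M -> 0 < c M) /\
      (forall (M : R) rho, 0 < M ->
        compact (supp rho) -> (Linfty_norm rho <= M%:E)%E ->
        ((c M)%:E * MMD2 rho mu <= dissipation rho mu)%E)).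
Proof.
move=> mu_bounded mu_compact [c [cpos PL]].
have [r r1 hm] := ae_norm_bound mu_compact.
have [A gm] := Linfty_fin_growth mu_bounded.
have c0 := cpos 1 ltr01.
have [S rS gap] := energy_beats_dissipation (kap1 R d * (4 ^+ d + 2)) c0 r1.
have S1 := le_trans r1 rS.
have := PL 1 _ ltr01 (supp_cube S1) (Linfty_cube mu S1).
apply/negP; rewrite -ltNge.
apply: (le_lt_trans (dissipation_cube gm r1 rS hm)).
apply: (@lt_le_trans _ _ (c 1 * _)%:E); first by rewrite lte_fin; exact: gap.
by rewrite EFinM lee_wpmul2l ?lee_fin ?(ltW c0)//; exact: (MMD2_cube gm r1 rS hm).
Qed.

End no_constant.

Theorem corollary1p18 (R : realType) (d : nat) (mu : probability 'rV[R]_d R)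
    (hd : (1 <= d)%N)
    (mu_bounded : (Linfty_norm mu < +oo)%E)
    (mu_compact : compact (supp mu)) :
  (forall (rho0 : nat -> probability 'rV[R]_d R)
      (rho : nat -> R -> probability 'rV[R]_d R) (Dn : nat -> R)
      (c0 c1 C1 : R) (n0 : nat),
    (forall n, compact (supp (rho0 n))) ->
    (ereal_sup [set Linfty_norm (rho0 n) | n in [set: nat]] < +oo)%E ->
    (ereal_sup [set set_diam (supp (rho0 n)) | n in [set: nat]] < +oo)%E ->
    (forall n, Dn n = set_dist (supp (rho0 n)) (supp mu)) ->
    Dn n @[n --> \oo] --> +oo ->
    (forall n, bounded_solution mu (rho0 n) (rho n)) ->
    persistence mu rho0 rho Dn c0 c1 C1 n0 ->
    exists (t : nat -> R) (C : R),
      (forall n, (n0 <= n)%N ->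
        0 < t n < c0 * Dn n /\
        (dissipation (rho n (t n)) mu / MMD2 (rho n (t n)) mu
           <= (C / Dn n)%:E)%E) /\
      C / Dn n @[n --> \oo] --> 0) /\
  ~ (exists c : R -> R,
      (forall M : R, 0 < M -> 0 < c M) /\
      (forall (M : R) (rho : probability 'rV[R]_d R), 0 < M ->
        compact (supp rho) -> (Linfty_norm rho <= M%:E)%E ->
        ((c M)%:E * MMD2 rho mu <= dissipation rho mu)%E)).
Proof.
split; last exact: no_PL_constant.
move=> rho0 rho Dn c0 c1 C1 n0 _ _ _ _ Doo sol pers.
exact: (small_ratio_times hd mu_bounded Doo sol pers).
Qed.
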